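(* Fix $N_1,N_2\ge0$. For $\alpha=(\alpha_1,\alpha_2)\in\mathbb{R}^2$ let $(u(r;\alpha),v(r;\alpha))$ be the radial solution of $$\begin{cases}\Delta u=-2e^u+e^v+4e^{2u}-2e^{2v}-e^{u+v}+4\pi N_1\delta_0\\ \Delta v=e^u-2e^v-2e^{2u}+4e^{2v}-e^{u+v}+4\pi N_2\delta_0\end{cases}$$ with $u(r)=2N_1\log r+\alpha_1+o(1)$ and $v(r)=2N_2\log r+\alpha_2+o(1)$ as $r\to0^+$. Let $$\Omega=\{\alpha\in\mathbb{R}^2: (u(r;\alpha),v(r;\alpha))\text{ is a non-topological solution}\}.$$ Then $\Omega$ is an open set. Furthermore, if $\alpha\in\partial\Omega$, then $(u(r;\alpha),v(r;\alpha))$ is either a topological solution or a mixed-type solution.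
   Context: Here $\delta_0$ is the Dirac measure at the origin of $\mathbb{R}^2$ and $r=|x|$. A radial solution satisfies $u_{rr}+\frac1r u_r=-2e^u+e^v+4e^{2u}-2e^{2v}-e^{u+v}$ and $v_{rr}+\frac1r v_r=e^u-2e^v-2e^{2u}+4e^{2v}-e^{u+v}$ for $r>0$ on its maximal interval of existence, with the stated behaviour at $0$; it is entire if it exists for all $r\in(0,\infty)$. An entire radial solution is called topological if $(u,v)\to(0,0)$ as $r\to\infty$; non-topological if $(u,v)\to(-\infty,-\infty)$ as $r\to\infty$; and mixed-type if $(u,v)\to(\log\frac12,-\infty)$ or $(u,v)\to(-\infty,\log\frac12)$ as $r\to\infty$. *)

(* Defs.v *)
From Stdlib Require Import Reals.
From Coquelicot Require Import Coquelicot.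
Open Scope R_scope.

Definition F1 (u v : R) : R :=
  - 2 * exp u + exp v + 4 * exp (2 * u) - 2 * exp (2 * v) - exp (u + v).

Definition F2 (u v : R) : R :=
  exp u - 2 * exp v - 2 * exp (2 * u) + 4 * exp (2 * v) - exp (u + v).

(* [w'' + w'/r = g] at [r].  The first conjunct is not implied by the second:
   [Derive w] is a total function, with a junk value where [w] is not
   differentiable. *)
Definition radial_laplace_eq (w : R -> R) (r g : R) : Prop :=
  ex_derive w r /\ ex_derive (Derive w) r /\
  Derive_n w 2 r + / r * Derive w r = g.

(* [w(r) = 2 N log r + a + o(1)] as [r -> 0+].  As [Delta (2 N log |x|)] is
   [4 pi N delta_0] in the plane, this is what carries the Dirac mass. *)
Definition behaviour_at_0 (N a : R) (w : R -> R) : Prop :=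
  filterlim (fun r => w r - (2 * N * ln r + a)) (at_right 0) (locally 0).

(* [(u, v)] is a radial solution on [(0, T)], where [T] may be [p_infty]; the
   values of [u] and [v] outside this interval are irrelevant. *)
Definition radial_solution_on (N1 N2 : R) (alpha : R * R)
    (T : Rbar) (u v : R -> R) : Prop :=
  Rbar_lt 0 T /\
  (forall r : R, 0 < r -> Rbar_lt r T ->
     radial_laplace_eq u r (F1 (u r) (v r)) /\
     radial_laplace_eq v r (F2 (u r) (v r))) /\
  behaviour_at_0 N1 (fst alpha) u /\
  behaviour_at_0 N2 (snd alpha) v.

(* [(u, v)] on [(0, T)] is the maximal solution [(u(.; alpha), v(.; alpha))]:
   it extends every solution with the same behaviour at 0. *)
Definition the_radial_solution (N1 N2 : R) (alpha : R * R)
    (T : Rbar) (u v : R -> R) : Prop :=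
  radial_solution_on N1 N2 alpha T u v /\
  forall (T' : Rbar) (u' v' : R -> R),
    radial_solution_on N1 N2 alpha T' u' v' ->
    Rbar_le T' T /\
    forall r : R, 0 < r -> Rbar_lt r T' -> u' r = u r /\ v' r = v r.

Definition entire (T : Rbar) : Prop := T = p_infty.

Definition topological (T : Rbar) (u v : R -> R) : Prop :=
  entire T /\ is_lim u p_infty 0 /\ is_lim v p_infty 0.

Definition non_topological (T : Rbar) (u v : R -> R) : Prop :=
  entire T /\ is_lim u p_infty m_infty /\ is_lim v p_infty m_infty.

Definition mixed_type (T : Rbar) (u v : R -> R) : Prop :=
  entire T /\
  ((is_lim u p_infty (ln (1 / 2)) /\ is_lim v p_infty m_infty) \/
   (is_lim u p_infty m_infty /\ is_lim v p_infty (ln (1 / 2)))).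

Definition Omega (N1 N2 : R) (alpha : R * R) : Prop :=
  exists (T : Rbar) (u v : R -> R),
    the_radial_solution N1 N2 alpha T u v /\ non_topological T u v.

Definition boundary {X : UniformSpace} (D : X -> Prop) (x : X) : Prop :=
  forall P : X -> Prop, locally x P ->
    (exists y : X, P y /\ D y) /\ (exists y : X, P y /\ ~ D y).

(* Main.v *)
(* In the variables p = r u', q = r v' the functions 2 u + v and u + 2 v have fluxes 2 p + q and
   2 q + p whose derivatives are - 3 r f1 and - 3 r f2, with f1 = e^u (1 - 2 e^u + e^v) and
   f2 = e^v (1 - 2 e^v + e^u).  With G = e^u + e^v - e^(2u) - e^(2v) + e^(u+v), the energy
   E = (p^2 + p q + q^2) / (3 r^2) + G is nonincreasing.

   Non-topological solutions satisfy u, v <= 0 by the maximum principle, a property that passes to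
   limits and forces solutions to be entire.  For an entire solution with u, v <= 0 either both
   fluxes stay nonnegative, then 2 u + v and u + 2 v increase to finite limits and the solution is
   topological; or both fluxes are eventually negative, and then 2 u + v and u + 2 v tend to
   minus infinity.  In the second case e^u cannot leave a neighbourhood of 1/2 downwards at late
   times: it would do so with a kinetic energy bounded below for a time comparable with r, although
   the integral of (kinetic energy) / r is finite.  So the solution is non-topological or of mixed
   type.

   A non-topological solution eventually has E < 1/4 and e^u + e^v < 1/2, and G >= 1/4 on the line
   e^u + e^v = 1/2: this potential well traps all nearby solutions, whence openness.

   Local theory: cutting the exponentials off at a level M makes the system globally Lipschitz, and
   Picard iteration in the norm weighted by exp (- L r^2) converges on the whole half line. *)

Require Import Defs.
From Stdlib Require Import Reals Lra Lia Classical.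
From Coquelicot Require Import Coquelicot.
Open Scope R_scope.

(** * Real induction and monotonicity *)

(** Openness is used twice: since [Omega] is open, a boundary point lies outside it, which strikes
    the non-topological case from the list of possible limits.

    The level 1/4 comes from s = e^u + e^v, for which G = s - s^2 + 3 e^(u+v). So G >= 1/4 on s =
    1/2, and 1/4 is also the value of G at e^u = 1/2, e^v = 0, the limit of a mixed-type solution:
    the well shuts out exactly that end.

    The flux dichotomy has to exclude fluxes of lasting opposite sign.

    With both fluxes negative, the limits of 2 u + v and u + 2 v do not control u and v separately,
    and u might oscillate between log(1/2) and minus infinity. Finite dissipation forbids this only
    once every late fall of u is known to cost a definite amount. A one-dimensional energy of u,
    compared with E, supplies it: the fall leaves so much flux that the kinetic energy stays bounded
    below on a whole window [r, k r]. *)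

(** The continuation principle behind all barrier and sign arguments: there a property makes some
    function monotone, and this monotonicity in turn carries the property to the next point. *)
Lemma real_induction (P : R -> Prop) (a b : R) :
  (forall r, a <= r <= b -> P r -> locally r P) ->
  P a ->
  (forall r, a < r <= b -> (forall s, a <= s < r -> P s) -> P r) ->
  forall r, a <= r <= b -> P r.
Proof.
  intros Hopen Ha Hlim r Hr.
  apply NNPP; intros HPr.
  set (A := fun x => a <= x <= r /\ forall s, a <= s <= x -> P s).
  assert (HA : A a).
  { split; [lra |]. intros s Hs; replace s with a by lra; exact Ha. }
  destruct (completeness A) as [c [Hub Hlub]].
  { exists r; intros x [Hx _]; lra. }
  { exists a; exact HA. }
  assert (Hac : a <= c) by (apply Hub, HA).
  assert (Hcr : c <= r) by (apply Hlub; intros x [Hx _]; lra).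
  assert (Hbelow : forall s, a <= s < c -> P s).
  { intros s Hs. apply NNPP; intros HPs.
    assert (c <= s); [| lra].
    apply Hlub; intros x [Hx Hx'].
    destruct (Rle_lt_dec x s) as [| Hsx]; [assumption |].
    elim HPs; apply Hx'; lra. }
  assert (HPc : P c).
  { destruct (Req_dec a c) as [<- | Hne]; [exact Ha |].
    apply Hlim; [lra | exact Hbelow]. }
  assert (c < r).
  { destruct (Req_dec c r) as [-> | Hne]; [contradiction | lra]. }
  destruct (Hopen c ltac:(lra) HPc) as [e He].
  pose proof (cond_pos e) as He0.
  set (d := Rmin (c + e / 2) r).
  assert (Hd : c < d <= r /\ d <= c + e / 2).
  { unfold d, Rmin; destruct (Rle_dec _ _); lra. }
  assert (HAd : A d).
  { split; [lra |]. intros s Hs.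
    destruct (Rlt_le_dec s c) as [Hsc | Hsc]; [apply Hbelow; lra |].
    apply He. change (Rabs (s - c) < e). rewrite Rabs_right; lra. }
  pose proof (Hub d HAd); lra.
Qed.

Lemma locally_lt {T : UniformSpace} (f g : T -> R) (x : T) :
  continuous f x -> continuous g x -> f x < g x ->
  locally x (fun y => f y < g y).
Proof.
  intros Hf Hg Hlt.
  assert (Hc : continuous (fun y => g y - f y) x).
  { apply (continuous_minus (V := R_NormedModule) g f); assumption. }
  assert (H : locally (g x - f x) (fun y => 0 < y)) by (apply open_gt; lra).
  specialize (Hc _ H); unfold filtermap in Hc; revert Hc.
  apply filter_imp; intros y Hy; lra.
Qed.

Lemma is_derive_continuous (f : R -> R) (x l : R) :
  is_derive f x l -> continuous f x.
Proof. intros H; apply (ex_derive_continuous (V := R_NormedModule) f x); exists l; exact H. Qed.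

Lemma derive_nonneg_le (f df : R -> R) (a b : R) :
  a <= b ->
  (forall x, a <= x <= b -> is_derive f x (df x)) ->
  (forall x, a < x < b -> 0 <= df x) ->
  f a <= f b.
Proof.
  intros [Hab | ->] Hf Hdf; [| lra].
  destruct (MVT_cor2 f df a b Hab) as [c [Hc Hcab]].
  { intros c Hc; apply is_derive_Reals, Hf, Hc. }
  pose proof (Hdf c Hcab).
  assert (0 <= df c * (b - a)) by (apply Rmult_le_pos; lra).
  lra.
Qed.

Lemma derive_pos_lt (f df : R -> R) (a b : R) :
  a < b ->
  (forall x, a <= x <= b -> is_derive f x (df x)) ->
  (forall x, a < x < b -> 0 < df x) ->
  f a < f b.
Proof.
  intros Hab Hf Hdf.
  destruct (MVT_cor2 f df a b Hab) as [c [Hc Hcab]].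
  { intros c Hc; apply is_derive_Reals, Hf, Hc. }
  pose proof (Hdf c Hcab).
  assert (0 < df c * (b - a)) by (apply Rmult_lt_0_compat; lra).
  lra.
Qed.

Lemma derive_nonpos_le (f df : R -> R) (a b : R) :
  a <= b ->
  (forall x, a <= x <= b -> is_derive f x (df x)) ->
  (forall x, a < x < b -> df x <= 0) ->
  f b <= f a.
Proof.
  intros Hab Hf Hdf.
  cut (- f a <= - f b); [lra |].
  apply (derive_nonneg_le (fun x => - f x) (fun x => - df x)); [assumption | |].
  - intros x Hx; apply (is_derive_opp f), Hf, Hx.
  - intros x Hx; specialize (Hdf x Hx); lra.
Qed.

Lemma derive_neg_lt (f df : R -> R) (a b : R) :
  a < b ->
  (forall x, a <= x <= b -> is_derive f x (df x)) ->
  (forall x, a < x < b -> df x < 0) ->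
  f b < f a.
Proof.
  intros Hab Hf Hdf.
  cut (- f a < - f b); [lra |].
  apply (derive_pos_lt (fun x => - f x) (fun x => - df x)); [assumption | |].
  - intros x Hx; apply (is_derive_opp f), Hf, Hx.
  - intros x Hx; specialize (Hdf x Hx); lra.
Qed.

Lemma derive_le_compare (f g df dg : R -> R) (a b : R) :
  a <= b ->
  (forall x, a <= x <= b -> is_derive f x (df x)) ->
  (forall x, a <= x <= b -> is_derive g x (dg x)) ->
  (forall x, a < x < b -> df x <= dg x) ->
  f b - f a <= g b - g a.
Proof.
  intros Hab Hf Hg Hle.
  cut (g a - f a <= g b - f b); [lra |].
  apply (derive_nonneg_le (fun x => g x - f x) (fun x => dg x - df x)); [assumption | |].
  - intros x Hx; apply (is_derive_minus g f); [apply Hg | apply Hf]; exact Hx.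
  - intros x Hx; specialize (Hle x Hx); lra.
Qed.

Lemma derive_pos_right (f : R -> R) (x l : R) :
  is_derive f x l -> 0 < l ->
  exists e : posreal, forall y, x < y < x + e -> f x < f y.
Proof.
  intros Hf Hl.
  apply is_derive_Reals in Hf.
  destruct (Hf l Hl) as [d Hd].
  exists d; intros y Hy.
  specialize (Hd (y - x) ltac:(lra)).
  rewrite Rabs_right in Hd by lra; specialize (Hd ltac:(lra)).
  replace (x + (y - x)) with y in Hd by ring.
  apply Rabs_def2 in Hd.
  assert (0 < (f y - f x) / (y - x)) by lra.
  assert (Hp : 0 < (f y - f x) / (y - x) * (y - x)) by (apply Rmult_lt_0_compat; lra).
  replace ((f y - f x) / (y - x) * (y - x)) with (f y - f x) in Hp by (field; lra).
  lra.
Qed.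

Lemma derive_pos_left (f : R -> R) (x l : R) :
  is_derive f x l -> 0 < l ->
  exists e : posreal, forall y, x - e < y < x -> f y < f x.
Proof.
  intros Hf Hl.
  apply is_derive_Reals in Hf.
  destruct (Hf l Hl) as [d Hd].
  exists d; intros y Hy.
  specialize (Hd (y - x) ltac:(lra)).
  rewrite Rabs_left in Hd by lra; specialize (Hd ltac:(lra)).
  replace (x + (y - x)) with y in Hd by ring.
  apply Rabs_def2 in Hd.
  assert (0 < (f y - f x) / (y - x)) by lra.
  assert (Hp : 0 < (f y - f x) / (y - x) * (x - y)) by (apply Rmult_lt_0_compat; lra).
  replace ((f y - f x) / (y - x) * (x - y)) with (f x - f y) in Hp by (field; lra).
  lra.
Qed.

(** * Limits and growth at infinity *)

Lemma is_lim_p_infty_le (f : R -> R) (l : R) (c R0 : R) :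
  is_lim f p_infty l -> (forall r, R0 < r -> f r <= c) -> l <= c.
Proof.
  intros Hf Hc.
  refine (is_lim_le_loc f (fun _ => c) p_infty l c _ Hf (is_lim_const c p_infty)).
  exists R0; exact Hc.
Qed.

Lemma decreasing_limit (f : R -> R) (r0 K : R) :
  (forall x y, r0 <= x <= y -> f y <= f x) ->
  (forall x, r0 <= x -> K <= f x) ->
  exists l : R, K <= l /\ is_lim f p_infty l /\ forall x, r0 <= x -> l <= f x.
Proof.
  intros Hdec HK.
  set (A := fun y => exists x, r0 <= x /\ y = - f x).
  destruct (completeness A) as [m [Hub Hlub]].
  { exists (- K); intros y [x [Hx ->]]; specialize (HK x Hx); lra. }
  { exists (- f r0), r0; split; [lra | reflexivity]. }
  assert (Hle : forall x, r0 <= x -> - m <= f x).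
  { intros x Hx. assert (- f x <= m); [| lra].
    apply Hub; exists x; split; [exact Hx | reflexivity]. }
  exists (- m); repeat split; [| | exact Hle].
  - assert (m <= - K); [| lra].
    apply Hlub; intros y [x [Hx ->]]; specialize (HK x Hx); lra.
  - apply is_lim_spec; intros eps.
    destruct (classic (exists x, r0 <= x /\ f x < - m + eps)) as [[x [Hx Hfx]] | Hno].
    + exists (Rmax x r0); intros y Hy.
      assert (x < y) by (apply Rle_lt_trans with (2 := Hy), Rmax_l).
      specialize (Hle y ltac:(lra)); specialize (Hdec x y ltac:(lra)).
      apply Rabs_def1; lra.
    + exfalso.
      assert (m <= m - eps); [| pose proof (cond_pos eps); lra].
      apply Hlub; intros y [x [Hx ->]].
      destruct (Rlt_le_dec (f x) (- m + eps)); [| lra].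
      elim Hno; exists x; split; assumption.
Qed.

Lemma increasing_limit (f : R -> R) (r0 K : R) :
  (forall x y, r0 <= x <= y -> f x <= f y) ->
  (forall x, r0 <= x -> f x <= K) ->
  exists l : R, is_lim f p_infty l.
Proof.
  intros Hinc HK.
  destruct (decreasing_limit (fun x => - f x) r0 (- K)) as [l [_ [Hl _]]].
  - intros x y Hxy; specialize (Hinc x y Hxy); lra.
  - intros x Hx; specialize (HK x Hx); lra.
  - exists (- l).
    apply (is_lim_ext (fun x => - - f x)); [intros; ring |].
    apply (is_lim_opp _ _ _ Hl).
Qed.

Lemma decreasing_unbounded_limit (f : R -> R) (r0 : R) :
  (forall x y, r0 <= x <= y -> f y <= f x) ->
  (forall K, exists x, r0 <= x /\ f x < K) ->
  is_lim f p_infty m_infty.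
Proof.
  intros Hdec Hunb.
  apply is_lim_spec; intros K.
  destruct (Hunb K) as [x [Hx HK]].
  exists x; intros y Hy; specialize (Hdec x y ltac:(lra)); lra.
Qed.

(** In the variable [ln r] the derivative of [f] is [p], so [f] gains at least [c] per unit of
    logarithm. Applied to [u] with its flux, it contradicts an upper bound on [u] whenever the flux
    stays positive. *)
Lemma log_growth_unbounded (f p : R -> R) (r0 c K : R) :
  0 < r0 -> 0 < c ->
  (forall r, r0 <= r -> is_derive f r (p r / r)) ->
  (forall r, r0 <= r -> c <= p r) ->
  exists r, r0 <= r /\ K < f r.
Proof.
  intros Hr0 Hc Hf Hp.
  set (k := Rmax 0 ((K + 1 - f r0) / c)).
  assert (Hk0 : 0 <= k) by apply Rmax_l.
  assert (Hk : K + 1 - f r0 <= c * k).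
  { apply Rmult_le_reg_r with (/ c); [apply Rinv_0_lt_compat; lra |].
    replace (c * k * / c) with k by (field; lra). apply Rmax_r. }
  set (r := r0 * exp k).
  assert (Hr : r0 <= r).
  { unfold r. pose proof (exp_ineq1_le k). rewrite <- (Rmult_1_r r0) at 1.
    apply Rmult_le_compat_l; lra. }
  exists r; split; [exact Hr |].
  assert (Hcmp : c * ln r - c * ln r0 <= f r - f r0).
  { apply (derive_le_compare (fun x => c * ln x) f (fun x => c * / x) (fun x => p x / x)).
    - exact Hr.
    - intros x Hx. apply (is_derive_scal ln). apply is_derive_Reals, derivable_pt_lim_ln; lra.
    - intros x Hx; apply Hf; lra.
    - intros x Hx. unfold Rdiv; apply Rmult_le_compat_r.
      + apply Rlt_le, Rinv_0_lt_compat; lra.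
      + apply Hp; lra. }
  unfold r in Hcmp at 1; rewrite ln_mult, ln_exp in Hcmp by (try apply exp_pos; lra).
  lra.
Qed.

Lemma log_decay_unbounded (f p : R -> R) (r0 c K : R) :
  0 < r0 -> 0 < c ->
  (forall r, r0 <= r -> is_derive f r (p r / r)) ->
  (forall r, r0 <= r -> p r <= - c) ->
  exists r, r0 <= r /\ f r < K.
Proof.
  intros Hr0 Hc Hf Hp.
  destruct (log_growth_unbounded (fun x => - f x) (fun x => - p x) r0 c (- K)) as [r [Hr HK]];
    [exact Hr0 | exact Hc | | | exists r; split; lra].
  - intros r Hr. replace (- p r / r) with (- (p r / r)) by (unfold Rdiv; ring).
    apply (is_derive_opp f), Hf, Hr.
  - intros r Hr; specialize (Hp r Hr); lra.
Qed.

(** Only the linear lower bound [c r0 (r - r0)] for the gain is extracted, which is enough to pass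
    any level [K]. *)
Lemma quadratic_growth (p g : R -> R) (r0 c K : R) :
  0 < r0 -> 0 < c ->
  (forall r, r0 <= r -> is_derive p r (r * g r)) ->
  (forall r, r0 <= r -> c <= g r) ->
  exists r1, r0 <= r1 /\ forall r, r1 <= r -> K <= p r.
Proof.
  intros Hr0 Hc Hp Hg.
  set (k := Rmax 0 ((K - p r0) / (c * r0))).
  assert (Hcr : 0 < c * r0) by (apply Rmult_lt_0_compat; lra).
  assert (Hk0 : 0 <= k) by apply Rmax_l.
  assert (Hk : K - p r0 <= c * r0 * k).
  { apply Rmult_le_reg_r with (/ (c * r0)); [apply Rinv_0_lt_compat; lra |].
    replace (c * r0 * k * / (c * r0)) with k by (field; lra). apply Rmax_r. }
  exists (r0 + k); split; [lra |]. intros r Hr.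
  assert (Hcmp : c * r0 * r - c * r0 * r0 <= p r - p r0).
  { apply (derive_le_compare (fun x => c * r0 * x) p (fun x => c * r0) (fun x => x * g x));
      [lra | | |].
    - intros x Hx. auto_derive; [exact I | ring].
    - intros x Hx; apply Hp; lra.
    - intros x Hx. rewrite (Rmult_comm c). apply Rmult_le_compat; try lra. apply Hg; lra. }
  assert (c * r0 * k <= c * r0 * (r - r0)) by (apply Rmult_le_compat_l; lra).
  lra.
Qed.

(** * One-sided limits *)

Lemma at_right_intro (P : R -> Prop) (x d : R) :
  0 < d -> (forall y, x < y < x + d -> P y) -> at_right x P.
Proof.
  intros Hd H. exists (mkposreal d Hd); intros y Hy Hxy.
  apply H. change (Rabs (y - x) < d) in Hy. apply Rabs_def2 in Hy; lra.
Qed.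

Lemma at_right_elim (P : R -> Prop) (x : R) :
  at_right x P -> exists d, 0 < d /\ forall y, x < y < x + d -> P y.
Proof.
  intros [d Hd]. exists d; split; [apply cond_pos |].
  intros y Hy; apply Hd; [| lra].
  change (Rabs (y - x) < d). rewrite Rabs_right; lra.
Qed.

Lemma filterlim_at_right_spec (f : R -> R) (x l : R) :
  filterlim f (at_right x) (locally l) <->
  forall e, 0 < e -> exists d, 0 < d /\ forall y, x < y < x + d -> Rabs (f y - l) < e.
Proof.
  split.
  - intros H e He. apply at_right_elim.
    apply (H (fun z => Rabs (z - l) < e)).
    exists (mkposreal e He); intros z Hz; exact Hz.
  - intros H P [e He].
    destruct (H e (cond_pos e)) as [d [Hd Hy]].
    apply (at_right_intro _ x d Hd); intros y Hxy.
    apply He, Hy, Hxy.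
Qed.

(** * The cut-off nonlinearity and radial potentials *)

(** Both right-hand sides are this polynomial in [U = e^u], [V = e^v], with the arguments exchanged
    for the second one. Estimates become polynomial inequalities, and the symmetry lets each
    statement about [u] serve for [v]. *)
Definition cs_poly (U V : R) : R := - 2 * U + V + 4 * (U * U) - 2 * (V * V) - U * V.

Lemma continuous_Rplus {T : UniformSpace} (f g : T -> R) (x : T) :
  continuous f x -> continuous g x -> continuous (fun y => f y + g y) x.
Proof. apply (continuous_plus (V := R_NormedModule)). Qed.

Lemma continuous_Rminus {T : UniformSpace} (f g : T -> R) (x : T) :
  continuous f x -> continuous g x -> continuous (fun y => f y - g y) x.
Proof. apply (continuous_minus (V := R_NormedModule)). Qed.

Lemma continuous_Rmult {T : UniformSpace} (f g : T -> R) (x : T) :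
  continuous f x -> continuous g x -> continuous (fun y => f y * g y) x.
Proof. apply (continuous_mult (K := R_AbsRing)). Qed.

Lemma continuous_Rexp {T : UniformSpace} (f : T -> R) (z : T) :
  continuous f z -> continuous (fun w => exp (f w)) z.
Proof. intros Hf. apply (continuous_comp f exp); [exact Hf | apply continuous_exp]. Qed.

Lemma continuous_cs_poly {T : UniformSpace} (f g : T -> R) (x : T) :
  continuous f x -> continuous g x -> continuous (fun y => cs_poly (f y) (g y)) x.
Proof.
  intros Hf Hg. unfold cs_poly.
  assert (Hff : continuous (fun y => f y * f y) x) by (apply continuous_Rmult; assumption).
  assert (Hgg : continuous (fun y => g y * g y) x) by (apply continuous_Rmult; assumption).
  assert (Hfg : continuous (fun y => f y * g y) x) by (apply continuous_Rmult; assumption).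
  assert (Hc : forall (c : R) (h : T -> R), continuous h x -> continuous (fun y => c * h y) x)
    by (intros c h Hh; apply continuous_Rmult; [apply continuous_const | exact Hh]).
  apply continuous_Rminus; [| exact Hfg].
  apply continuous_Rminus; [| apply (Hc 2), Hgg].
  apply continuous_Rplus; [| apply (Hc 4), Hff].
  apply continuous_Rplus; [apply (Hc (- 2)), Hf | exact Hg].
Qed.

Lemma F1_cs_poly (u v : R) : F1 u v = cs_poly (exp u) (exp v).
Proof.
  unfold F1, cs_poly.
  replace (2 * u) with (u + u) by ring; replace (2 * v) with (v + v) by ring.
  rewrite !exp_plus; ring.
Qed.

Lemma F2_cs_poly (u v : R) : F2 u v = cs_poly (exp v) (exp u).
Proof.
  unfold F2, cs_poly.
  replace (2 * u) with (u + u) by ring; replace (2 * v) with (v + v) by ring.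
  rewrite !exp_plus; ring.
Qed.

(* The nonlinearity with its exponentials cut off at level [M], which makes it bounded and globally
   Lipschitz; the second component is obtained by exchanging the arguments. *)
Definition cut_field (M x y : R) : R := cs_poly (exp (Rmin x M)) (exp (Rmin y M)).

Lemma cut_field_F1 (M x y : R) : x <= M -> y <= M -> cut_field M x y = F1 x y.
Proof.
  intros Hx Hy. unfold cut_field. rewrite F1_cs_poly, !Rmin_left by assumption. reflexivity.
Qed.

Lemma cut_field_F2 (M x y : R) : x <= M -> y <= M -> cut_field M y x = F2 x y.
Proof.
  intros Hx Hy. unfold cut_field. rewrite F2_cs_poly, !Rmin_left by assumption. reflexivity.
Qed.

Lemma exp_incr_le (x y : R) : x <= y -> exp x <= exp y.
Proof. intros [H | ->]; [left; apply exp_increasing, H | right; reflexivity]. Qed.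

Lemma exp_diff_le (x y M : R) : x <= y <= M -> exp y - exp x <= exp M * (y - x).
Proof.
  intros Hxy.
  pose proof (exp_ineq1_le (x - y)).
  assert (Hx : exp x = exp y * exp (x - y)) by (rewrite <- exp_plus; f_equal; ring).
  pose proof (exp_pos y). pose proof (exp_incr_le y M ltac:(lra)).
  assert (exp y * (1 + (x - y)) <= exp x) by (rewrite Hx; apply Rmult_le_compat_l; lra).
  assert (exp y * (y - x) <= exp M * (y - x)) by (apply Rmult_le_compat_r; lra).
  lra.
Qed.

Lemma cut_exp_lipschitz (M x y : R) :
  Rabs (exp (Rmin x M) - exp (Rmin y M)) <= exp M * Rabs (x - y).
Proof.
  assert (Hwlog : forall x y, x <= y ->
    Rabs (exp (Rmin x M) - exp (Rmin y M)) <= exp M * Rabs (x - y)).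
  { clear x y; intros x y Hxy.
    assert (H : Rmin x M <= Rmin y M <= M /\ Rmin y M - Rmin x M <= y - x).
    { unfold Rmin; do 2 destruct (Rle_dec _ _); lra. }
    pose proof (exp_diff_le _ _ _ (proj1 H)).
    pose proof (exp_incr_le _ _ (proj1 (proj1 H))).
    rewrite Rabs_minus_sym, (Rabs_minus_sym x), !Rabs_right by lra.
    pose proof (exp_pos M).
    assert (exp M * (Rmin y M - Rmin x M) <= exp M * (y - x)) by (apply Rmult_le_compat_l; lra).
    lra. }
  destruct (Rle_lt_dec x y) as [H | H]; [apply Hwlog, H |].
  rewrite Rabs_minus_sym, (Rabs_minus_sym x); apply Hwlog; lra.
Qed.

Lemma cut_exp_bound (M x : R) : 0 < exp (Rmin x M) <= exp M.
Proof. split; [apply exp_pos | apply exp_incr_le, Rmin_r]. Qed.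

Lemma cut_field_bounded (M : R) : exists K, 0 < K /\ forall x y, Rabs (cut_field M x y) <= K.
Proof.
  pose proof (exp_pos M) as HB; set (B := exp M) in *.
  exists (3 * B + 7 * (B * B)). split; [nra |].
  intros x y. unfold cut_field, cs_poly.
  pose proof (cut_exp_bound M x) as HU; pose proof (cut_exp_bound M y) as HV.
  fold B in HU, HV.
  set (U := exp (Rmin x M)) in *; set (V := exp (Rmin y M)) in *.
  assert (0 <= U * U <= B * B) by (split; nra).
  assert (0 <= V * V <= B * B) by (split; nra).
  assert (0 <= U * V <= B * B) by (split; nra).
  apply Rabs_le; lra.
Qed.

Lemma Rabs_mult_le (x y a b : R) : Rabs x <= a -> Rabs y <= b -> Rabs (x * y) <= a * b.
Proof.
  intros. rewrite Rabs_mult. apply Rmult_le_compat; try apply Rabs_pos; assumption.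
Qed.

Lemma cut_field_lipschitz (M : R) :
  exists L, 0 < L /\ forall x y x' y',
    Rabs (cut_field M x y - cut_field M x' y') <= L * (Rabs (x - x') + Rabs (y - y')).
Proof.
  pose proof (exp_pos M) as HB; set (B := exp M) in *.
  exists ((2 + 9 * B) * B). split; [nra |].
  intros x y x' y'. unfold cut_field, cs_poly.
  pose proof (cut_exp_bound M x) as HU; pose proof (cut_exp_bound M y) as HV.
  pose proof (cut_exp_bound M x') as HU'; pose proof (cut_exp_bound M y') as HV'.
  pose proof (cut_exp_lipschitz M x x') as HdU; pose proof (cut_exp_lipschitz M y y') as HdV.
  fold B in HU, HV, HU', HV', HdU, HdV.
  set (U := exp (Rmin x M)) in *; set (V := exp (Rmin y M)) in *.
  set (U' := exp (Rmin x' M)) in *; set (V' := exp (Rmin y' M)) in *.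
  replace (_ - _) with ((U - U') * (- 2 + 4 * (U + U') - V) + (V - V') * (1 - 2 * (V + V') - U'))
    by ring.
  apply Rle_trans with (1 := Rabs_triang _ _).
  assert (H1 : Rabs (- 2 + 4 * (U + U') - V) <= 2 + 9 * B) by (apply Rabs_le; lra).
  assert (H2 : Rabs (1 - 2 * (V + V') - U') <= 2 + 9 * B) by (apply Rabs_le; lra).
  pose proof (Rabs_mult_le _ _ _ _ HdU H1). pose proof (Rabs_mult_le _ _ _ _ HdV H2).
  lra.
Qed.

Lemma continuous_cut_field (M : R) (h1 h2 : R -> R) (s : R) :
  continuous h1 s -> continuous h2 s -> continuous (fun t => cut_field M (h1 t) (h2 t)) s.
Proof.
  intros H1 H2.
  destruct (cut_field_lipschitz M) as [L [HL HLip]].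
  apply filterlim_locally; intros eps.
  assert (He : 0 < eps / (2 * L)).
  { apply Rdiv_lt_0_compat; [apply cond_pos | lra]. }
  generalize (proj1 (filterlim_locally h1 (h1 s)) H1 (mkposreal _ He)).
  generalize (proj1 (filterlim_locally h2 (h2 s)) H2 (mkposreal _ He)).
  intros K2 K1. generalize (filter_and _ _ K1 K2). apply filter_imp.
  intros t [Ht1 Ht2].
  change (Rabs (h1 t - h1 s) < eps / (2 * L)) in Ht1.
  change (Rabs (h2 t - h2 s) < eps / (2 * L)) in Ht2.
  change (Rabs (cut_field M (h1 t) (h2 t) - cut_field M (h1 s) (h2 s)) < eps).
  apply Rle_lt_trans with (1 := HLip _ _ _ _).
  replace (pos eps) with (L * (eps / (2 * L) + eps / (2 * L))) by (field; lra).
  apply Rmult_lt_compat_l; lra.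
Qed.

(** The mean value comparison runs from a point [s] so close to 0 that both functions are within
    [e / 2] of their limits; nothing is assumed about the values at 0 itself. *)
Lemma at_right_compare (f h df dh : R -> R) (f0 h0 R1 : R) :
  (forall r, 0 < r < R1 -> is_derive f r (df r)) ->
  (forall r, 0 < r < R1 -> is_derive h r (dh r)) ->
  filterlim f (at_right 0) (locally f0) ->
  filterlim h (at_right 0) (locally h0) ->
  (forall r, 0 < r < R1 -> Rabs (df r) <= dh r) ->
  forall r, 0 < r < R1 -> Rabs (f r - f0) <= h r - h0.
Proof.
  intros Hf Hh Hf0 Hh0 Hle r Hr.
  apply le_epsilon; intros e He.
  destruct (proj1 (filterlim_at_right_spec _ _ _) Hf0 (e / 2) ltac:(lra)) as [d1 [Hd1 H1]].
  destruct (proj1 (filterlim_at_right_spec _ _ _) Hh0 (e / 2) ltac:(lra)) as [d2 [Hd2 H2]].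
  set (s := Rmin (Rmin d1 d2) r / 2).
  assert (Hs : 0 < s /\ s < d1 /\ s < d2 /\ s < r).
  { unfold s, Rmin; repeat destruct (Rle_dec _ _); lra. }
  specialize (H1 s ltac:(lra)); specialize (H2 s ltac:(lra)).
  assert (Hup : f r - f s <= h r - h s).
  { apply (derive_le_compare f h df dh); [lra | | |].
    - intros x Hx; apply Hf; lra.
    - intros x Hx; apply Hh; lra.
    - intros x Hx; specialize (Hle x ltac:(lra)). pose proof (Rle_abs (df x)); lra. }
  assert (Hlo : - f r - - f s <= h r - h s).
  { apply (derive_le_compare (fun x => - f x) h (fun x => - df x) dh); [lra | | |].
    - intros x Hx; apply (is_derive_opp f), Hf; lra.
    - intros x Hx; apply Hh; lra.
    - intros x Hx; specialize (Hle x ltac:(lra)).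
      pose proof (Rle_abs (- df x)) as Ha; rewrite Rabs_Ropp in Ha; lra. }
  apply Rabs_def2 in H1; apply Rabs_def2 in H2.
  apply Rabs_le; lra.
Qed.

Lemma filterlim_at_right_0 (h : R -> R) :
  continuous h 0 -> filterlim h (at_right 0) (locally (h 0)).
Proof.
  intros Hc. apply filterlim_filter_le_1 with (2 := Hc).
  intros P HP. unfold at_right, within. revert HP. apply filter_imp. auto.
Qed.

Lemma gauss_derive (c L x : R) :
  is_derive (fun r => c * exp (L * (r * r))) x (c * (2 * L * x * exp (L * (x * x)))).
Proof. auto_derive; [exact I | ring]. Qed.

Lemma gauss_at_right (c L : R) :
  filterlim (fun r => c * exp (L * (r * r))) (at_right 0) (locally c).
Proof.
  replace (locally c) with (locally ((fun r => c * exp (L * (r * r))) 0)).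
  - apply filterlim_at_right_0. apply (is_derive_continuous _ _ _ (gauss_derive c L 0)).
  - f_equal. rewrite Rmult_0_r, Rmult_0_r, exp_0; ring.
Qed.

(* [Delta Phi = g] with [Phi(0) = a]: the weight [exp (L r^2)] turns two integrations into the
   factor [1 / (4 L)], so the Picard operator contracts on the whole half line. *)
Lemma weighted_potential_bound (Phi Z g : R -> R) (a C L R1 : R) :
  0 < L -> 0 <= C ->
  (forall r, 0 < r < R1 -> is_derive Phi r (Z r / r) /\ is_derive Z r (r * g r)) ->
  filterlim Phi (at_right 0) (locally a) ->
  filterlim Z (at_right 0) (locally 0) ->
  (forall r, 0 < r < R1 -> Rabs (g r) <= C * exp (L * (r * r))) ->
  forall r, 0 < r < R1 ->
    Rabs (Z r) <= C / 2 * (r * r) * exp (L * (r * r)) /\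
    Rabs (Phi r - a) <= C / (4 * L) * exp (L * (r * r)).
Proof.
  intros HL HC Hd HPhi HZ Hg.
  assert (HZb : forall r, 0 < r < R1 -> Rabs (Z r) <= C / 2 * (r * r) * exp (L * (r * r))).
  { intros r Hr.
    assert (H : Rabs (Z r - 0) <= C / (2 * L) * exp (L * (r * r)) - C / (2 * L)).
    { revert r Hr. apply (at_right_compare Z _ (fun r => r * g r)
        (fun x => C / (2 * L) * (2 * L * x * exp (L * (x * x)))));
        [apply Hd | intros; apply gauss_derive | exact HZ | apply gauss_at_right |].
      intros r Hr. rewrite Rabs_mult, Rabs_right by lra.
      replace (C / (2 * L) * (2 * L * r * exp (L * (r * r)))) with (r * (C * exp (L * (r * r))))
        by (field; lra).
      apply Rmult_le_compat_l; [lra | apply Hg, Hr]. }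
    rewrite Rminus_0_r in H. apply Rle_trans with (1 := H).
    set (x := L * (r * r)).
    (* This is [1 - x <= exp (- x)] multiplied by [exp x]; it produces the factor [r^2] that the
       division by [r] in the second integration requires. *)
    assert (Hx : exp x - 1 <= x * exp x).
    { pose proof (exp_ineq1_le (- x)). pose proof (exp_pos x).
      assert (exp x * (1 + - x) <= exp x * exp (- x)) by (apply Rmult_le_compat_l; lra).
      rewrite <- exp_plus, Rplus_opp_r, exp_0 in H2. lra. }
    replace (C / (2 * L) * exp x - C / (2 * L)) with (C / (2 * L) * (exp x - 1)) by ring.
    replace (C / 2 * (r * r) * exp x) with (C / (2 * L) * (x * exp x)) by (unfold x; field; lra).
    apply Rmult_le_compat_l; [| exact Hx].
    apply Rdiv_le_0_compat; lra. }
  intros r Hr; split; [apply HZb, Hr |].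
  assert (H : Rabs (Phi r - a) <= C / (4 * L) * exp (L * (r * r)) - C / (4 * L)).
  { revert r Hr. apply (at_right_compare Phi _ (fun r => Z r / r)
      (fun x => C / (4 * L) * (2 * L * x * exp (L * (x * x)))));
      [apply Hd | intros; apply gauss_derive | exact HPhi | apply gauss_at_right |].
    intros r Hr. unfold Rdiv at 1. rewrite Rabs_mult, (Rabs_right (/ r))
      by (apply Rle_ge, Rlt_le, Rinv_0_lt_compat; lra).
    apply Rmult_le_reg_r with r; [lra |].
    replace (Rabs (Z r) * / r * r) with (Rabs (Z r)) by (field; lra).
    replace (C / (4 * L) * (2 * L * r * exp (L * (r * r))) * r)
      with (C / 2 * (r * r) * exp (L * (r * r))) by (field; lra).
    apply HZb, Hr. }
  assert (0 <= C / (4 * L)) by (apply Rdiv_le_0_compat; lra).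
  lra.
Qed.

Lemma flux_bound (Z g : R -> R) (K R1 : R) :
  (forall r, 0 < r < R1 -> is_derive Z r (r * g r)) ->
  filterlim Z (at_right 0) (locally 0) ->
  (forall r, 0 < r < R1 -> Rabs (g r) <= K) ->
  forall r, 0 < r < R1 -> Rabs (Z r) <= K / 2 * (r * r).
Proof.
  intros Hd HZ Hg r Hr.
  cut (Rabs (Z r - 0) <= K / 2 * (r * r) - 0); [rewrite !Rminus_0_r; auto |].
  revert r Hr.
  apply (at_right_compare Z (fun r => K / 2 * (r * r)) (fun r => r * g r) (fun r => r * K));
    [exact Hd | | exact HZ | |].
  - intros r Hr. auto_derive; [exact I | field].
  - replace (locally 0) with (locally ((fun r => K / 2 * (r * r)) 0)) by (f_equal; ring).
    apply (filterlim_at_right_0 (fun r => K / 2 * (r * r))).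
    apply (is_derive_continuous _ _ (K / 2 * (0 + 0))). auto_derive; [exact I | ring].
  - intros r Hr. rewrite Rabs_mult, Rabs_right by lra.
    apply Rmult_le_compat_l; [lra | apply Hg, Hr].
Qed.

(** Setting the integrand to 0 for [s <= 0] makes it continuous on the whole line as soon as [k] is
    [O(s)] at the origin, so the primitive is differentiable at 0 too and its limit there is read
    off by continuity. *)
Definition primitive0 (k : R -> R) (r : R) : R :=
  RInt (fun s => if Rle_dec s 0 then 0 else k s) 0 r.

Lemma primitive0_spec (k : R -> R) (K : R) :
  (forall s, 0 < s -> continuous k s) ->
  (forall s, 0 < s -> Rabs (k s) <= K * s) ->
  (forall r, 0 < r -> is_derive (primitive0 k) r (k r)) /\
  filterlim (primitive0 k) (at_right 0) (locally 0).
Proof.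
  intros Hc Hb.
  set (k0 := fun s => if Rle_dec s 0 then 0 else k s).
  assert (HK : 0 <= K).
  { specialize (Hb 1 Rlt_0_1). pose proof (Rabs_pos (k 1)). lra. }
  assert (Hk0 : forall s, continuous k0 s).
  { intros s. destruct (total_order_T s 0) as [[Hs | ->] | Hs].
    - apply (continuous_ext_loc _ (fun _ => 0)); [| apply continuous_const].
      generalize (open_lt 0 s Hs); apply filter_imp; intros y Hy.
      unfold k0; destruct (Rle_dec y 0); [reflexivity | lra].
    - apply filterlim_locally; intros eps.
      assert (Hd : 0 < eps / (K + 1)) by (apply Rdiv_lt_0_compat; [apply cond_pos | lra]).
      exists (mkposreal _ Hd); intros y Hy.
      change (Rabs (y - 0) < eps / (K + 1)) in Hy.
      change (Rabs (k0 y - k0 0) < eps).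
      unfold k0; destruct (Rle_dec 0 0); [| lra].
      pose proof (cond_pos eps).
      destruct (Rle_dec y 0); rewrite Rminus_0_r; [rewrite Rabs_R0; lra |].
      apply Rle_lt_trans with (1 := Hb y ltac:(lra)).
      rewrite Rminus_0_r, Rabs_right in Hy by lra.
      assert (Hy' : (K + 1) * y < (K + 1) * (eps / (K + 1))) by (apply Rmult_lt_compat_l; lra).
      replace ((K + 1) * (eps / (K + 1))) with (pos eps) in Hy' by (field; lra).
      lra.
    - apply (continuous_ext_loc _ k); [| apply Hc, Hs].
      generalize (open_gt 0 s Hs); apply filter_imp; intros y Hy.
      unfold k0; destruct (Rle_dec y 0); [lra | reflexivity]. }
  assert (Hder : forall r, is_derive (primitive0 k) r (k0 r)).
  { intros r. apply (is_derive_RInt k0 (primitive0 k) 0 r).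
    - apply filter_forall; intros y. apply (RInt_correct (V := R_CompleteNormedModule)).
      apply (ex_RInt_continuous (V := R_CompleteNormedModule)); intros; apply Hk0.
    - apply Hk0. }
  split.
  - intros r Hr. replace (k r) with (k0 r); [apply Hder |].
    unfold k0; destruct (Rle_dec r 0); [lra | reflexivity].
  - replace (locally 0) with (locally (primitive0 k 0)).
    + apply filterlim_at_right_0, (is_derive_continuous _ _ _ (Hder 0)).
    + f_equal. unfold primitive0. apply (RInt_point (V := R_CompleteNormedModule) 0).
Qed.

Definition radial_flux (g : R -> R) : R -> R := primitive0 (fun s => s * g s).

(** The solution of [(r Phi')' = r g] with value [a] and no logarithmic part at the origin. For
    bounded [g] the flux is [O(r^2)], so the second integrand is again [O(s)] and [primitive0]
    applies twice. *)
Definition radial_potential (a : R) (g : R -> R) (r : R) : R :=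
  a + primitive0 (fun s => radial_flux g s / s) r.

Lemma radial_potential_spec (a K : R) (g : R -> R) :
  (forall s, 0 < s -> continuous g s) ->
  (forall s, 0 < s -> Rabs (g s) <= K) ->
  (forall r, 0 < r ->
     is_derive (radial_potential a g) r (radial_flux g r / r) /\
     is_derive (radial_flux g) r (r * g r)) /\
  filterlim (radial_potential a g) (at_right 0) (locally a) /\
  filterlim (radial_flux g) (at_right 0) (locally 0).
Proof.
  intros Hc Hb.
  destruct (primitive0_spec (fun s => s * g s) K) as [HZ HZ0].
  { intros s Hs. apply (continuous_mult (fun s => s) g); [apply continuous_id | apply Hc, Hs]. }
  { intros s Hs. rewrite Rabs_mult, Rabs_right, Rmult_comm by lra.
    apply Rmult_le_compat_r; [lra | apply Hb, Hs]. }
  fold (radial_flux g) in HZ, HZ0.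
  destruct (primitive0_spec (fun s => radial_flux g s / s) (K / 2)) as [HP HP0].
  { intros s Hs. apply (continuous_mult (radial_flux g) Rinv).
    - apply (is_derive_continuous _ _ _ (HZ s Hs)).
    - apply (ex_derive_continuous (V := R_NormedModule)). auto_derive; lra. }
  { intros s Hs.
    pose proof (flux_bound (radial_flux g) g K (s + 1) ltac:(intros; apply HZ; lra) HZ0
      ltac:(intros; apply Hb; lra) s ltac:(lra)) as H.
    unfold Rdiv at 1. rewrite Rabs_mult, (Rabs_right (/ s))
      by (apply Rle_ge, Rlt_le, Rinv_0_lt_compat; lra).
    apply Rmult_le_reg_r with s; [lra |].
    replace (Rabs (radial_flux g s) * / s * s) with (Rabs (radial_flux g s)) by (field; lra).
    lra. }
  split; [| split; [| exact HZ0]].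
  - intros r Hr; split; [| apply HZ, Hr].
    unfold radial_potential.
    replace (radial_flux g r / r) with (0 + radial_flux g r / r) by ring.
    apply (is_derive_plus (fun _ => a) (primitive0 (fun s => radial_flux g s / s)));
      [apply (is_derive_const (V := R_NormedModule)) | apply HP, Hr].
  - apply filterlim_at_right_spec; intros e He.
    destruct (proj1 (filterlim_at_right_spec _ _ _) HP0 e He) as [d [Hd H]].
    exists d; split; [exact Hd |]; intros y Hy. specialize (H y Hy).
    unfold radial_potential. rewrite Rminus_0_r in H.
    match goal with |- Rabs ?x < _ => replace x with
      (primitive0 (fun s : R => radial_flux g s / s) y) by ring end.
    exact H.
Qed.

(** The limit is named by the total function [Lim_seq], so that the limit of the Picard iterates can
    be defined pointwise in [r] without choice. *)
Lemma geometric_cauchy_limit (x : nat -> R) (C : R) :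
  (forall n, Rabs (x (S n) - x n) <= C * (1 / 2) ^ n) ->
  forall n, Rabs (real (Lim_seq x) - x n) <= 2 * C * (1 / 2) ^ n.
Proof.
  intros Hx.
  assert (Hp : forall n, 0 < (1 / 2) ^ n) by (intros n; apply pow_lt; lra).
  assert (HC : 0 <= C).
  { specialize (Hx 0%nat). simpl in Hx. pose proof (Rabs_pos (x 1%nat - x 0%nat)). lra. }
  assert (Htail : forall n k, Rabs (x (n + k)%nat - x n) <= 2 * C * (1 / 2) ^ n).
  { intros n k.
    assert (H : Rabs (x (n + k)%nat - x n) <= 2 * C * ((1 / 2) ^ n - (1 / 2) ^ (n + k))).
    { induction k as [| k IH].
      - rewrite Nat.add_0_r, Rminus_diag, Rabs_R0, Rminus_diag. lra.
      - rewrite Nat.add_succ_r.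
        replace (x (S (n + k)) - x n) with ((x (S (n + k)) - x (n + k)%nat) + (x (n + k)%nat - x n))
          by ring.
        apply Rle_trans with (1 := Rabs_triang _ _).
        specialize (Hx (n + k)%nat). simpl pow. lra. }
    apply Rle_trans with (1 := H). apply Rmult_le_compat_l; [lra |].
    specialize (Hp (n + k)%nat). lra. }
  assert (Hcv : ex_finite_lim_seq x).
  { apply ex_lim_seq_cauchy_corr; intros eps.
    destruct (pow_lt_1_zero (1 / 2) ltac:(rewrite Rabs_right; lra) (eps / (4 * C + 4))) as [N HN].
    { apply Rdiv_lt_0_compat; [apply cond_pos | lra]. }
    exists N; intros n m Hn Hm.
    assert (Hclose : forall k, (N <= k)%nat -> Rabs (x k - x N) < eps / 2).
    { intros k Hk. replace k with (N + (k - N))%nat by lia.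
      apply Rle_lt_trans with (1 := Htail _ _).
      specialize (HN N (le_n _)). rewrite Rabs_right in HN by (apply Rle_ge, Rlt_le, Hp).
      assert (Hm2 : (4 * C + 4) * (1 / 2) ^ N < (4 * C + 4) * (eps / (4 * C + 4)))
        by (apply Rmult_lt_compat_l; lra).
      replace ((4 * C + 4) * (eps / (4 * C + 4))) with (pos eps) in Hm2 by (field; lra).
      specialize (Hp N). lra. }
    pose proof (Hclose n Hn) as H1; pose proof (Hclose m Hm) as H2.
    apply Rabs_def2 in H1; apply Rabs_def2 in H2. apply Rabs_def1; lra. }
  destruct Hcv as [l Hl].
  intros n. rewrite (is_lim_seq_unique _ _ Hl). simpl real.
  assert (Hl' : is_lim_seq (fun k => x (k + n)%nat) l) by (apply is_lim_seq_incr_n with (1 := Hl)).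
  assert (Hb : forall k, x n - 2 * C * (1 / 2) ^ n <= x (k + n)%nat <= x n + 2 * C * (1 / 2) ^ n).
  { intros k. specialize (Htail n k). rewrite Nat.add_comm.
    apply Rabs_le_between in Htail. lra. }
  pose proof (is_lim_seq_le _ _ _ _ (fun k => proj1 (Hb k)) (is_lim_seq_const _) Hl') as H1.
  pose proof (is_lim_seq_le _ _ _ _ (fun k => proj2 (Hb k)) Hl' (is_lim_seq_const _)) as H2.
  simpl in H1, H2. apply Rabs_le; lra.
Qed.

(** * The cut-off system *)

Definition cut_rhs (M N N' : R) (phi psi : R -> R) (r : R) : R :=
  cut_field M (2 * N * ln r + phi r) (2 * N' * ln r + psi r).

Lemma cut_rhs_ext (M N N' : R) (phi psi phi' psi' : R -> R) (r : R) :
  phi r = phi' r -> psi r = psi' r -> cut_rhs M N N' phi psi r = cut_rhs M N N' phi' psi' r.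
Proof. intros Hphi Hpsi. unfold cut_rhs. rewrite Hphi, Hpsi. reflexivity. Qed.

(* [u = 2 N1 log r + phi] and [v = 2 N2 log r + psi], with [z = r phi'] and [w = r psi']. *)
Definition cut_solution (M N1 N2 a1 a2 R1 : R) (phi psi z w : R -> R) : Prop :=
  (forall r, 0 < r < R1 ->
     (is_derive phi r (z r / r) /\ is_derive z r (r * cut_rhs M N1 N2 phi psi r)) /\
     (is_derive psi r (w r / r) /\ is_derive w r (r * cut_rhs M N2 N1 psi phi r))) /\
  filterlim phi (at_right 0) (locally a1) /\ filterlim psi (at_right 0) (locally a2) /\
  filterlim z (at_right 0) (locally 0) /\ filterlim w (at_right 0) (locally 0).

Lemma continuous_log_shift (N : R) (phi : R -> R) (s : R) :
  0 < s -> continuous phi s -> continuous (fun r => 2 * N * ln r + phi r) s.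
Proof.
  intros Hs Hphi. apply (continuous_plus (fun r => 2 * N * ln r) phi); [| exact Hphi].
  apply (ex_derive_continuous (V := R_NormedModule)). auto_derive. exact Hs.
Qed.

Lemma continuous_cut_rhs (M N N' : R) (phi psi : R -> R) (s : R) :
  0 < s -> continuous phi s -> continuous psi s -> continuous (cut_rhs M N N' phi psi) s.
Proof.
  intros Hs Hphi Hpsi.
  apply (continuous_cut_field M (fun r => 2 * N * ln r + phi r) (fun r => 2 * N' * ln r + psi r));
    apply continuous_log_shift; assumption.
Qed.

Lemma at_right_minus (f g : R -> R) (x l m : R) :
  filterlim f (at_right x) (locally l) -> filterlim g (at_right x) (locally m) ->
  filterlim (fun r => f r - g r) (at_right x) (locally (l - m)).
Proof.
  intros Hf Hg. apply filterlim_at_right_spec; intros e He.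
  destruct (proj1 (filterlim_at_right_spec _ _ _) Hf (e / 2) ltac:(lra)) as [d1 [Hd1 H1]].
  destruct (proj1 (filterlim_at_right_spec _ _ _) Hg (e / 2) ltac:(lra)) as [d2 [Hd2 H2]].
  exists (Rmin d1 d2); split; [apply Rmin_glb_lt; assumption |].
  intros y Hy. pose proof (Rmin_l d1 d2); pose proof (Rmin_r d1 d2).
  specialize (H1 y ltac:(lra)); specialize (H2 y ltac:(lra)).
  apply Rabs_def2 in H1; apply Rabs_def2 in H2. apply Rabs_def1; lra.
Qed.

(** The logarithms cancel in the differences, so [L] depends on [M] alone and the singularity at the
    origin does not enter. *)
Lemma cut_rhs_lipschitz (M : R) :
  exists L, 0 < L /\ forall N N' phi psi phi' psi' r,
    Rabs (cut_rhs M N N' phi psi r - cut_rhs M N N' phi' psi' r)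
      <= L * (Rabs (phi r - phi' r) + Rabs (psi r - psi' r)).
Proof.
  destruct (cut_field_lipschitz M) as [L [HL HLip]].
  exists L; split; [exact HL |]; intros.
  replace (phi r - phi' r) with ((2 * N * ln r + phi r) - (2 * N * ln r + phi' r)) by ring.
  replace (psi r - psi' r) with ((2 * N' * ln r + psi r) - (2 * N' * ln r + psi' r)) by ring.
  apply HLip.
Qed.

(** The Lipschitz constant [L] is also taken as the exponent of the weight, so that [L m / (4 L)]
    leaves [m / 4] for each component and [m / 2] for their sum. *)
Lemma weighted_potential_diff
  (L m R1 a a' : R) (Phi Z Phi' Z' g g' : R -> R) :
  0 < L -> 0 <= m ->
  (forall r, 0 < r < R1 -> is_derive Phi r (Z r / r) /\ is_derive Z r (r * g r)) ->
  (forall r, 0 < r < R1 -> is_derive Phi' r (Z' r / r) /\ is_derive Z' r (r * g' r)) ->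
  filterlim Phi (at_right 0) (locally a) -> filterlim Z (at_right 0) (locally 0) ->
  filterlim Phi' (at_right 0) (locally a') -> filterlim Z' (at_right 0) (locally 0) ->
  (forall r, 0 < r < R1 -> Rabs (g r - g' r) <= L * (m * exp (L * (r * r)))) ->
  forall r, 0 < r < R1 ->
    Rabs (Z r - Z' r) <= L * m / 2 * (r * r) * exp (L * (r * r)) /\
    Rabs (Phi r - Phi' r) <= Rabs (a - a') + m / 4 * exp (L * (r * r)).
Proof.
  intros HL Hm HD HD' HP HZ HP' HZ' Hg r Hr.
  destruct (weighted_potential_bound (fun r => Phi r - Phi' r) (fun r => Z r - Z' r)
    (fun r => g r - g' r) (a - a') (L * m) L R1 HL) with (r := r) as [H1 H2].
  - apply Rmult_le_pos; lra.
  - intros x Hx; split.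
    + replace ((Z x - Z' x) / x) with (Z x / x - Z' x / x) by (field; lra).
      apply (is_derive_minus Phi Phi'); [apply HD | apply HD']; exact Hx.
    + replace (x * (g x - g' x)) with (x * g x - x * g' x) by ring.
      apply (is_derive_minus Z Z'); [apply HD | apply HD']; exact Hx.
  - apply at_right_minus; assumption.
  - replace 0 with (0 - 0) at 2 by ring. apply at_right_minus; assumption.
  - intros x Hx. rewrite Rmult_assoc. apply Hg, Hx.
  - exact Hr.
  - split; [exact H1 |].
    replace (Phi r - Phi' r) with ((a - a') + (Phi r - Phi' r - (a - a'))) by ring.
    apply Rle_trans with (1 := Rabs_triang _ _).
    replace (m / 4) with (L * m / (4 * L)) by (field; lra). lra.
Qed.

Lemma exp_square_ge_1 (L r : R) : 0 < L -> 1 <= exp (L * (r * r)).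
Proof.
  intros HL. pose proof (exp_ineq1_le (L * (r * r))).
  assert (0 <= L * (r * r)) by (apply Rmult_le_pos; [lra | apply Rle_0_sqr]). lra.
Qed.

(** One use of the equations improves a weighted bound [m] on the difference to [d + m / 2], where
    [d] is the distance of the data; the fixed point of this map is [2 d]. Iteration replaces a
    Gronwall inequality and yields uniqueness ([d = 0]) and continuous dependence together. *)
Lemma cut_solution_dependence (M : R) :
  exists L, 0 < L /\ forall N1 N2 a1 a2 a1' a2' R1 phi psi z w phi' psi' z' w',
    cut_solution M N1 N2 a1 a2 R1 phi psi z w ->
    cut_solution M N1 N2 a1' a2' R1 phi' psi' z' w' ->
    forall r, 0 < r < R1 ->
      Rabs (phi r - phi' r) + Rabs (psi r - psi' r)
        <= 2 * (Rabs (a1 - a1') + Rabs (a2 - a2')) * exp (L * (r * r)) /\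
      Rabs (z r - z' r) <= L * (Rabs (a1 - a1') + Rabs (a2 - a2')) * (r * r) * exp (L * (r * r)) /\
      Rabs (w r - w' r) <= L * (Rabs (a1 - a1') + Rabs (a2 - a2')) * (r * r) * exp (L * (r * r)).
Proof.
  destruct (cut_rhs_lipschitz M) as [L [HL HLip]].
  destruct (cut_field_bounded M) as [K [HK HKb]].
  exists L; split; [exact HL |].
  intros N1 N2 a1 a2 a1' a2' R1 phi psi z w phi' psi' z' w' [HD [Hp1 [Hp2 [Hz Hw]]]]
    [HD' [Hp1' [Hp2' [Hz' Hw']]]].
  set (d := Rabs (a1 - a1') + Rabs (a2 - a2')).
  assert (Hd : 0 <= d).
  { unfold d. pose proof (Rabs_pos (a1 - a1')); pose proof (Rabs_pos (a2 - a2')); lra. }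
  set (D := fun r => Rabs (phi r - phi' r) + Rabs (psi r - psi' r)).
  assert (Hstep : forall m, 0 <= m ->
    (forall r, 0 < r < R1 -> D r <= m * exp (L * (r * r))) ->
    forall r, 0 < r < R1 ->
      D r <= (d + m / 2) * exp (L * (r * r)) /\
      Rabs (z r - z' r) <= L * m / 2 * (r * r) * exp (L * (r * r)) /\
      Rabs (w r - w' r) <= L * m / 2 * (r * r) * exp (L * (r * r))).
  { intros m Hm HDm r Hr.
    assert (H1 := weighted_potential_diff L m R1 a1 a1' phi z phi' z'
      (cut_rhs M N1 N2 phi psi) (cut_rhs M N1 N2 phi' psi') HL Hm
      (fun r Hr => proj1 (HD r Hr)) (fun r Hr => proj1 (HD' r Hr)) Hp1 Hz Hp1' Hz').
    assert (H2 := weighted_potential_diff L m R1 a2 a2' psi w psi' w'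
      (cut_rhs M N2 N1 psi phi) (cut_rhs M N2 N1 psi' phi') HL Hm
      (fun r Hr => proj2 (HD r Hr)) (fun r Hr => proj2 (HD' r Hr)) Hp2 Hw Hp2' Hw').
    destruct H1 with (r := r) as [H1z H1p]; [| exact Hr |].
    { intros x Hx. apply Rle_trans with (1 := HLip _ _ _ _ _ _ _).
      apply Rmult_le_compat_l; [lra | apply (HDm x Hx)]. }
    destruct H2 with (r := r) as [H2z H2p]; [| exact Hr |].
    { intros x Hx. apply Rle_trans with (1 := HLip _ _ _ _ _ _ _).
      apply Rmult_le_compat_l; [lra |]. rewrite Rplus_comm. apply (HDm x Hx). }
    pose proof (exp_square_ge_1 L r HL) as Hge.
    split; [| split; assumption].
    unfold D. assert (d * 1 <= d * exp (L * (r * r))) by (apply Rmult_le_compat_l; lra).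
    unfold d in *; lra. }
  (* The iteration needs a first bound. Two values of the cut-off field differ by at most [2 K],
     which corresponds to [m = 2 K / L]; two components with [m / 4] each give [K / L]. *)
  assert (H0 : forall r, 0 < r < R1 -> D r <= (d + K / L) * exp (L * (r * r))).
  { intros r Hr.
    assert (HKL : 0 <= 2 * K / L) by (apply Rdiv_le_0_compat; lra).
    assert (Hg : forall N N' f g f' g' x, Rabs (cut_rhs M N N' f g x - cut_rhs M N N' f' g' x)
        <= L * (2 * K / L * exp (L * (x * x)))).
    { intros. pose proof (HKb (2 * N * ln x + f x) (2 * N' * ln x + g x)) as Ha.
      pose proof (HKb (2 * N * ln x + f' x) (2 * N' * ln x + g' x)) as Hb.
      apply Rabs_le_between in Ha; apply Rabs_le_between in Hb.
      replace (L * (2 * K / L * exp (L * (x * x)))) with (2 * K * exp (L * (x * x)))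
        by (field; lra).
      pose proof (exp_square_ge_1 L x HL).
      assert (2 * K * 1 <= 2 * K * exp (L * (x * x))) by (apply Rmult_le_compat_l; lra).
      unfold cut_rhs. apply Rabs_le; lra. }
    destruct (weighted_potential_diff L (2 * K / L) R1 a1 a1' phi z phi' z' _ _ HL HKL
      (fun r Hr => proj1 (HD r Hr)) (fun r Hr => proj1 (HD' r Hr)) Hp1 Hz Hp1' Hz'
      (fun x _ => Hg _ _ _ _ _ _ x) r Hr) as [_ H1].
    destruct (weighted_potential_diff L (2 * K / L) R1 a2 a2' psi w psi' w' _ _ HL HKL
      (fun r Hr => proj2 (HD r Hr)) (fun r Hr => proj2 (HD' r Hr)) Hp2 Hw Hp2' Hw'
      (fun x _ => Hg _ _ _ _ _ _ x) r Hr) as [_ H2].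
    pose proof (exp_square_ge_1 L r HL) as Hge.
    assert (d * 1 <= d * exp (L * (r * r))) by (apply Rmult_le_compat_l; lra).
    unfold D, d in *. replace (2 * K / L / 4) with (K / L / 2) in H1, H2 by (field; lra). lra. }
  set (m0 := d + K / L).
  assert (Hm0 : 0 <= m0).
  { unfold m0. assert (0 <= K / L) by (apply Rdiv_le_0_compat; lra). lra. }
  assert (Hpow : forall n, 0 < (1 / 2) ^ n) by (intros n; apply pow_lt; lra).
  assert (Hmn : forall n r, 0 < r < R1 -> D r <= (2 * d + m0 * (1 / 2) ^ n) * exp (L * (r * r))).
  { induction n as [| n IH]; intros r Hr.
    - apply Rle_trans with (1 := H0 r Hr). pose proof (exp_square_ge_1 L r HL).
      apply Rmult_le_compat_r; [lra |]. simpl; unfold m0; lra.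
    - destruct (Hstep (2 * d + m0 * (1 / 2) ^ n)) with (r := r) as [Hs _]; [| exact IH | exact Hr |].
      + specialize (Hpow n). assert (0 <= m0 * (1 / 2) ^ n) by (apply Rmult_le_pos; lra). lra.
      + apply Rle_trans with (1 := Hs). pose proof (exp_square_ge_1 L r HL).
        apply Rmult_le_compat_r; [lra |]. simpl; lra. }
  assert (Hlim : forall r, 0 < r < R1 -> D r <= 2 * d * exp (L * (r * r))).
  { intros r Hr.
    assert (Hseq : is_lim_seq (fun n => (2 * d + m0 * (1 / 2) ^ n) * exp (L * (r * r)))
                     ((2 * d + m0 * 0) * exp (L * (r * r)))).
    { apply (is_lim_seq_scal_r _ _ (Finite _)).
      apply is_lim_seq_plus'; [apply is_lim_seq_const |].
      apply (is_lim_seq_scal_l _ _ (Finite 0)), is_lim_seq_geom. rewrite Rabs_right; lra. }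
    pose proof (is_lim_seq_le _ _ _ _ (fun n => Hmn n r Hr) (is_lim_seq_const _) Hseq) as H.
    simpl in H. lra. }
  intros r Hr. destruct (Hstep (2 * d) ltac:(lra) Hlim r Hr) as [_ [H1 H2]].
  split; [apply Hlim, Hr |].
  replace (L * (2 * d) / 2) with (L * d) in H1, H2 by field.
  split; assumption.
Qed.

(** * Picard iteration for the cut-off system *)

Fixpoint picard (M N1 N2 a1 a2 : R) (n : nat) : (R -> R) * (R -> R) :=
  match n with
  | O => (fun _ => a1, fun _ => a2)
  | S n =>
      let f := picard M N1 N2 a1 a2 n in
      (radial_potential a1 (cut_rhs M N1 N2 (fst f) (snd f)),
       radial_potential a2 (cut_rhs M N2 N1 (snd f) (fst f)))
  end.

Lemma cut_potential_spec (M N N' a : R) (phi psi : R -> R) :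
  (forall s, 0 < s -> continuous phi s) -> (forall s, 0 < s -> continuous psi s) ->
  let g := cut_rhs M N N' phi psi in
  (forall r, 0 < r ->
     is_derive (radial_potential a g) r (radial_flux g r / r) /\
     is_derive (radial_flux g) r (r * g r)) /\
  filterlim (radial_potential a g) (at_right 0) (locally a) /\
  filterlim (radial_flux g) (at_right 0) (locally 0).
Proof.
  intros Hphi Hpsi g. destruct (cut_field_bounded M) as [K [_ HK]].
  apply (radial_potential_spec a K).
  - intros s Hs. apply continuous_cut_rhs; auto.
  - intros s _. apply HK.
Qed.

Lemma picard_continuous (M N1 N2 a1 a2 : R) (n : nat) (s : R) :
  0 < s ->
  continuous (fst (picard M N1 N2 a1 a2 n)) s /\ continuous (snd (picard M N1 N2 a1 a2 n)) s.
Proof.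
  revert s; induction n as [| n IH]; intros s Hs.
  - split; apply continuous_const.
  - destruct (cut_potential_spec M N1 N2 a1 _ _ (fun s Hs => proj1 (IH s Hs))
      (fun s Hs => proj2 (IH s Hs))) as [H1 _].
    destruct (cut_potential_spec M N2 N1 a2 _ _ (fun s Hs => proj2 (IH s Hs))
      (fun s Hs => proj1 (IH s Hs))) as [H2 _].
    split; [apply (is_derive_continuous _ _ _ (proj1 (H1 s Hs)))
           | apply (is_derive_continuous _ _ _ (proj1 (H2 s Hs)))].
Qed.

Lemma cut_potential_diff (M : R) :
  exists L, 0 < L /\ forall N N' a phi psi phi' psi' m,
    (forall s, 0 < s -> continuous phi s) -> (forall s, 0 < s -> continuous psi s) ->
    (forall s, 0 < s -> continuous phi' s) -> (forall s, 0 < s -> continuous psi' s) ->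
    0 <= m ->
    (forall r, 0 < r ->
       Rabs (phi r - phi' r) + Rabs (psi r - psi' r) <= m * exp (L * (r * r))) ->
    forall r, 0 < r ->
      Rabs (radial_potential a (cut_rhs M N N' phi psi) r -
            radial_potential a (cut_rhs M N N' phi' psi') r) <= m / 4 * exp (L * (r * r)).
Proof.
  destruct (cut_rhs_lipschitz M) as [L [HL HLip]].
  exists L; split; [exact HL |].
  intros N N' a phi psi phi' psi' m H1 H2 H1' H2' Hm HD r Hr.
  destruct (cut_potential_spec M N N' a _ _ H1 H2) as [K1 [K2 K3]].
  destruct (cut_potential_spec M N N' a _ _ H1' H2') as [K1' [K2' K3']].
  destruct (weighted_potential_diff L m (r + 1) a a _ _ _ _
    (cut_rhs M N N' phi psi) (cut_rhs M N N' phi' psi') HL Hm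
    (fun r Hr => K1 r (proj1 Hr)) (fun r Hr => K1' r (proj1 Hr)) K2 K3 K2' K3') with (r := r)
    as [_ H].
  - intros x Hx. apply Rle_trans with (1 := HLip _ _ _ _ _ _ _).
    apply Rmult_le_compat_l; [lra | apply HD, Hx].
  - lra.
  - rewrite Rminus_diag, Rabs_R0 in H. lra.
Qed.

(** The weight is unbounded on the half line, so uniform convergence is used only on [(0, s + 1)],
    where the weight is at most its value at [s + 1]. *)
Lemma uniform_limit_continuous (L C : R) (f : nat -> R -> R) (g : R -> R) (s : R) :
  0 < L -> 0 < s ->
  (forall n, continuous (f n) s) ->
  (forall n r, 0 < r -> Rabs (g r - f n r) <= C * exp (L * (r * r)) * (1 / 2) ^ n) ->
  continuous g s.
Proof.
  intros HL Hs Hf Hg. apply filterlim_locally; intros eps.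
  assert (HC : 0 <= C).
  { specialize (Hg 0%nat s Hs). simpl in Hg. pose proof (Rabs_pos (g s - f 0%nat s)).
    pose proof (exp_pos (L * (s * s))). apply Rnot_lt_le; intros HC.
    assert (C * exp (L * (s * s)) < 0 * exp (L * (s * s))) by (apply Rmult_lt_compat_r; lra).
    lra. }
  set (B := C * exp (L * ((s + 1) * (s + 1))) + 1).
  assert (HB : 0 < B).
  { unfold B. pose proof (exp_pos (L * ((s + 1) * (s + 1)))).
    assert (0 <= C * exp (L * ((s + 1) * (s + 1)))) by (apply Rmult_le_pos; lra). lra. }
  pose proof (cond_pos eps) as Heps.
  destruct (pow_lt_1_zero (1 / 2) ltac:(rewrite Rabs_right; lra) (eps / (3 * B))) as [n Hn].
  { apply Rdiv_lt_0_compat; lra. }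
  specialize (Hn n (le_n _)).
  assert (Hp : 0 < (1 / 2) ^ n) by (apply pow_lt; lra).
  rewrite Rabs_right in Hn by lra.
  assert (Hclose : forall r, 0 < r < s + 1 -> Rabs (g r - f n r) < eps / 3).
  { intros r Hr. apply Rle_lt_trans with (1 := Hg n r (proj1 Hr)).
    assert (H : C * exp (L * (r * r)) <= B).
    { unfold B. assert (exp (L * (r * r)) <= exp (L * ((s + 1) * (s + 1)))).
      { apply exp_incr_le. apply Rmult_le_compat_l; [lra |]. apply Rmult_le_compat; lra. }
      assert (C * exp (L * (r * r)) <= C * exp (L * ((s + 1) * (s + 1))))
        by (apply Rmult_le_compat_l; lra).
      lra. }
    apply Rle_lt_trans with (B * (1 / 2) ^ n); [apply Rmult_le_compat_r; lra |].
    replace (eps / 3) with (B * (eps / (3 * B))) by (field; lra).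
    apply Rmult_lt_compat_l; lra. }
  assert (He3 : 0 < eps / 3) by lra.
  generalize (proj1 (filterlim_locally (f n) (f n s)) (Hf n) (mkposreal _ He3)).
  intros K1.
  assert (K2 : locally s (fun r => 0 < r)) by (apply open_gt; lra).
  assert (K3 : locally s (fun r => r < s + 1)) by (apply open_lt; lra).
  generalize (filter_and _ _ K1 (filter_and _ _ K2 K3)). apply filter_imp.
  intros r [H1 [H2 H3]].
  change (Rabs (f n r - f n s) < eps / 3) in H1.
  change (Rabs (g r - g s) < eps).
  pose proof (Hclose r ltac:(lra)) as H4. pose proof (Hclose s ltac:(lra)) as H5.
  apply Rabs_def2 in H1; apply Rabs_def2 in H4; apply Rabs_def2 in H5. apply Rabs_def1; lra.
Qed.

(** The same functions serve for every [R1]: the cut-off solution is global. This is what later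
    allows a solution to be continued past a supposed maximal radius. *)
Lemma cut_solution_exists (M N1 N2 a1 a2 : R) :
  exists phi psi z w, forall R1, cut_solution M N1 N2 a1 a2 R1 phi psi z w.
Proof.
  destruct (cut_potential_diff M) as [L [HL Hdiff]].
  destruct (cut_field_bounded M) as [K [HK HKb]].
  set (f := fun n => fst (picard M N1 N2 a1 a2 n)).
  set (g := fun n => snd (picard M N1 N2 a1 a2 n)).
  assert (Hf : forall n s, 0 < s -> continuous (f n) s) by (intros; apply picard_continuous; auto).
  assert (Hg : forall n s, 0 < s -> continuous (g n) s) by (intros; apply picard_continuous; auto).
  assert (Hpow : forall n, 0 < (1 / 2) ^ n) by (intros n; apply pow_lt; lra).
  set (C := K / (2 * L)).
  assert (HC : 0 < C) by (apply Rdiv_lt_0_compat; lra).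
  assert (Hbase : forall N N' a phi psi r, 0 < r ->
    (forall s, 0 < s -> continuous phi s) -> (forall s, 0 < s -> continuous psi s) ->
    Rabs (radial_potential a (cut_rhs M N N' phi psi) r - a) <= C / 2 * exp (L * (r * r))).
  { intros N N' a phi psi r Hr Hphi Hpsi.
    destruct (cut_potential_spec M N N' a phi psi Hphi Hpsi) as [K1 [K2 K3]].
    destruct (weighted_potential_bound (radial_potential a (cut_rhs M N N' phi psi)) _ _ a K L
      (r + 1) HL (Rlt_le _ _ HK) (fun r Hr => K1 r (proj1 Hr)) K2 K3) with (r := r) as [_ H].
    - intros x Hx. pose proof (exp_square_ge_1 L x HL).
      assert (K * 1 <= K * exp (L * (x * x))) by (apply Rmult_le_compat_l; lra).
      specialize (HKb (2 * N * ln x + phi x) (2 * N' * ln x + psi x)).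
      fold (cut_rhs M N N' phi psi x) in HKb. lra.
    - lra.
    - unfold C. replace (K / (2 * L) / 2) with (K / (4 * L)) by (field; lra). exact H. }
  assert (Hstep : forall n r, 0 < r ->
    Rabs (f (S n) r - f n r) + Rabs (g (S n) r - g n r) <= C * (1 / 2) ^ n * exp (L * (r * r))).
  { induction n as [| n IH]; intros r Hr.
    - pose proof (Hbase N1 N2 a1 (f 0%nat) (g 0%nat) r Hr (Hf 0%nat) (Hg 0%nat)) as H1.
      pose proof (Hbase N2 N1 a2 (g 0%nat) (f 0%nat) r Hr (Hg 0%nat) (Hf 0%nat)) as H2.
      change (Rabs (f 1%nat r - f 0%nat r) <= C / 2 * exp (L * (r * r))) in H1.
      change (Rabs (g 1%nat r - g 0%nat r) <= C / 2 * exp (L * (r * r))) in H2.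
      simpl pow. lra.
    - assert (Hm : 0 <= C * (1 / 2) ^ n) by (specialize (Hpow n); apply Rmult_le_pos; lra).
      pose proof (Hdiff N1 N2 a1 (f (S n)) (g (S n)) (f n) (g n) _
        (Hf _) (Hg _) (Hf _) (Hg _) Hm IH r Hr) as H1.
      pose proof (Hdiff N2 N1 a2 (g (S n)) (f (S n)) (g n) (f n) _
        (Hg _) (Hf _) (Hg _) (Hf _) Hm
        (fun r Hr => Rle_trans _ _ _ (Req_le _ _ (Rplus_comm _ _)) (IH r Hr)) r Hr) as H2.
      change (Rabs (f (S (S n)) r - f (S n) r) <= C * (1 / 2) ^ n / 4 * exp (L * (r * r))) in H1.
      change (Rabs (g (S (S n)) r - g (S n) r) <= C * (1 / 2) ^ n / 4 * exp (L * (r * r))) in H2.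
      simpl pow. lra. }
  set (phi := fun r => real (Lim_seq (fun n => f n r))).
  set (psi := fun r => real (Lim_seq (fun n => g n r))).
  assert (Hphi : forall n r, 0 < r ->
    Rabs (phi r - f n r) <= 2 * C * exp (L * (r * r)) * (1 / 2) ^ n).
  { intros n r Hr. rewrite (Rmult_assoc 2).
    apply (geometric_cauchy_limit (fun n => f n r)). intros k.
    specialize (Hstep k r Hr). pose proof (Rabs_pos (g (S k) r - g k r)). lra. }
  assert (Hpsi : forall n r, 0 < r ->
    Rabs (psi r - g n r) <= 2 * C * exp (L * (r * r)) * (1 / 2) ^ n).
  { intros n r Hr. rewrite (Rmult_assoc 2).
    apply (geometric_cauchy_limit (fun n => g n r)). intros k.
    specialize (Hstep k r Hr). pose proof (Rabs_pos (f (S k) r - f k r)). lra. }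
  assert (Hcphi : forall s, 0 < s -> continuous phi s).
  { intros s Hs. apply (uniform_limit_continuous L (2 * C) f phi s HL Hs); auto. }
  assert (Hcpsi : forall s, 0 < s -> continuous psi s).
  { intros s Hs. apply (uniform_limit_continuous L (2 * C) g psi s HL Hs); auto. }
  assert (Hfix : forall N N' a (h : nat -> R -> R) (k : nat -> R -> R) (hl kl : R -> R),
    (forall n s, 0 < s -> continuous (h n) s) -> (forall n s, 0 < s -> continuous (k n) s) ->
    (forall s, 0 < s -> continuous hl s) -> (forall s, 0 < s -> continuous kl s) ->
    (forall n r, 0 < r -> Rabs (hl r - h n r) <= 2 * C * exp (L * (r * r)) * (1 / 2) ^ n) ->
    (forall n r, 0 < r -> Rabs (kl r - k n r) <= 2 * C * exp (L * (r * r)) * (1 / 2) ^ n) ->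
    (forall n r, h (S n) r = radial_potential a (cut_rhs M N N' (h n) (k n)) r) ->
    forall r, 0 < r -> hl r = radial_potential a (cut_rhs M N N' hl kl) r).
  { intros N N' a h k hl kl Hh Hk Hhl Hkl Hhb Hkb Hrec r Hr.
    set (T := radial_potential a (cut_rhs M N N' hl kl) r).
    (* Both [T] and [hl r] are geometrically close to the iterate [h (S n) r]: the first by the
       contraction estimate, the second by the rate of convergence. *)
    assert (Hn : forall n, Rabs (T - hl r) <= 3 * C * exp (L * (r * r)) * (1 / 2) ^ n).
    { intros n. specialize (Hpow n).
      assert (H1 : Rabs (T - h (S n) r) <= 4 * C * (1 / 2) ^ n / 4 * exp (L * (r * r))).
      { rewrite Hrec. unfold T.
        apply (Hdiff N N' a hl kl (h n) (k n)); auto.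
        - assert (0 <= C * (1 / 2) ^ n) by (apply Rmult_le_pos; lra). lra.
        - intros s Hs. specialize (Hhb n s Hs); specialize (Hkb n s Hs). lra. }
      pose proof (Hhb (S n) r Hr) as H2. simpl pow in H2.
      apply Rabs_le_between in H1; apply Rabs_le_between in H2. apply Rabs_le; split; lra. }
    assert (H0 : Rabs (T - hl r) <= 0).
    { assert (Hseq : is_lim_seq (fun n => 3 * C * exp (L * (r * r)) * (1 / 2) ^ n)
                       (3 * C * exp (L * (r * r)) * 0)).
      { apply (is_lim_seq_scal_l _ _ (Finite 0)), is_lim_seq_geom. rewrite Rabs_right; lra. }
      pose proof (is_lim_seq_le _ _ _ _ Hn (is_lim_seq_const _) Hseq) as H.
      simpl in H. rewrite Rmult_0_r in H. exact H. }
    pose proof (Rabs_pos (T - hl r)). 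
    destruct (Req_dec (T - hl r) 0) as [H1 | H1]; [lra |].
    apply Rabs_pos_lt in H1. lra. }
  assert (Hfixphi := Hfix N1 N2 a1 f g phi psi Hf Hg Hcphi Hcpsi Hphi Hpsi (fun n r => eq_refl)).
  assert (Hfixpsi := Hfix N2 N1 a2 g f psi phi Hg Hf Hcpsi Hcphi Hpsi Hphi (fun n r => eq_refl)).
  destruct (cut_potential_spec M N1 N2 a1 phi psi Hcphi Hcpsi) as [A1 [A2 A3]].
  destruct (cut_potential_spec M N2 N1 a2 psi phi Hcpsi Hcphi) as [B1 [B2 B3]].
  (* The witnesses are the potentials and not the pointwise limits [phi], [psi]: the potentials are
     differentiable by construction, and agreement with the limits is known only for [r > 0]. *)
  exists (radial_potential a1 (cut_rhs M N1 N2 phi psi)),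
    (radial_potential a2 (cut_rhs M N2 N1 psi phi)),
    (radial_flux (cut_rhs M N1 N2 phi psi)), (radial_flux (cut_rhs M N2 N1 psi phi)).
  intros R1. split; [| repeat split; assumption].
  intros r [Hr _].
  rewrite (cut_rhs_ext M N1 N2 _ _ phi psi r (eq_sym (Hfixphi r Hr)) (eq_sym (Hfixpsi r Hr))).
  rewrite (cut_rhs_ext M N2 N1 _ _ psi phi r (eq_sym (Hfixpsi r Hr)) (eq_sym (Hfixphi r Hr))).
  split; [apply A1 | apply B1]; exact Hr.
Qed.

(** * Maximal solutions and continuous dependence *)

(* The radial system in the variables [p = r u'], [q = r v']. *)
Definition trajectory (u v p q : R -> R) (r : R) : Prop :=
  is_derive u r (p r / r) /\ is_derive v r (q r / r) /\
  is_derive p r (r * F1 (u r) (v r)) /\ is_derive q r (r * F2 (u r) (v r)).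

Lemma radial_laplace_flux (w : R -> R) (r g : R) :
  0 < r -> radial_laplace_eq w r g ->
  is_derive w r (r * Derive w r / r) /\ is_derive (fun s => s * Derive w s) r (r * g).
Proof.
  intros Hr [H1 [H2 H3]]. split.
  - replace (r * Derive w r / r) with (Derive w r) by (field; lra).
    apply Derive_correct, H1.
  - rewrite <- H3. change (Derive_n w 2 r) with (Derive (Derive w) r).
    replace (r * (Derive (Derive w) r + / r * Derive w r))
      with (1 * Derive w r + r * Derive (Derive w) r) by (field; lra).
    apply (is_derive_mult (fun s => s) (Derive w) r 1 (Derive (Derive w) r)).
    + apply (is_derive_id (K := R_AbsRing)).
    + apply Derive_correct, H2.
    + intros; apply Rmult_comm.
Qed.

Lemma flux_radial_laplace (w p : R -> R) (r g : R) :
  0 < r -> locally r (fun s => is_derive w s (p s / s)) -> is_derive p r (r * g) ->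
  radial_laplace_eq w r g.
Proof.
  intros Hr Hw Hp.
  assert (Heq : locally r (fun s => p s / s = Derive w s)).
  { revert Hw; apply filter_imp; intros s Hs. symmetry; apply is_derive_unique, Hs. }
  assert (Hd : is_derive (Derive w) r (g - p r / (r * r))).
  { apply (is_derive_ext_loc (fun s => p s / s)); [exact Heq |].
    auto_derive; [split; [exists (r * g); exact Hp | split; [lra | exact I]] |].
    replace (Derive (fun x => p x) r) with (r * g) by (symmetry; apply is_derive_unique, Hp).
    field; lra. }
  pose proof (locally_singleton _ _ Hw) as Hw0. cbv beta in Hw0.
  split; [exists (p r / r); exact Hw0 |]. split; [exists (g - p r / (r * r)); exact Hd |].
  change (Derive_n w 2 r) with (Derive (Derive w) r).
  rewrite (is_derive_unique _ _ _ Hd), (is_derive_unique _ _ _ Hw0). field; lra.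
Qed.

Lemma locally_open_interval (P : R -> Prop) (a b r : R) :
  a < r < b -> (forall s, a < s < b -> P s) -> locally r P.
Proof.
  intros Hr H.
  assert (K1 : locally r (fun s => a < s)) by (apply open_gt; lra).
  assert (K2 : locally r (fun s => s < b)) by (apply open_lt; lra).
  generalize (filter_and _ _ K1 K2); apply filter_imp; intros s Hs; apply H; exact Hs.
Qed.

Lemma Rbar_between (r : R) (T : Rbar) : Rbar_lt r T -> exists s, r < s /\ Rbar_lt s T.
Proof.
  destruct T as [t | |]; simpl; intros H.
  - exists ((r + t) / 2); split; lra.
  - exists (r + 1); split; [lra | exact I].
  - contradiction.
Qed.

Lemma solution_trajectory (N1 N2 : R) (alpha : R * R) (T : Rbar) (u v : R -> R) (r : R) :
  radial_solution_on N1 N2 alpha T u v -> 0 < r -> Rbar_lt r T ->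
  trajectory u v (fun s => s * Derive u s) (fun s => s * Derive v s) r.
Proof.
  intros [_ [H _]] Hr HrT. destruct (H r Hr HrT) as [Hu Hv].
  destruct (radial_laplace_flux u r _ Hr Hu) as [H0 H1]; destruct (radial_laplace_flux v r _ Hr Hv) as [H2 H3].
  exact (conj H0 (conj H2 (conj H1 H3))).
Qed.

(* A nonzero limit of the flux [z = r phi'] would make [phi] grow logarithmically at the origin. *)
Lemma flux_vanishes_at_0 (phi z g : R -> R) (a K R1 : R) :
  0 < R1 ->
  (forall r, 0 < r < R1 -> is_derive phi r (z r / r) /\ is_derive z r (r * g r)) ->
  filterlim phi (at_right 0) (locally a) ->
  (forall r, 0 < r < R1 -> Rabs (g r) <= K) ->
  filterlim z (at_right 0) (locally 0).
Proof.
  assert (Hup : forall phi z g a K R1, 0 < R1 ->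
    (forall r, 0 < r < R1 -> is_derive phi r (z r / r) /\ is_derive z r (r * g r)) ->
    filterlim phi (at_right 0) (locally a) ->
    (forall r, 0 < r < R1 -> Rabs (g r) <= K) ->
    forall r, 0 < r < R1 -> z r <= K / 2 * (r * r)).
  { clear. intros phi z g a K R1 HR1 HD Hphi Hg r Hr.
    apply Rnot_lt_le; intros Hlt.
    set (d := z r - K / 2 * (r * r)).
    (* An excess [d] of the flux over [K / 2 r^2] persists towards the origin, because
       [z - K / 2 r^2] is nonincreasing in [r]. *)
    assert (Hz : forall s, 0 < s <= r -> d <= z s).
    { intros s Hs.
      assert (H : z r - z s <= K / 2 * (r * r) - K / 2 * (s * s)).
      { apply (derive_le_compare z (fun x => K / 2 * (x * x)) (fun x => x * g x) (fun x => x * K)).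
        - lra.
        - intros x Hx; apply HD; lra.
        - intros x Hx; auto_derive; [exact I | field].
        - intros x Hx. apply Rmult_le_compat_l; [lra |].
          apply Rle_trans with (1 := Rle_abs _). apply Hg; lra. }
      assert (0 <= K / 2 * (s * s)).
      { specialize (Hg r Hr). pose proof (Rabs_pos (g r)). nra. }
      unfold d; lra. }
    destruct (proj1 (filterlim_at_right_spec _ _ _) Hphi 1 Rlt_0_1) as [e [He Hlim]].
    (* With this [k] the logarithmic descent from [r] to [s = s0 e^(-k)] is at least
       [|phi r - a| + 2], so [phi s <= a - 2], although [phi s] is within 1 of [a]. *)
    set (k := (Rabs (phi r - a) + 2) / d).
    assert (Hd : 0 < d) by (unfold d; lra).
    assert (Hk : 0 < k).
    { apply Rdiv_lt_0_compat; [pose proof (Rabs_pos (phi r - a)); lra | lra]. }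
    set (s0 := Rmin (e / 2) r).
    assert (Hs0 : 0 < s0 /\ s0 < e /\ s0 <= r).
    { unfold s0, Rmin; destruct (Rle_dec _ _); lra. }
    set (s := s0 * exp (- k)).
    assert (Hek : 0 < exp (- k) < 1).
    { split; [apply exp_pos |]. rewrite <- exp_0. apply exp_increasing; lra. }
    assert (Hs : 0 < s < s0).
    { unfold s; split; [apply Rmult_lt_0_compat; lra |].
      rewrite <- (Rmult_1_r s0) at 2. apply Rmult_lt_compat_l; lra. }
    assert (Hcmp : d * ln r - d * ln s <= phi r - phi s).
    { apply (derive_le_compare (fun x => d * ln x) phi (fun x => d * / x) (fun x => z x / x)).
      - lra.
      - intros x Hx. apply (is_derive_scal ln). apply is_derive_Reals, derivable_pt_lim_ln; lra.
      - intros x Hx; apply HD; lra.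
      - intros x Hx. unfold Rdiv; apply Rmult_le_compat_r.
        + apply Rlt_le, Rinv_0_lt_compat; lra.
        + apply Hz; lra. }
    unfold s in Hcmp at 1; rewrite ln_mult, ln_exp in Hcmp by (try apply exp_pos; lra).
    assert (ln s0 <= ln r) by (apply ln_le; lra).
    assert (d * ln s0 <= d * ln r) by (apply Rmult_le_compat_l; lra).
    assert (d * k = Rabs (phi r - a) + 2) by (unfold k; field; lra).
    specialize (Hlim s ltac:(lra)). apply Rabs_def2 in Hlim.
    pose proof (Rle_abs (phi r - a)). lra. }
  intros HR1 HD Hphi Hg.
  assert (Hb : forall r, 0 < r < R1 -> Rabs (z r) <= K / 2 * (r * r)).
  { intros r Hr. apply Rabs_le; split; [| apply (Hup phi z g a K R1); assumption].
    cut (- z r <= K / 2 * (r * r)); [lra |].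
    apply (Hup (fun x => - phi x) (fun x => - z x) (fun x => - g x) (- a) K R1); try assumption.
    - intros x Hx; split.
      + replace (- z x / x) with (- (z x / x)) by (unfold Rdiv; ring).
        apply (is_derive_opp phi), HD, Hx.
      + replace (x * - g x) with (- (x * g x)) by ring. apply (is_derive_opp z), HD, Hx.
    - apply filterlim_at_right_spec; intros e He.
      destruct (proj1 (filterlim_at_right_spec _ _ _) Hphi e He) as [d [Hd H]].
      exists d; split; [exact Hd |]; intros y Hy.
      replace (- phi y - - a) with (- (phi y - a)) by ring. rewrite Rabs_Ropp. apply H, Hy.
    - intros x Hx; rewrite Rabs_Ropp; apply Hg, Hx. }
  assert (HK : 0 <= K).
  { specialize (Hg (R1 / 2) ltac:(lra)). pose proof (Rabs_pos (g (R1 / 2))); lra. }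
  apply filterlim_at_right_spec; intros e He.
  exists (Rmin (Rmin R1 1) (e / (K + 1))).
  assert (He' : 0 < e / (K + 1)) by (apply Rdiv_lt_0_compat; lra).
  split; [repeat apply Rmin_glb_lt; lra |].
  intros y Hy.
  assert (Hy' : y < R1 /\ y < 1 /\ y < e / (K + 1)).
  { revert Hy. unfold Rmin; repeat destruct (Rle_dec _ _); lra. }
  rewrite Rminus_0_r. apply Rle_lt_trans with (1 := Hb y ltac:(lra)).
  assert (y * y <= y) by nra.
  assert ((K + 1) * y < (K + 1) * (e / (K + 1))) by (apply Rmult_lt_compat_l; lra).
  replace ((K + 1) * (e / (K + 1))) with e in * by (field; lra).
  assert (K / 2 * (y * y) <= K / 2 * y) by (apply Rmult_le_compat_l; lra).
  assert (0 <= K * y) by (apply Rmult_le_pos; lra).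
  lra.
Qed.

Lemma behaviour_at_0_shift (N a : R) (w : R -> R) :
  behaviour_at_0 N a w <->
  filterlim (fun r => w r - 2 * N * ln r) (at_right 0) (locally a).
Proof.
  unfold behaviour_at_0. split; intros H; apply filterlim_at_right_spec; intros e He;
    destruct (proj1 (filterlim_at_right_spec _ _ _) H e He) as [d [Hd Hy]];
    exists d; (split; [exact Hd |]); intros y Hxy; specialize (Hy y Hxy).
  - replace (w y - 2 * N * ln y - a) with (w y - (2 * N * ln y + a) - 0) by ring. exact Hy.
  - replace (w y - (2 * N * ln y + a) - 0) with (w y - 2 * N * ln y - a) by ring. exact Hy.
Qed.

Definition log_shift (N : R) (w : R -> R) (r : R) : R := w r - 2 * N * ln r.
Definition flux_shift (N : R) (w : R -> R) (r : R) : R := r * Derive w r - 2 * N.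

(** Below the level [M] the cut-off is inactive. The behaviour prescribed at 0 concerns only [u] and
    [v]; that the regular fluxes vanish there is recovered from [flux_vanishes_at_0]. *)
Lemma solution_cut_solution (N1 N2 : R) (alpha : R * R) (T : Rbar) (u v : R -> R) (R1 M : R) :
  radial_solution_on N1 N2 alpha T u v -> 0 < R1 -> Rbar_le R1 T ->
  (forall r, 0 < r < R1 -> u r <= M /\ v r <= M) ->
  cut_solution M N1 N2 (fst alpha) (snd alpha) R1
    (log_shift N1 u) (log_shift N2 v) (flux_shift N1 u) (flux_shift N2 v).
Proof.
  intros Hsol HR1 HR1T HM.
  assert (HD : forall r, 0 < r < R1 ->
    (is_derive (log_shift N1 u) r (flux_shift N1 u r / r) /\
     is_derive (flux_shift N1 u) r (r * cut_rhs M N1 N2 (log_shift N1 u) (log_shift N2 v) r)) /\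
    (is_derive (log_shift N2 v) r (flux_shift N2 v r / r) /\
     is_derive (flux_shift N2 v) r (r * cut_rhs M N2 N1 (log_shift N2 v) (log_shift N1 u) r))).
  { intros r Hr.
    destruct (solution_trajectory _ _ _ _ _ _ r Hsol ltac:(lra)) as [Hu [Hv [Hp Hq]]].
    { apply Rbar_lt_le_trans with (2 := HR1T); simpl; lra. }
    assert (Hlog : forall N w, is_derive w r (r * Derive w r / r) ->
      is_derive (log_shift N w) r (flux_shift N w r / r)).
    { intros N w Hw. unfold flux_shift.
      replace ((r * Derive w r - 2 * N) / r) with (r * Derive w r / r - 2 * N * / r)
        by (field; lra).
      apply (is_derive_minus w (fun s => 2 * N * ln s)); [exact Hw |].
      apply (is_derive_scal ln). apply is_derive_Reals, derivable_pt_lim_ln; lra. }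
    assert (Hflux : forall N w g, is_derive (fun s => s * Derive w s) r g ->
      is_derive (flux_shift N w) r g).
    { intros N w g Hw. replace g with (g - 0) by ring.
      apply (is_derive_minus (fun s => s * Derive w s) (fun _ => 2 * N)); [exact Hw |].
      apply (is_derive_const (V := R_NormedModule)). }
    assert (Hun : forall N w, 2 * N * ln r + log_shift N w r = w r)
      by (intros; unfold log_shift; ring).
    destruct (HM r Hr). unfold cut_rhs; rewrite !Hun.
    rewrite cut_field_F1, cut_field_F2 by assumption.
    split; split; auto. }
  destruct Hsol as [_ [_ [Hb1 Hb2]]].
  apply behaviour_at_0_shift in Hb1; apply behaviour_at_0_shift in Hb2.
  destruct (cut_field_bounded M) as [K [_ HK]].
  split; [exact HD |]. split; [exact Hb1 |]. split; [exact Hb2 |]. split.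
  - apply (flux_vanishes_at_0 (log_shift N1 u) _ _ (fst alpha) K R1 HR1
      (fun r Hr => proj1 (HD r Hr)) Hb1). intros; apply HK.
  - apply (flux_vanishes_at_0 (log_shift N2 v) _ _ (snd alpha) K R1 HR1
      (fun r Hr => proj2 (HD r Hr)) Hb2). intros; apply HK.
Qed.

Lemma cut_solution_derive (M N1 N2 a1 a2 R1 : R) (phi psi z w : R -> R) (r : R) :
  cut_solution M N1 N2 a1 a2 R1 phi psi z w -> 0 < r < R1 ->
  is_derive (fun s => 2 * N1 * ln s + phi s) r ((2 * N1 + z r) / r) /\
  is_derive (fun s => 2 * N2 * ln s + psi s) r ((2 * N2 + w r) / r).
Proof.
  intros [HD _] Hr. destruct (HD r Hr) as [[H1 _] [H2 _]].
  assert (Hlog : forall N f l, is_derive f r (l / r) ->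
    is_derive (fun s => 2 * N * ln s + f s) r ((2 * N + l) / r)).
  { intros N f l Hf. replace ((2 * N + l) / r) with (2 * N * / r + l / r) by (field; lra).
    apply (is_derive_plus (fun s => 2 * N * ln s) f); [| exact Hf].
    apply (is_derive_scal ln). apply is_derive_Reals, derivable_pt_lim_ln; lra. }
  split; apply Hlog; assumption.
Qed.

Lemma cut_solution_solution (M N1 N2 a1 a2 R1 : R) (phi psi z w : R -> R) :
  cut_solution M N1 N2 a1 a2 R1 phi psi z w -> 0 < R1 ->
  (forall r, 0 < r < R1 -> 2 * N1 * ln r + phi r <= M /\ 2 * N2 * ln r + psi r <= M) ->
  radial_solution_on N1 N2 (a1, a2) R1
    (fun r => 2 * N1 * ln r + phi r) (fun r => 2 * N2 * ln r + psi r).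
Proof.
  intros Hsol HR1 HM. split; [exact HR1 |]. split; [| split].
  - intros r Hr HrR1. simpl in HrR1.
    pose proof (fun s Hs => cut_solution_derive _ _ _ _ _ _ _ _ _ _ s Hsol Hs) as Hder.
    destruct Hsol as [HD _].
    destruct (HD r ltac:(lra)) as [[_ H1] [_ H2]].
    destruct (HM r ltac:(lra)) as [M1 M2].
    unfold cut_rhs in H1, H2. rewrite cut_field_F1 in H1 by assumption.
    rewrite cut_field_F2 in H2 by assumption.
    assert (Hshift : forall N f g, is_derive f r g -> is_derive (fun s => 2 * N + f s) r g).
    { intros N f g Hf. replace g with (0 + g) by ring.
      apply (is_derive_plus (fun _ => 2 * N) f); [| exact Hf].
      apply (is_derive_const (V := R_NormedModule)). }
    split.
    + apply (flux_radial_laplace _ (fun s => 2 * N1 + z s)); [exact Hr | | apply Hshift, H1].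
      apply (locally_open_interval _ 0 R1); [lra |]. intros s Hs; apply Hder, Hs.
    + apply (flux_radial_laplace _ (fun s => 2 * N2 + w s)); [exact Hr | | apply Hshift, H2].
      apply (locally_open_interval _ 0 R1); [lra |]. intros s Hs; apply Hder, Hs.
  - apply behaviour_at_0_shift. destruct Hsol as [_ [H _]].
    apply (filterlim_ext phi); [intros; ring | exact H].
  - apply behaviour_at_0_shift. destruct Hsol as [_ [_ [H _]]].
    apply (filterlim_ext psi); [intros; ring | exact H].
Qed.

Lemma bounded_above_near_0 (N a : R) (phi : R -> R) :
  0 <= N -> filterlim phi (at_right 0) (locally a) ->
  exists d, 0 < d /\ forall r, 0 < r < d -> 2 * N * ln r + phi r <= a + 1.
Proof.
  intros HN Hphi.
  destruct (proj1 (filterlim_at_right_spec _ _ _) Hphi 1 Rlt_0_1) as [d [Hd H]].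
  exists (Rmin d 1); split; [apply Rmin_glb_lt; lra |].
  intros r Hr. pose proof (Rmin_l d 1); pose proof (Rmin_r d 1).
  specialize (H r ltac:(lra)). apply Rabs_def2 in H.
  assert (ln r <= 0) by (rewrite <- ln_1; apply ln_le; lra).
  assert (0 <= N * - ln r) by (apply Rmult_le_pos; lra). lra.
Qed.

(** Near the origin [2 N ln r <= 0] bounds from above, and compactness does the rest. An upper bound
    is all that the cut-off asks for; [u] and [v] may well tend to minus infinity at 0. *)
Lemma solution_bounded_above (N1 N2 : R) (alpha : R * R) (T : Rbar) (u v : R -> R) (R1 : R) :
  0 <= N1 -> 0 <= N2 -> radial_solution_on N1 N2 alpha T u v -> Rbar_lt R1 T ->
  exists M, forall r, 0 < r <= R1 -> u r <= M /\ v r <= M.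
Proof.
  intros HN1 HN2 Hsol HR1.
  assert (Hone : forall N a w, 0 <= N -> behaviour_at_0 N a w ->
    (forall r, 0 < r -> Rbar_lt r T -> continuous w r) ->
    exists M, forall r, 0 < r <= R1 -> w r <= M).
  { intros N a w HN Hb Hc. apply behaviour_at_0_shift in Hb.
    destruct (bounded_above_near_0 N a _ HN Hb) as [d [Hd Hnear]].
    destruct (Rlt_le_dec R1 (d / 2)) as [Hsmall | Hbig].
    - exists (a + 1); intros r Hr. specialize (Hnear r ltac:(lra)). lra.
    - destruct (continuity_ab_maj w (d / 2) R1 Hbig) as [x [Hx _]].
      { intros c Hc'. apply continuity_pt_filterlim, Hc; [lra |].
        apply Rbar_le_lt_trans with (2 := HR1); simpl; lra. }
      exists (Rmax (a + 1) (w x)); intros r Hr.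
      destruct (Rlt_le_dec r (d / 2)) as [Hrd | Hrd].
      + specialize (Hnear r ltac:(lra)).
        apply Rle_trans with (2 := Rmax_l _ _). lra.
      + apply Rle_trans with (2 := Rmax_r _ _). apply Hx; lra. }
  assert (Htr := fun r Hr HrT => solution_trajectory _ _ _ _ _ _ r Hsol Hr HrT).
  destruct Hsol as [_ [_ [Hb1 Hb2]]].
  destruct (Hone N1 (fst alpha) u HN1 Hb1) as [M1 HM1].
  { intros r Hr HrT. apply (is_derive_continuous _ _ _ (proj1 (Htr r Hr HrT))). }
  destruct (Hone N2 (snd alpha) v HN2 Hb2) as [M2 HM2].
  { intros r Hr HrT. apply (is_derive_continuous _ _ _ (proj1 (proj2 (Htr r Hr HrT)))). }
  exists (Rmax M1 M2); intros r Hr. split.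
  - apply Rle_trans with (2 := Rmax_l _ _). apply HM1, Hr.
  - apply Rle_trans with (2 := Rmax_r _ _). apply HM2, Hr.
Qed.

(** Both solutions solve one cut-off system with level above their common upper bound, and
    [cut_solution_dependence] is applied with data at distance zero. *)
Lemma radial_solution_unique (N1 N2 : R) (alpha : R * R) (T T' : Rbar) (u v u' v' : R -> R) (r : R) :
  0 <= N1 -> 0 <= N2 ->
  radial_solution_on N1 N2 alpha T u v -> radial_solution_on N1 N2 alpha T' u' v' ->
  0 < r -> Rbar_lt r T -> Rbar_lt r T' -> u r = u' r /\ v r = v' r.
Proof.
  intros HN1 HN2 Hsol Hsol' Hr HrT HrT'.
  destruct (Rbar_between r T HrT) as [s [Hs HsT]].
  destruct (Rbar_between r T' HrT') as [s' [Hs' HsT']].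
  set (R1 := Rmin s s').
  assert (HR1 : r < R1 /\ R1 <= s /\ R1 <= s') by (unfold R1, Rmin; destruct (Rle_dec _ _); lra).
  destruct (solution_bounded_above _ _ _ _ _ _ s HN1 HN2 Hsol HsT) as [M HM].
  destruct (solution_bounded_above _ _ _ _ _ _ s' HN1 HN2 Hsol' HsT') as [M' HM'].
  set (B := Rmax M M').
  assert (HB : M <= B /\ M' <= B) by (split; [apply Rmax_l | apply Rmax_r]).
  destruct (cut_solution_dependence B) as [L [_ Hdep]].
  assert (C1 : cut_solution B N1 N2 (fst alpha) (snd alpha) R1
    (log_shift N1 u) (log_shift N2 v) (flux_shift N1 u) (flux_shift N2 v)).
  { apply (solution_cut_solution _ _ _ _ _ _ _ _ Hsol); [lra | |].
    - apply Rbar_lt_le, Rbar_le_lt_trans with (2 := HsT); simpl; lra.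
    - intros x Hx. destruct (HM x ltac:(lra)). split; lra. }
  assert (C2 : cut_solution B N1 N2 (fst alpha) (snd alpha) R1
    (log_shift N1 u') (log_shift N2 v') (flux_shift N1 u') (flux_shift N2 v')).
  { apply (solution_cut_solution _ _ _ _ _ _ _ _ Hsol'); [lra | |].
    - apply Rbar_lt_le, Rbar_le_lt_trans with (2 := HsT'); simpl; lra.
    - intros x Hx. destruct (HM' x ltac:(lra)). split; lra. }
  destruct (Hdep _ _ _ _ _ _ _ _ _ _ _ _ _ _ _ C1 C2 r ltac:(lra)) as [H _].
  rewrite !Rminus_diag, Rabs_R0, Rplus_0_r, Rmult_0_r, Rmult_0_l in H.
  unfold log_shift in H.
  replace (u r - 2 * N1 * ln r - (u' r - 2 * N1 * ln r)) with (u r - u' r) in H by ring.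
  replace (v r - 2 * N2 * ln r - (v' r - 2 * N2 * ln r)) with (v r - v' r) in H by ring.
  pose proof (Rabs_pos (u r - u' r)); pose proof (Rabs_pos (v r - v' r)).
  assert (Hz : forall x, Rabs x <= 0 -> x = 0).
  { intros x Hx. pose proof (Rle_abs x); pose proof (Rle_abs (- x)) as H'.
    rewrite Rabs_Ropp in H'. lra. }
  split; apply Rminus_diag_uniq, Hz; lra.
Qed.

(** Near the origin each component of the cut-off solution exceeds its datum [a1] or [a2] by at most
    1, hence stays below the cut-off level there. *)
Lemma radial_solution_local (N1 N2 : R) (alpha : R * R) :
  0 <= N1 -> 0 <= N2 ->
  exists (t : R) (u v : R -> R), radial_solution_on N1 N2 alpha t u v.
Proof.
  intros HN1 HN2. destruct alpha as [a1 a2].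
  destruct (cut_solution_exists (Rmax a1 a2 + 1) N1 N2 a1 a2) as [phi [psi [z [w H]]]].
  destruct (H 1) as [_ [Hphi [Hpsi _]]].
  destruct (bounded_above_near_0 N1 a1 phi HN1 Hphi) as [d1 [Hd1 H1]].
  destruct (bounded_above_near_0 N2 a2 psi HN2 Hpsi) as [d2 [Hd2 H2]].
  exists (Rmin d1 d2). do 2 eexists.
  apply (cut_solution_solution _ _ _ _ _ _ _ _ _ _ (H _)); [apply Rmin_glb_lt; assumption |].
  intros r Hr. pose proof (Rmin_l d1 d2); pose proof (Rmin_r d1 d2).
  specialize (H1 r ltac:(lra)); specialize (H2 r ltac:(lra)).
  pose proof (Rmax_l a1 a2); pose proof (Rmax_r a1 a2). split; lra.
Qed.

Lemma radial_solution_ext (N1 N2 : R) (alpha : R * R) (t : R) (u v u' v' : R -> R) (r : R) :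
  radial_solution_on N1 N2 alpha t u v ->
  (forall s, 0 < s < t -> u s = u' s /\ v s = v' s) -> 0 < r < t ->
  radial_laplace_eq u' r (F1 (u' r) (v' r)) /\ radial_laplace_eq v' r (F2 (u' r) (v' r)).
Proof.
  intros Hsol Heq Hr.
  destruct (Heq r Hr) as [Eu Ev]. rewrite <- Eu, <- Ev.
  assert (Htr := fun s (Hs : 0 < s < t) => solution_trajectory _ _ _ _ _ _ s Hsol (proj1 Hs) (proj2 Hs)).
  destruct (Htr r Hr) as [_ [_ [Hp Hq]]].
  split.
  - apply (flux_radial_laplace _ (fun s => s * Derive u s)); [lra | | exact Hp].
    apply (locally_open_interval _ 0 t); [exact Hr |]. intros s Hs.
    apply (is_derive_ext_loc u); [| apply Htr, Hs].
    apply (locally_open_interval _ 0 t); [exact Hs |]. intros x Hx; apply Heq, Hx.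
  - apply (flux_radial_laplace _ (fun s => s * Derive v s)); [lra | | exact Hq].
    apply (locally_open_interval _ 0 t); [exact Hr |]. intros s Hs.
    apply (is_derive_ext_loc v); [| apply Htr, Hs].
    apply (locally_open_interval _ 0 t); [exact Hs |]. intros x Hx; apply Heq, Hx.
Qed.

Lemma radial_solution_restrict (N1 N2 : R) (alpha : R * R) (T : Rbar) (t : R) (u v : R -> R) :
  radial_solution_on N1 N2 alpha T u v -> 0 < t -> Rbar_le t T ->
  radial_solution_on N1 N2 alpha t u v.
Proof.
  intros [_ [H [Hb1 Hb2]]] Ht HtT. split; [exact Ht |]. split; [| split; assumption].
  intros r Hr Hrt. apply H; [exact Hr |]. apply Rbar_lt_le_trans with (1 := Hrt); exact HtT.
Qed.

Lemma Lub_Rbar_singleton (A : R -> Prop) (y : R) :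
  A y -> (forall z, A z -> z = y) -> real (Lub_Rbar A) = y.
Proof.
  intros Hy Huniq. rewrite (is_lub_Rbar_unique A (Finite y)); [reflexivity |]. split.
  - intros z Hz. rewrite (Huniq z Hz). apply Rle_refl.
  - intros b Hb. apply Hb, Hy.
Qed.

(* The values are glued as suprema of singletons, so that no choice is needed. *)
Lemma the_radial_solution_exists (N1 N2 : R) (alpha : R * R) :
  0 <= N1 -> 0 <= N2 ->
  exists (T : Rbar) (u v : R -> R), the_radial_solution N1 N2 alpha T u v.
Proof.
  intros HN1 HN2.
  set (E := fun t : R => exists u v, radial_solution_on N1 N2 alpha t u v).
  set (T := Lub_Rbar E).
  destruct (Lub_Rbar_correct E) as [Hub Hlub]. fold T in Hub, Hlub.
  set (u := fun r => real (Lub_Rbar (fun y => exists (t : R) u' v',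
    radial_solution_on N1 N2 alpha t u' v' /\ r < t /\ y = u' r))).
  set (v := fun r => real (Lub_Rbar (fun y => exists (t : R) u' v',
    radial_solution_on N1 N2 alpha t u' v' /\ r < t /\ y = v' r))).
  assert (Heq : forall (t : R) u' v', radial_solution_on N1 N2 alpha t u' v' ->
    forall r, 0 < r < t -> u' r = u r /\ v' r = v r).
  { intros t u' v' Hsol r [Hr Hrt].
    split; symmetry; apply Lub_Rbar_singleton.
    - exists t, u', v'. exact (conj Hsol (conj Hrt eq_refl)).
    - intros y [t' [u'' [v'' [Hsol' [Hrt' ->]]]]].
      apply (radial_solution_unique N1 N2 alpha t' t u'' v'' u' v' r); assumption.
    - exists t, u', v'. exact (conj Hsol (conj Hrt eq_refl)).
    - intros y [t' [u'' [v'' [Hsol' [Hrt' ->]]]]].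
      apply (radial_solution_unique N1 N2 alpha t' t u'' v'' u' v' r); assumption. }
  destruct (radial_solution_local N1 N2 alpha HN1 HN2) as [t0 [u0 [v0 H0]]].
  assert (Ht0 : 0 < t0) by apply H0.
  assert (Ht0T : Rbar_le t0 T) by (apply Hub; exists u0, v0; exact H0).
  assert (Hbehave : forall N a w w0, behaviour_at_0 N a w0 ->
    (forall r, 0 < r < t0 -> w0 r = w r) -> behaviour_at_0 N a w).
  { intros N a w w0 Hb Hw. apply filterlim_at_right_spec; intros e He.
    destruct (proj1 (filterlim_at_right_spec _ _ _) Hb e He) as [d [Hd Hy]].
    exists (Rmin d t0); split; [apply Rmin_glb_lt; assumption |]; intros y Hy0.
    pose proof (Rmin_l d t0); pose proof (Rmin_r d t0).
    rewrite <- (Hw y) by lra. apply Hy; lra. }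
  exists T, u, v. split.
  - split; [apply Rbar_lt_le_trans with (2 := Ht0T); exact Ht0 |]. split; [| split].
    + intros r Hr HrT.
      assert (exists t u' v', radial_solution_on N1 N2 alpha (Finite t) u' v' /\ r < t)
        as [t [u' [v' [Hsol Hrt]]]].
      { apply NNPP; intros Hno. apply (Rbar_lt_not_le _ _ HrT).
        apply Hlub. intros t [u' [v' Hsol]]. simpl. apply Rnot_lt_le; intros Hrt.
        apply Hno. exists t, u', v'; split; assumption. }
      apply (radial_solution_ext N1 N2 alpha t u' v' u v r Hsol); [| split; assumption].
      intros s Hs; apply (Heq t u' v' Hsol s Hs).
    + apply (Hbehave _ _ _ u0 (proj1 (proj2 (proj2 H0)))). intros; apply (Heq t0 u0 v0 H0 r H).
    + apply (Hbehave _ _ _ v0 (proj2 (proj2 (proj2 H0)))). intros; apply (Heq t0 u0 v0 H0 r H).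
  - intros T' u' v' Hsol. split.
    + apply Rbar_not_lt_le; intros HTT'.
      assert (exists t : R, Rbar_lt T t /\ Rbar_le t T') as [t [HTt HtT']].
      { destruct T as [x | |]; [| destruct T'; contradiction | elim Ht0T].
        destruct T' as [y | |]; simpl in HTT'; [| | contradiction].
        - exists y; split; [exact HTT' | apply Rle_refl].
        - exists (x + 1); split; [simpl; lra | exact I]. }
      apply (Rbar_lt_not_le _ _ HTt). apply Hub. exists u', v'.
      apply (radial_solution_restrict _ _ _ T'); [exact Hsol | | exact HtT'].
      assert (Htt : Rbar_lt t0 t) by (apply Rbar_le_lt_trans with (1 := Ht0T); exact HTt).
      simpl in Htt; lra.
    + intros r Hr HrT'. destruct (Rbar_between r T' HrT') as [s [Hrs HsT']].
      apply (Heq s u' v'); [| split; assumption].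
      apply (radial_solution_restrict _ _ _ T'); [exact Hsol | lra | apply Rbar_lt_le, HsT'].
Qed.

(** The system cut off one unit above [M] has a global solution, which coincides with [(u, v)]
    before a finite [t]. By continuity it stays below [M + 1] a little beyond [t], so it is a true
    solution on a longer interval, against maximality. *)
Lemma bounded_above_entire (N1 N2 : R) (alpha : R * R) (T : Rbar) (u v : R -> R) (M : R) :
  the_radial_solution N1 N2 alpha T u v ->
  (forall r, 0 < r -> Rbar_lt r T -> u r <= M /\ v r <= M) ->
  T = p_infty.
Proof.
  intros [Hsol Hmax] HM.
  destruct T as [t | |]; [exfalso | reflexivity | elim (proj1 Hsol)].
  assert (Ht : 0 < t) by apply Hsol.
  destruct (cut_solution_exists (M + 1) N1 N2 (fst alpha) (snd alpha)) as [phi [psi [z [w Hcut]]]].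
  destruct (cut_solution_dependence (M + 1)) as [L [_ Hdep]].
  assert (C1 : cut_solution (M + 1) N1 N2 (fst alpha) (snd alpha) t
    (log_shift N1 u) (log_shift N2 v) (flux_shift N1 u) (flux_shift N2 v)).
  { apply (solution_cut_solution _ _ _ _ _ _ _ _ Hsol); [lra | apply Rle_refl |].
    intros x Hx. destruct (HM x (proj1 Hx) (proj2 Hx)). split; lra. }
  assert (Hbd : forall r, 0 < r < t ->
    2 * N1 * ln r + phi r <= M /\ 2 * N2 * ln r + psi r <= M).
  { intros r Hr. destruct (HM r (proj1 Hr) (proj2 Hr)) as [H1 H2].
    destruct (Hdep _ _ _ _ _ _ _ _ _ _ _ _ _ _ _ C1 (Hcut t) r Hr) as [H _].
    rewrite !Rminus_diag, Rabs_R0, Rplus_0_r, Rmult_0_r, Rmult_0_l in H.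
    unfold log_shift in H.
    pose proof (Rabs_pos (u r - 2 * N1 * ln r - phi r)).
    pose proof (Rabs_pos (v r - 2 * N2 * ln r - psi r)).
    assert (K1 : Rabs (u r - 2 * N1 * ln r - phi r) <= 0) by lra.
    assert (K2 : Rabs (v r - 2 * N2 * ln r - psi r) <= 0) by lra.
    apply Rabs_le_between in K1; apply Rabs_le_between in K2. lra. }
  assert (Hext : forall N f l, is_derive (fun s => 2 * N * ln s + f s) t l ->
    (forall r, 0 < r < t -> 2 * N * ln r + f r <= M) ->
    exists d, 0 < d /\ forall r, 0 < r < t + d -> 2 * N * ln r + f r <= M + 1).
  { intros N f l Hd Hb. apply is_derive_continuous in Hd.
    destruct (proj1 (filterlim_locally _ _) Hd (mkposreal (1 / 2) ltac:(lra))) as [d Hd'].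
    assert (Hnear : forall r, t - d < r < t + d ->
      Rabs ((2 * N * ln r + f r) - (2 * N * ln t + f t)) < 1 / 2).
    { intros r Hr. apply (Hd' r). change (Rabs (r - t) < d). apply Rabs_def1; lra. }
    pose proof (cond_pos d).
    exists d; split; [lra |]. intros r Hr.
    set (s := Rmax (t / 2) (t - d / 2)).
    assert (Hs : 0 < s < t /\ t - d < s) by (unfold s, Rmax; destruct (Rle_dec _ _); lra).
    pose proof (Hnear s ltac:(lra)) as H1. specialize (Hb s ltac:(lra)) as H2.
    destruct (Rlt_le_dec r t) as [Hrt | Hrt].
    - specialize (Hb r ltac:(lra)). lra.
    - pose proof (Hnear r ltac:(lra)) as H3.
      apply Rabs_def2 in H1; apply Rabs_def2 in H3. lra. }
  destruct (cut_solution_derive _ _ _ _ _ _ _ _ _ _ t (Hcut (t + 1)) ltac:(lra)) as [D1 D2].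
  destruct (Hext N1 phi _ D1 (fun r Hr => proj1 (Hbd r Hr))) as [d1 [Hd1 H1]].
  destruct (Hext N2 psi _ D2 (fun r Hr => proj2 (Hbd r Hr))) as [d2 [Hd2 H2]].
  set (d := Rmin d1 d2).
  assert (Hd : 0 < d /\ d <= d1 /\ d <= d2) by (unfold d, Rmin; destruct (Rle_dec _ _); lra).
  assert (Hnew := cut_solution_solution _ _ _ _ _ (t + d) _ _ _ _ (Hcut _) ltac:(lra)).
  rewrite <- surjective_pairing in Hnew.
  destruct (Hmax _ _ _ (Hnew ltac:(intros r Hr; split; [apply H1 | apply H2]; lra))) as [Hle _].
  simpl in Hle; lra.
Qed.

(** The nearby solution is taken from the system cut off one unit above the given one. As it stays
    within distance 1 of that solution, it never meets the cut-off and solves the true system up to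
    [S > R1]. *)
Lemma radial_solution_dependence (N1 N2 : R) (alpha : R * R) (T : Rbar) (u v : R -> R) (R1 e : R) :
  0 <= N1 -> 0 <= N2 ->
  radial_solution_on N1 N2 alpha T u v -> 0 < R1 -> Rbar_lt R1 T -> 0 < e ->
  exists d, 0 < d /\ forall alpha' : R * R,
    Rabs (fst alpha' - fst alpha) < d -> Rabs (snd alpha' - snd alpha) < d ->
    exists (T' : R) (u' v' : R -> R),
      R1 < T' /\ radial_solution_on N1 N2 alpha' T' u' v' /\
      Rabs (u' R1 - u R1) < e /\ Rabs (v' R1 - v R1) < e /\
      Rabs (R1 * Derive u' R1 - R1 * Derive u R1) < e /\
      Rabs (R1 * Derive v' R1 - R1 * Derive v R1) < e.
Proof.
  intros HN1 HN2 Hsol HR1 HR1T He.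
  destruct (Rbar_between R1 T HR1T) as [S [HS HST]].
  destruct (solution_bounded_above _ _ _ _ _ _ S HN1 HN2 Hsol HST) as [M HM].
  destruct (cut_solution_dependence (M + 1)) as [L [HL Hdep]].
  assert (C1 : cut_solution (M + 1) N1 N2 (fst alpha) (snd alpha) S
    (log_shift N1 u) (log_shift N2 v) (flux_shift N1 u) (flux_shift N2 v)).
  { apply (solution_cut_solution _ _ _ _ _ _ _ _ Hsol); [lra | apply Rbar_lt_le, HST |].
    intros x Hx. destruct (HM x ltac:(lra)). split; lra. }
  (* [B] dominates both factors of [cut_solution_dependence] on [(0, S)]: [2 e^(L r^2)] for the
     values and [L r^2 e^(L r^2)] for the fluxes. *)
  set (B := (2 + L * (S * S)) * exp (L * (S * S))).
  assert (Hexp : 1 <= exp (L * (S * S))) by (apply exp_square_ge_1, HL).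
  assert (HSS : 0 <= L * (S * S)) by (apply Rmult_le_pos; [lra | apply Rle_0_sqr]).
  assert (HB : 0 < B) by (apply Rmult_lt_0_compat; lra).
  set (c := Rmin e 1).
  assert (Hc : 0 < c /\ c <= e /\ c <= 1) by (unfold c, Rmin; destruct (Rle_dec _ _); lra).
  exists (c / (2 * B)). split; [apply Rdiv_lt_0_compat; lra |].
  intros alpha' Ha1 Ha2.
  destruct (cut_solution_exists (M + 1) N1 N2 (fst alpha') (snd alpha')) as [phi [psi [z [w Hcut]]]].
  set (D := Rabs (fst alpha' - fst alpha) + Rabs (snd alpha' - snd alpha)).
  assert (HD0 : 0 <= D).
  { unfold D. pose proof (Rabs_pos (fst alpha' - fst alpha)).
    pose proof (Rabs_pos (snd alpha' - snd alpha)). lra. }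
  assert (HDB : D * B < c).
  { replace c with ((c / (2 * B) + c / (2 * B)) * B) by (field; lra).
    apply Rmult_lt_compat_r; [lra |]. unfold D; lra. }
  assert (Hclose : forall r, 0 < r < S ->
    Rabs (phi r - log_shift N1 u r) < c /\ Rabs (psi r - log_shift N2 v r) < c /\
    Rabs (z r - flux_shift N1 u r) < c /\ Rabs (w r - flux_shift N2 v r) < c).
  { intros r Hr.
    destruct (Hdep _ _ _ _ _ _ _ _ _ _ _ _ _ _ _ (Hcut S) C1 r Hr) as [H1 [H2 H3]].
    fold D in H1, H2, H3.
    assert (Hrr : 0 <= r * r <= S * S) by (split; [apply Rle_0_sqr | apply Rmult_le_compat; lra]).
    assert (HLr : L * (r * r) <= L * (S * S)) by (apply Rmult_le_compat_l; lra).
    assert (Her : exp (L * (r * r)) <= exp (L * (S * S))) by (apply exp_incr_le, HLr).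
    pose proof (exp_pos (L * (r * r))).
    assert (HLr0 : 0 <= L * (r * r)) by (apply Rmult_le_pos; lra).
    assert (K1 : 2 * exp (L * (r * r)) <= B) by (apply Rmult_le_compat; lra).
    assert (K2 : L * (r * r) * exp (L * (r * r)) <= B) by (apply Rmult_le_compat; lra).
    apply (Rmult_le_compat_l D) in K1; [| exact HD0].
    apply (Rmult_le_compat_l D) in K2; [| exact HD0].
    replace (2 * D * exp (L * (r * r))) with (D * (2 * exp (L * (r * r)))) in H1 by ring.
    replace (L * D * (r * r) * exp (L * (r * r))) with (D * (L * (r * r) * exp (L * (r * r))))
      in H2, H3 by ring.
    pose proof (Rabs_pos (phi r - log_shift N1 u r)).
    pose proof (Rabs_pos (psi r - log_shift N2 v r)).
    repeat split; lra. }
  exists S, (fun r => 2 * N1 * ln r + phi r), (fun r => 2 * N2 * ln r + psi r).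
  split; [exact HS |]. split; [| ].
  { rewrite (surjective_pairing alpha').
    apply (cut_solution_solution _ _ _ _ _ _ _ _ _ _ (Hcut S)); [lra |].
    intros r Hr. destruct (Hclose r Hr) as [H1 [H2 _]]. destruct (HM r ltac:(lra)).
    unfold log_shift in H1, H2. apply Rabs_def2 in H1; apply Rabs_def2 in H2. split; lra. }
  destruct (Hclose R1 ltac:(lra)) as [H1 [H2 [H3 H4]]].
  destruct (cut_solution_derive _ _ _ _ _ _ _ _ _ _ R1 (Hcut S) ltac:(lra)) as [D1 D2].
  replace (Derive (fun r => 2 * N1 * ln r + phi r) R1) with ((2 * N1 + z R1) / R1)
    by (symmetry; apply is_derive_unique, D1).
  replace (Derive (fun r => 2 * N2 * ln r + psi r) R1) with ((2 * N2 + w R1) / R1)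
    by (symmetry; apply is_derive_unique, D2).
  replace (R1 * ((2 * N1 + z R1) / R1)) with (2 * N1 + z R1) by (field; lra).
  replace (R1 * ((2 * N2 + w R1) / R1)) with (2 * N2 + w R1) by (field; lra).
  unfold log_shift, flux_shift in H1, H2, H3, H4.
  apply Rabs_def2 in H1; apply Rabs_def2 in H2; apply Rabs_def2 in H3; apply Rabs_def2 in H4.
  repeat split; apply Rabs_def1; lra.
Qed.

(** * The sign of the fluxes *)

(** [react u v] and [react v u] are the f1 and f2 of the overview; in terms of them the system has
    constant coefficients, and [2 F1 + F2 = - 3 f1], [F1 + 2 F2 = - 3 f2]. *)
Definition react (x y : R) : R := exp x * (1 - 2 * exp x + exp y).

Lemma F1_react (x y : R) : F1 x y = - 2 * react x y + react y x.
Proof. rewrite F1_cs_poly. unfold cs_poly, react. ring. Qed.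

Lemma F2_react (x y : R) : F2 x y = react x y - 2 * react y x.
Proof. rewrite F2_cs_poly. unfold cs_poly, react. ring. Qed.

Lemma F2_swap (x y : R) : F2 x y = F1 y x.
Proof. rewrite F1_react, F2_react. ring. Qed.

Lemma exp_le_1 (x : R) : x <= 0 -> exp x <= 1.
Proof. intros Hx. rewrite <- exp_0. apply exp_incr_le, Hx. Qed.

Lemma react_pos (x y : R) : 2 * exp x < 1 + exp y -> 0 < react x y.
Proof. intros H. apply Rmult_lt_0_compat; [apply exp_pos | lra]. Qed.

Lemma react_neg (x y : R) : 1 + exp y < 2 * exp x -> react x y < 0.
Proof. intros H. pose proof (exp_pos x). unfold react. nra. Qed.

Lemma react_nonpos (x y : R) : 1 + exp y <= 2 * exp x -> react x y <= 0.
Proof. intros H. pose proof (exp_pos x). unfold react. nra. Qed.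

(** In [X = e^x], [Y = e^y] the lines [2 X = 1 + Y] and [2 Y = 1 + X] meet only at (1, 1). For
    [X <= 1] the first region therefore lies on the nonnegative side of the second line. *)
Lemma react_nonneg_opposite (x y : R) :
  x <= 0 -> 1 + exp y <= 2 * exp x -> 0 <= react y x.
Proof.
  intros Hx H. pose proof (exp_le_1 x Hx). pose proof (exp_pos y).
  apply Rmult_le_pos; lra.
Qed.

Lemma trajectory_swap (u v p q : R -> R) (r : R) :
  trajectory u v p q r -> trajectory v u q p r.
Proof.
  intros [Hu [Hv [Hp Hq]]].
  rewrite F2_swap in Hq. rewrite <- (F2_swap (v r) (u r)) in Hp.
  exact (conj Hv (conj Hu (conj Hq Hp))).
Qed.

Lemma trajectory_theta (u v p q : R -> R) (r : R) :
  0 < r -> trajectory u v p q r ->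
  is_derive (fun s => 2 * u s + v s) r ((2 * p r + q r) / r).
Proof.
  intros Hr [Hu [Hv _]].
  replace ((2 * p r + q r) / r) with (2 * (p r / r) + q r / r) by (field; lra).
  apply (is_derive_plus (fun s => 2 * u s) v); [apply (is_derive_scal u), Hu | exact Hv].
Qed.

Lemma trajectory_flux (u v p q : R -> R) (r : R) :
  trajectory u v p q r ->
  is_derive (fun s => 2 * p s + q s) r (- (3 * r * react (u r) (v r))).
Proof.
  intros [_ [_ [Hp Hq]]].
  replace (- (3 * r * react (u r) (v r)))
    with (2 * (r * F1 (u r) (v r)) + r * F2 (u r) (v r))
    by (rewrite F1_react, F2_react; ring).
  apply (is_derive_plus (fun s => 2 * p s) q); [apply (is_derive_scal p), Hp | exact Hq].
Qed.

Lemma trajectory_continuous (u v p q : R -> R) (r : R) :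
  trajectory u v p q r ->
  continuous u r /\ continuous v r /\ continuous p r /\ continuous q r.
Proof.
  intros [H1 [H2 [H3 H4]]].
  repeat split; eapply is_derive_continuous; eassumption.
Qed.

Definition nonpos_trajectory (u v p q : R -> R) (r0 : R) : Prop :=
  0 < r0 /\ forall r, r0 <= r -> trajectory u v p q r /\ u r <= 0 /\ v r <= 0.

Lemma nonpos_trajectory_swap (u v p q : R -> R) (r0 : R) :
  nonpos_trajectory u v p q r0 -> nonpos_trajectory v u q p r0.
Proof.
  intros [H0 H]. split; [exact H0 |]. intros r Hr. destruct (H r Hr) as [Ht [Hu Hv]].
  split; [apply trajectory_swap, Ht | split; assumption].
Qed.

Lemma nonpos_trajectory_later (u v p q : R -> R) (r0 r1 : R) :
  nonpos_trajectory u v p q r0 -> r0 <= r1 -> nonpos_trajectory u v p q r1.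
Proof. intros [H0 H] H1. split; [lra |]. intros r Hr. apply H; lra. Qed.

Lemma u_increasing (u v p q : R -> R) (a b : R) :
  0 < a -> a <= b -> (forall r, a <= r <= b -> trajectory u v p q r) ->
  (forall r, a < r < b -> 0 <= p r) -> u a <= u b.
Proof.
  intros Ha Hab Ht Hp.
  apply (derive_nonneg_le u (fun r => p r / r)); [exact Hab | intros; apply Ht; assumption |].
  intros x Hx. apply Rdiv_le_0_compat; [apply Hp, Hx | lra].
Qed.

Lemma u_decreasing (u v p q : R -> R) (a b : R) :
  0 < a -> a <= b -> (forall r, a <= r <= b -> trajectory u v p q r) ->
  (forall r, a < r < b -> p r <= 0) -> u b <= u a.
Proof.
  intros Ha Hab Ht Hp.
  apply (derive_nonpos_le u (fun r => p r / r)); [exact Hab | intros; apply Ht; assumption |].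
  intros x Hx. assert (0 <= - p x / x) by (apply Rdiv_le_0_compat; [specialize (Hp x Hx) |]; lra).
  unfold Rdiv in *; lra.
Qed.

Lemma continuous_exp_lin (u v : R -> R) (r : R) :
  continuous u r -> continuous v r ->
  continuous (fun s => 2 * exp (u s)) r /\ continuous (fun s => 1 + exp (v s)) r.
Proof.
  intros Cu Cv. split.
  - apply (continuous_Rmult (fun _ => 2)); [apply continuous_const | apply continuous_Rexp, Cu].
  - apply (continuous_Rplus (fun _ => 1)); [apply continuous_const | apply continuous_Rexp, Cv].
Qed.

(* [u] is subharmonic and [v] superharmonic where [2 e^u > 1 + e^v], so there [u] can increase
   while [v] decreases only at the price of [u] tending to infinity. *)
Lemma no_escape_strict (u v p q : R -> R) (r0 : R) :
  nonpos_trajectory u v p q r0 ->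
  0 <= p r0 -> q r0 <= 0 -> 1 + exp (v r0) < 2 * exp (u r0) -> False.
Proof.
  intros [Hr0 H] Hp0 Hq0 Hstart.
  assert (Ht : forall r, r0 <= r -> trajectory u v p q r) by (intros; apply H; assumption).
  assert (Hcont : forall r, r0 <= r -> (forall s, r0 <= s < r -> 1 + exp (v s) < 2 * exp (u s)) ->
    p r0 <= p r /\ q r <= q r0).
  { intros r Hr Hs. split.
    - apply (derive_nonneg_le p (fun x => x * F1 (u x) (v x))); [exact Hr | |].
      + intros x Hx. apply Ht; lra.
      + intros x Hx. destruct (H x ltac:(lra)) as [_ [Hu Hv]]. specialize (Hs x ltac:(lra)).
        pose proof (react_neg _ _ Hs). pose proof (react_nonneg_opposite _ _ Hu (Rlt_le _ _ Hs)).
        apply Rmult_le_pos; [lra |]. rewrite F1_react; lra.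
    - apply (derive_nonpos_le q (fun x => x * F2 (u x) (v x))); [exact Hr | |].
      + intros x Hx. apply Ht; lra.
      + intros x Hx. destruct (H x ltac:(lra)) as [_ [Hu Hv]]. specialize (Hs x ltac:(lra)).
        pose proof (react_neg _ _ Hs). pose proof (react_nonneg_opposite _ _ Hu (Rlt_le _ _ Hs)).
        assert (F2 (u x) (v x) <= 0) by (rewrite F2_react; lra). nra. }
  assert (Hall : forall r, r0 <= r -> 1 + exp (v r) < 2 * exp (u r)).
  { intros r Hr. apply (real_induction (fun r => 1 + exp (v r) < 2 * exp (u r)) r0 r);
      [| exact Hstart | | lra].
    - intros x Hx Hlt. destruct (trajectory_continuous _ _ _ _ x (Ht x ltac:(lra))) as [Cu [Cv _]].
      destruct (continuous_exp_lin u v x Cu Cv) as [C1 C2].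
      exact (locally_lt _ _ x C2 C1 Hlt).
    - intros x Hx Hs.
      assert (Hu : u r0 <= u x).
      { apply (u_increasing u v p q); [lra | lra | intros; apply Ht; lra |].
        intros y Hy. destruct (Hcont y) as [Hp _]; [lra | intros; apply Hs; lra | lra]. }
      assert (Hv : v x <= v r0).
      { apply (u_decreasing v u q p); [lra | lra | intros; apply trajectory_swap, Ht; lra |].
        intros y Hy. destruct (Hcont y) as [_ Hq]; [lra | intros; apply Hs; lra | lra]. }
      pose proof (exp_incr_le _ _ Hu). pose proof (exp_incr_le _ _ Hv). lra. }
  assert (Hp1 : 0 < p (r0 + 1)).
  { apply Rle_lt_trans with (1 := Hp0).
    apply (derive_pos_lt p (fun x => x * F1 (u x) (v x))); [lra | |].
    + intros x Hx. apply Ht; lra.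
    + intros x Hx. destruct (H x ltac:(lra)) as [_ [Hu Hv]]. specialize (Hall x ltac:(lra)).
      pose proof (react_neg _ _ Hall). pose proof (react_nonneg_opposite _ _ Hu (Rlt_le _ _ Hall)).
      apply Rmult_lt_0_compat; [lra |]. rewrite F1_react; lra. }
  destruct (log_growth_unbounded u p (r0 + 1) (p (r0 + 1)) 0) as [r [Hr Hur]]; [lra | exact Hp1 | | |].
  - intros r Hr. apply Ht; lra.
  - intros r Hr.
    apply (derive_nonneg_le p (fun x => x * F1 (u x) (v x))); [exact Hr | |].
    + intros x Hx. apply Ht; lra.
    + intros x Hx. destruct (H x ltac:(lra)) as [_ [Hu Hv]]. specialize (Hall x ltac:(lra)).
      pose proof (react_neg _ _ Hall). pose proof (react_nonneg_opposite _ _ Hu (Rlt_le _ _ Hall)).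
      apply Rmult_le_pos; [lra |]. rewrite F1_react; lra.
  - destruct (H r ltac:(lra)) as [_ [Hu _]]. lra.
Qed.

(** On the boundary of the region [2 e^u - e^v] has positive derivative when [p > 0 > q], so a
    moment later the strict version applies. *)
Lemma no_escape (u v p q : R -> R) (r0 : R) :
  nonpos_trajectory u v p q r0 ->
  0 < p r0 -> q r0 < 0 -> 1 + exp (v r0) <= 2 * exp (u r0) -> False.
Proof.
  intros H Hp Hq Hge. pose proof H as [Hr0 H'].
  destruct (H' r0 (Rle_refl _)) as [Ht _].
  destruct (trajectory_continuous _ _ _ _ _ Ht) as [_ [_ [Cp Cq]]].
  assert (Hd : is_derive (fun r => 2 * exp (u r) - exp (v r)) r0
                 ((2 * exp (u r0) * p r0 - exp (v r0) * q r0) / r0)).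
  { destruct Ht as [Hu [Hv _]].
    auto_derive; [split; [eexists; exact Hu | split; [eexists; exact Hv | exact I]] |].
    replace (Derive (fun x => u x) r0) with (p r0 / r0) by (symmetry; apply is_derive_unique, Hu).
    replace (Derive (fun x => v x) r0) with (q r0 / r0) by (symmetry; apply is_derive_unique, Hv).
    field; lra. }
  destruct (derive_pos_right _ _ _ Hd) as [e He].
  { pose proof (exp_pos (u r0)); pose proof (exp_pos (v r0)).
    apply Rdiv_lt_0_compat; [nra | lra]. }
  destruct (locally_lt (fun _ => 0) p r0 (continuous_const _ _) Cp Hp) as [e1 He1].
  destruct (locally_lt q (fun _ => 0) r0 Cq (continuous_const _ _) Hq) as [e2 He2].
  set (d := Rmin e (Rmin e1 e2) / 2).
  assert (Hdd : 0 < d /\ d < e /\ d < e1 /\ d < e2).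
  { pose proof (cond_pos e); pose proof (cond_pos e1); pose proof (cond_pos e2).
    unfold d, Rmin; repeat destruct (Rle_dec _ _); lra. }
  assert (Hball : Rabs (r0 + d - r0) = d) by (rewrite Rabs_right; lra).
  specialize (He (r0 + d) ltac:(lra)).
  specialize (He1 (r0 + d)). specialize (He2 (r0 + d)).
  assert (K1 : 0 < p (r0 + d)) by (apply He1; change (Rabs (r0 + d - r0) < e1); lra).
  assert (K2 : q (r0 + d) < 0) by (apply He2; change (Rabs (r0 + d - r0) < e2); lra).
  apply (no_escape_strict u v p q (r0 + d)); [apply (nonpos_trajectory_later _ _ _ _ r0) | | |];
    try assumption; lra.
Qed.

Lemma limit_nonpos (f : R -> R) (a b : R) :
  a < b -> continuous f b -> (forall s, a <= s < b -> f s <= 0) -> f b <= 0.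
Proof.
  intros Hab Hc Hs. apply Rnot_lt_le; intros Hlt.
  destruct (locally_lt (fun _ => 0) f b (continuous_const _ _) Hc Hlt) as [e He].
  set (s := Rmax a (b - e / 2)).
  assert (Hs' : a <= s < b /\ b - s < e).
  { pose proof (cond_pos e). unfold s, Rmax; destruct (Rle_dec _ _); lra. }
  specialize (Hs s (proj1 Hs')).
  assert (0 < f s); [| lra].
  apply He. change (Rabs (s - b) < e). rewrite Rabs_left; lra.
Qed.

Definition descending (p q : R -> R) (r : R) : Prop := 2 * p r + q r < 0 /\ 2 * q r + p r < 0.

Lemma descending_swap (p q : R -> R) (r : R) : descending p q r -> descending q p r.
Proof. intros [H1 H2]; split; assumption. Qed.

Lemma continuous_lin (p q : R -> R) (r : R) :
  continuous p r -> continuous q r -> continuous (fun s => 2 * p s + q s) r.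
Proof.
  intros Cp Cq. apply (continuous_plus (fun s => 2 * p s) q); [| exact Cq].
  apply (continuous_mult (fun _ => 2) p); [apply continuous_const | exact Cp].
Qed.

(** Where [2 e^u < 1 + e^v] the flux [2 p + q] strictly decreases, and so it cannot climb from
    negative values to 0. *)
Lemma flux_first_zero (u v p q : R -> R) (a b : R) :
  a < b -> 0 < a ->
  (forall r, a <= r <= b -> trajectory u v p q r) ->
  (forall r, a <= r < b -> 2 * p r + q r < 0) ->
  2 * p b + q b = 0 -> 1 + exp (v b) <= 2 * exp (u b).
Proof.
  intros Hab Ha Ht Hneg Hz. apply Rnot_lt_le; intros Hlt.
  destruct (trajectory_continuous _ _ _ _ b (Ht b ltac:(lra))) as [Cu [Cv _]].
  destruct (continuous_exp_lin u v b Cu Cv) as [C1 C2].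
  destruct (locally_lt _ _ b C1 C2 Hlt) as [e He].
  set (s := Rmax a (b - e / 2)).
  assert (Hs : a <= s < b /\ b - s < e).
  { pose proof (cond_pos e). unfold s, Rmax; destruct (Rle_dec _ _); lra. }
  assert (H : 2 * p b + q b < 2 * p s + q s).
  { apply (derive_neg_lt (fun r => 2 * p r + q r) (fun r => - (3 * r * react (u r) (v r)))).
    - lra.
    - intros x Hx. apply trajectory_flux, Ht; lra.
    - intros x Hx. assert (0 < react (u x) (v x)).
      { apply react_pos, He. change (Rabs (x - b) < e). rewrite Rabs_left; lra. }
      assert (0 < 3 * x * react (u x) (v x)) by (apply Rmult_lt_0_compat; lra). lra. }
  specialize (Hneg s (proj1 Hs)). lra.
Qed.

(** At a first exit some flux vanishes, say [2 p + q]. If the other is still negative, then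
    [p > 0 > q] and [no_escape] applies. If both vanish, [flux_first_zero] gives both inequalities
    and forces [u = v = 0], although [2 u + v] has strictly decreased from a nonpositive value. *)
Lemma descending_forever (u v p q : R -> R) (r0 : R) :
  nonpos_trajectory u v p q r0 -> descending p q r0 ->
  forall r, r0 <= r -> descending p q r.
Proof.
  intros H Hd r Hr. pose proof H as [Hr0 H'].
  assert (Ht : forall x, r0 <= x -> trajectory u v p q x) by (intros; apply H'; assumption).
  assert (Hstep : forall u v p q x, nonpos_trajectory u v p q r0 -> r0 < x ->
    (forall s, r0 <= s < x -> descending p q s) -> 2 * p x + q x < 0).
  { clear - Hr0. intros u v p q x H Hx Hs. pose proof H as [_ H'].
    assert (Ht : forall x, r0 <= x -> trajectory u v p q x) by (intros; apply H'; assumption).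
    destruct (trajectory_continuous _ _ _ _ x (Ht x ltac:(lra))) as [Cu [Cv [Cp Cq]]].
    assert (Ha : 2 * p x + q x <= 0).
    { apply (limit_nonpos (fun s => 2 * p s + q s) r0 x Hx); [apply continuous_lin; assumption |].
      intros s Hs'; apply Rlt_le, Hs, Hs'. }
    assert (Hb : 2 * q x + p x <= 0).
    { apply (limit_nonpos (fun s => 2 * q s + p s) r0 x Hx); [apply continuous_lin; assumption |].
      intros s Hs'; apply Rlt_le, Hs, Hs'. }
    destruct Ha as [Ha | Ha]; [exact Ha | exfalso].
    pose proof (flux_first_zero u v p q r0 x Hx Hr0 ltac:(intros; apply Ht; lra)
      (fun s Hs' => proj1 (Hs s Hs')) Ha) as HB.
    destruct Hb as [Hb | Hb].
    - apply (no_escape u v p q x); [apply (nonpos_trajectory_later _ _ _ _ r0) | | |];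
        try assumption; lra.
    - pose proof (flux_first_zero v u q p r0 x Hx Hr0
        ltac:(intros; apply trajectory_swap, Ht; lra) (fun s Hs' => proj2 (Hs s Hs')) Hb) as HC.
      destruct (H' x ltac:(lra)) as [_ [Hu Hv]].
      pose proof (exp_le_1 _ Hu). pose proof (exp_le_1 _ Hv).
      assert (Hlt : 2 * u x + v x < 2 * u r0 + v r0).
      { apply (derive_neg_lt (fun r => 2 * u r + v r) (fun r => (2 * p r + q r) / r)); [exact Hx | |].
        - intros y Hy; apply trajectory_theta; [lra | apply Ht; lra].
        - intros y Hy. destruct (Hs y ltac:(lra)) as [Hya _].
          assert (0 < - (2 * p y + q y) / y) by (apply Rdiv_lt_0_compat; lra).
          unfold Rdiv in *; lra. }
      destruct (H' r0 (Rle_refl _)) as [_ [Hu0 Hv0]].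
      assert (Hux : u x = 0) by (apply exp_inv; rewrite exp_0; lra).
      assert (Hvx : v x = 0) by (apply exp_inv; rewrite exp_0; lra).
      lra. }
  apply (real_induction (descending p q) r0 r); [| exact Hd | | lra].
  - intros x Hx [Ha Hb]. destruct (trajectory_continuous _ _ _ _ x (Ht x ltac:(lra))) as [_ [_ [Cp Cq]]].
    apply filter_and.
    + apply (locally_lt (fun s => 2 * p s + q s) (fun _ => 0));
        [apply continuous_lin; assumption | apply continuous_const | exact Ha].
    + apply (locally_lt (fun s => 2 * q s + p s) (fun _ => 0));
        [apply continuous_lin; assumption | apply continuous_const | exact Hb].
  - intros x Hx Hs. split.
    + apply (Hstep u v p q); [exact H | lra | exact Hs].
    + apply (Hstep v u q p); [apply nonpos_trajectory_swap, H | lra |].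
      intros s Hs'; apply descending_swap, Hs, Hs'.
Qed.

Lemma real_induction_backward (P : R -> Prop) (a b : R) :
  (forall r, a <= r <= b -> P r -> locally r P) ->
  P b ->
  (forall r, a <= r < b -> (forall s, r < s <= b -> P s) -> P r) ->
  forall r, a <= r <= b -> P r.
Proof.
  intros Hopen Hb Hlim r Hr.
  rewrite <- (Ropp_involutive r).
  apply (real_induction (fun x => P (- x)) (- b) (- a)); [| | | lra].
  - intros x Hx HP. destruct (Hopen (- x) ltac:(lra) HP) as [e He].
    exists e; intros y Hy. apply He. change (Rabs (y - x) < e) in Hy.
    change (Rabs (- y - - x) < e). replace (- y - - x) with (- (y - x)) by ring.
    rewrite Rabs_Ropp; exact Hy.
  - rewrite Ropp_involutive; exact Hb.
  - intros x Hx Hs. apply Hlim; [lra |]. intros s Hs'.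
    rewrite <- (Ropp_involutive s). apply Hs; lra.
Qed.

Lemma open_signs (u v p q : R -> R) (r : R) :
  trajectory u v p q r -> 0 < p r /\ q r < 0 -> locally r (fun s => 0 < p s /\ q s < 0).
Proof.
  intros Ht [Hp Hq]. destruct (trajectory_continuous _ _ _ _ _ Ht) as [_ [_ [Cp Cq]]].
  apply filter_and.
  - apply (locally_lt (fun _ => 0) p); [apply continuous_const | exact Cp | exact Hp].
  - apply (locally_lt q (fun _ => 0)); [exact Cq | apply continuous_const | exact Hq].
Qed.

(* Backwards in [r] the region [1 + e^u <= 2 e^v] would be invariant and the flux [2 q + p] would
   stay below its negative value at [r0], against its limit at the origin. *)
Lemma not_in_v_region (u v p q : R -> R) (r0 l : R) :
  (forall r, 0 < r -> trajectory u v p q r /\ u r <= 0 /\ v r <= 0) ->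
  filterlim (fun r => 2 * q r + p r) (at_right 0) (locally l) -> 0 <= l ->
  0 < r0 -> 0 <= 2 * p r0 + q r0 -> 2 * q r0 + p r0 < 0 ->
  2 * exp (v r0) < 1 + exp (u r0).
Proof.
  intros H Hlim Hl Hr0 Ha Hb. apply Rnot_le_lt; intros HC.
  assert (Hmono : forall r, 0 < r <= r0 -> (forall s, r < s <= r0 -> 0 < p s /\ q s < 0) ->
    0 <= 2 * p r + q r /\ 2 * q r + p r <= 2 * q r0 + p r0).
  { intros r Hr Hs.
    assert (Hreg : forall s, r < s <= r0 -> 1 + exp (u s) <= 2 * exp (v s)).
    { intros s Hs'.
      assert (Hu : u s <= u r0).
      { apply (u_increasing u v p q); [lra | lra | intros; apply H; lra |].
        intros y Hy; apply Rlt_le, Hs; lra. }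
      assert (Hv : v r0 <= v s).
      { apply (u_decreasing v u q p); [lra | lra | intros; apply trajectory_swap, H; lra |].
        intros y Hy; apply Rlt_le, Hs; lra. }
      pose proof (exp_incr_le _ _ Hu). pose proof (exp_incr_le _ _ Hv). lra. }
    split.
    - apply Rle_trans with (1 := Ha).
      apply (derive_nonpos_le (fun s => 2 * p s + q s) (fun s => - (3 * s * react (u s) (v s))));
        [lra | |].
      + intros x Hx; apply trajectory_flux, H; lra.
      + intros x Hx. destruct (H x ltac:(lra)) as [_ [_ Hv]].
        pose proof (react_nonneg_opposite _ _ Hv (Hreg x ltac:(lra))).
        assert (0 <= 3 * x * react (u x) (v x)) by (apply Rmult_le_pos; lra). lra.
    - apply (derive_nonneg_le (fun s => 2 * q s + p s) (fun s => - (3 * s * react (v s) (u s))));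
        [lra | |].
      + intros x Hx; apply (trajectory_flux v u), trajectory_swap, H; lra.
      + intros x Hx. pose proof (react_nonpos _ _ (Hreg x ltac:(lra))).
        assert (0 <= 3 * x * - react (v x) (u x)) by (apply Rmult_le_pos; lra). lra. }
  assert (Hall : forall r, 0 < r <= r0 -> 0 < p r /\ q r < 0).
  { intros r Hr. apply (real_induction_backward (fun s => 0 < p s /\ q s < 0) r r0); [| | | lra].
    - intros x Hx. apply (open_signs u v), H; lra.
    - lra.
    - intros x Hx Hs. destruct (Hmono x ltac:(lra) Hs). lra. }
  destruct (proj1 (filterlim_at_right_spec _ _ _) Hlim (- (2 * q r0 + p r0)) ltac:(lra)) as [d [Hd Hnear]].
  set (r := Rmin d r0 / 2).
  assert (Hr : 0 < r /\ r < d /\ r < r0) by (unfold r, Rmin; destruct (Rle_dec _ _); lra).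
  destruct (Hmono r ltac:(lra)) as [_ Hbr]; [intros s Hs; apply Hall; lra |].
  specialize (Hnear r ltac:(lra)). apply Rabs_def2 in Hnear. lra.
Qed.

(** Otherwise [2 p + q >= 0] as long as [2 q + p < 0], whence [p > 0 > q]: [u] rises, [v] falls, the
    inequality between the exponentials is preserved, and [2 q + p] keeps decreasing. *)
Lemma becomes_descending (u v p q : R -> R) (r0 : R) :
  nonpos_trajectory u v p q r0 ->
  2 * q r0 + p r0 < 0 -> 2 * exp (v r0) < 1 + exp (u r0) ->
  exists r, r0 <= r /\ descending p q r.
Proof.
  intros [Hr0 H] Hb HC. apply NNPP; intros Hno.
  assert (Ht : forall r, r0 <= r -> trajectory u v p q r) by (intros; apply H; assumption).
  assert (Ha : forall r, r0 <= r -> 2 * q r + p r < 0 -> 0 <= 2 * p r + q r).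
  { intros r Hr Hbr. apply Rnot_lt_le; intros Har. apply Hno.
    exists r; split; [exact Hr | split; assumption]. }
  assert (Hmono : forall r, r0 <= r -> (forall s, r0 <= s < r -> 2 * q s + p s < 0) ->
    2 * q r + p r <= 2 * q r0 + p r0).
  { intros r Hr Hs.
    apply (derive_nonpos_le (fun s => 2 * q s + p s) (fun s => - (3 * s * react (v s) (u s))));
      [lra | |].
    - intros x Hx; apply (trajectory_flux v u), trajectory_swap, Ht; lra.
    - intros x Hx.
      assert (Hsg : forall y, r0 < y < x -> 0 < p y /\ q y < 0).
      { intros y Hy. specialize (Hs y ltac:(lra)) as Hby. specialize (Ha y ltac:(lra) Hby). lra. }
      assert (Hu : u r0 <= u x).
      { apply (u_increasing u v p q); [lra | lra | intros; apply Ht; lra |].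
        intros y Hy; apply Rlt_le, Hsg; lra. }
      assert (Hv : v x <= v r0).
      { apply (u_decreasing v u q p); [lra | lra | intros; apply trajectory_swap, Ht; lra |].
        intros y Hy; apply Rlt_le, Hsg; lra. }
      pose proof (exp_incr_le _ _ Hu). pose proof (exp_incr_le _ _ Hv).
      assert (0 < react (v x) (u x)) by (apply react_pos; lra).
      assert (0 < 3 * x * react (v x) (u x)) by (apply Rmult_lt_0_compat; lra). lra. }
  assert (Hall : forall r, r0 <= r -> 2 * q r + p r < 0).
  { intros r Hr. apply (real_induction (fun s => 2 * q s + p s < 0) r0 r); [| exact Hb | | lra].
    - intros x Hx Hlt.
      destruct (trajectory_continuous _ _ _ _ x (Ht x ltac:(lra))) as [_ [_ [Cp Cq]]].
      apply (locally_lt (fun s => 2 * q s + p s) (fun _ => 0));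
        [apply continuous_lin; assumption | apply continuous_const | exact Hlt].
    - intros x Hx Hs. specialize (Hmono x ltac:(lra) Hs). lra. }
  (* The constant comes from [3 p = 2 (2 p + q) - (2 q + p)], whose first term is nonnegative and
     whose second is at least [- (2 q r0 + p r0)]. *)
  destruct (log_growth_unbounded u p r0 (- (2 * q r0 + p r0) / 3) 0) as [r [Hr Hur]];
    [lra | lra | | |].
  - intros r Hr; apply Ht, Hr.
  - intros r Hr. specialize (Ha r Hr (Hall r Hr)).
    specialize (Hmono r Hr ltac:(intros; apply Hall; lra)). lra.
  - destruct (H r Hr) as [_ [Hu _]]. lra.
Qed.

(** At a point where only one flux is negative, [not_in_v_region], looking back to the origin, gives
    the inequality from which [becomes_descending], looking forward, reaches descent. *)
Lemma monotone_or_descending (u v p q : R -> R) (l1 l2 : R) :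
  (forall r, 0 < r -> trajectory u v p q r /\ u r <= 0 /\ v r <= 0) ->
  filterlim (fun r => 2 * p r + q r) (at_right 0) (locally l1) -> 0 <= l1 ->
  filterlim (fun r => 2 * q r + p r) (at_right 0) (locally l2) -> 0 <= l2 ->
  (forall r, 0 < r -> 0 <= 2 * p r + q r /\ 0 <= 2 * q r + p r) \/
  exists r, 0 < r /\ descending p q r.
Proof.
  intros H H1 Hl1 H2 Hl2.
  destruct (classic (exists r, 0 < r /\ descending p q r)) as [| Hno]; [right; assumption | left].
  assert (Hswap : forall r, 0 < r -> trajectory v u q p r /\ v r <= 0 /\ u r <= 0).
  { intros r Hr. destruct (H r Hr) as [Ht [Hu Hv]].
    split; [apply trajectory_swap, Ht | split; assumption]. }
  intros r Hr. split; apply Rnot_lt_le; intros Hlt; apply Hno.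
  - destruct (Rlt_le_dec (2 * q r + p r) 0) as [Hb | Hb].
    { exists r; split; [exact Hr | split; assumption]. }
    destruct (becomes_descending v u q p r) as [s [Hs Hd]].
    + split; [exact Hr |]. intros s Hs; apply Hswap; lra.
    + exact Hlt.
    + apply (not_in_v_region v u q p r l1); assumption.
    + exists s; split; [lra | apply descending_swap, Hd].
  - destruct (Rlt_le_dec (2 * p r + q r) 0) as [Ha | Ha].
    { exists r; split; [exact Hr | split; assumption]. }
    destruct (becomes_descending u v p q r) as [s [Hs Hd]].
    + split; [exact Hr |]. intros s Hs; apply H; lra.
    + exact Hlt.
    + apply (not_in_v_region u v p q r l2); assumption.
    + exists s; split; [lra | exact Hd].
Qed.

(** * Limits at infinity in the monotone and the descending case *)

Lemma eventually_ge (f : R -> R) (l c : R) :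
  is_lim f p_infty l -> c < l -> exists r0, forall r, r0 < r -> c < f r.
Proof.
  intros Hf Hc. apply is_lim_spec in Hf.
  assert (He : 0 < l - c) by lra.
  destruct (Hf (mkposreal _ He)) as [r0 Hr0].
  exists r0; intros r Hr. specialize (Hr0 r Hr). simpl in Hr0. apply Rabs_def2 in Hr0. lra.
Qed.

Lemma eventually_le (f : R -> R) (l c : R) :
  is_lim f p_infty l -> l < c -> exists r0, forall r, r0 < r -> f r < c.
Proof.
  intros Hf Hc. apply is_lim_spec in Hf.
  assert (He : 0 < c - l) by lra.
  destruct (Hf (mkposreal _ He)) as [r0 Hr0].
  exists r0; intros r Hr. specialize (Hr0 r Hr). simpl in Hr0. apply Rabs_def2 in Hr0. lra.
Qed.

Lemma is_lim_exp_comp (u : R -> R) (l : R) :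
  is_lim u p_infty l -> is_lim (fun r => exp (u r)) p_infty (exp l).
Proof.
  intros Hu. apply (filterlim_comp _ _ _ u exp _ (locally l)); [exact Hu |].
  apply continuous_exp.
Qed.

Lemma is_lim_F1 (u v : R -> R) (lu lv : R) :
  is_lim u p_infty lu -> is_lim v p_infty lv ->
  is_lim (fun r => F1 (u r) (v r)) p_infty (F1 lu lv).
Proof.
  intros Hu Hv. rewrite F1_cs_poly.
  apply is_lim_ext with (fun r => cs_poly (exp (u r)) (exp (v r))).
  { intros; symmetry; apply F1_cs_poly. }
  apply is_lim_exp_comp in Hu; apply is_lim_exp_comp in Hv.
  unfold cs_poly. set (U := fun r => exp (u r)) in *. set (V := fun r => exp (v r)) in *.
  assert (HUU : is_lim (fun r => U r * U r) p_infty (exp lu * exp lu))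
    by (apply (is_lim_mult U U p_infty _ _ Hu Hu); exact I).
  assert (HVV : is_lim (fun r => V r * V r) p_infty (exp lv * exp lv))
    by (apply (is_lim_mult V V p_infty _ _ Hv Hv); exact I).
  assert (HUV : is_lim (fun r => U r * V r) p_infty (exp lu * exp lv))
    by (apply (is_lim_mult U V p_infty _ _ Hu Hv); exact I).
  apply is_lim_minus'; [apply is_lim_minus'; [apply is_lim_plus'; [apply is_lim_plus' |] |] |].
  - apply (is_lim_scal_l U (- 2) p_infty _ Hu).
  - exact Hv.
  - apply (is_lim_scal_l _ 4 p_infty _ HUU).
  - apply (is_lim_scal_l _ 2 p_infty _ HVV).
  - exact HUV.
Qed.

(** A nonzero limit of [F1] drives the flux [p] beyond 1 in absolute value with a fixed sign, and
    then [u] moves away at least logarithmically from its supposed finite limit. *)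
Lemma limit_F1_zero (u v p q : R -> R) (r0 lu lv : R) :
  0 < r0 -> (forall r, r0 <= r -> trajectory u v p q r) ->
  is_lim u p_infty lu -> is_lim v p_infty lv -> F1 lu lv = 0.
Proof.
  intros Hr0 Ht Hu Hv.
  pose proof (is_lim_F1 u v lu lv Hu Hv) as HF.
  destruct (Rtotal_order (F1 lu lv) 0) as [Hneg | [Hz | Hpos]]; [exfalso | exact Hz | exfalso].
  - destruct (eventually_le _ _ (F1 lu lv / 2) HF ltac:(lra)) as [r1 Hr1].
    destruct (eventually_ge _ _ (lu - 1) Hu ltac:(lra)) as [r2 Hr2].
    set (R0 := Rmax r0 (Rmax r1 r2) + 1).
    assert (HR0 : r0 < R0 /\ r1 < R0 /\ r2 < R0)
      by (unfold R0, Rmax; repeat destruct (Rle_dec _ _); lra).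
    destruct (quadratic_growth (fun r => - p r) (fun r => - F1 (u r) (v r)) R0 (- F1 lu lv / 2) 1)
      as [R1 [HR1 Hp]]; [lra | lra | | |].
    + intros r Hr. replace (r * - F1 (u r) (v r)) with (- (r * F1 (u r) (v r))) by ring.
      apply (is_derive_opp p), Ht; lra.
    + intros r Hr. specialize (Hr1 r ltac:(lra)). lra.
    + destruct (log_decay_unbounded u p R1 1 (lu - 1)) as [r [Hr Hur]]; [lra | lra | | |].
      * intros r Hr. apply Ht; lra.
      * intros r Hr. specialize (Hp r Hr). lra.
      * specialize (Hr2 r ltac:(lra)). lra.
  - destruct (eventually_ge _ _ (F1 lu lv / 2) HF ltac:(lra)) as [r1 Hr1].
    destruct (eventually_le _ _ (lu + 1) Hu ltac:(lra)) as [r2 Hr2].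
    set (R0 := Rmax r0 (Rmax r1 r2) + 1).
    assert (HR0 : r0 < R0 /\ r1 < R0 /\ r2 < R0)
      by (unfold R0, Rmax; repeat destruct (Rle_dec _ _); lra).
    destruct (quadratic_growth p (fun r => F1 (u r) (v r)) R0 (F1 lu lv / 2) 1)
      as [R1 [HR1 Hp]]; [lra | lra | | |].
    + intros r Hr. apply Ht; lra.
    + intros r Hr. specialize (Hr1 r ltac:(lra)). lra.
    + destruct (log_growth_unbounded u p R1 1 (lu + 1)) as [r [Hr Hur]]; [lra | lra | | |].
      * intros r Hr. apply Ht; lra.
      * intros r Hr. apply Hp, Hr.
      * specialize (Hr2 r ltac:(lra)). lra.
Qed.

(** A finite limit is a common zero of both reactions; since exponentials do not vanish, the two
    linear factors must, and they do so only at [e^u = e^v = 1]. *)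
Lemma finite_limit_zero (u v p q : R -> R) (r0 lu lv : R) :
  0 < r0 -> (forall r, r0 <= r -> trajectory u v p q r) ->
  is_lim u p_infty lu -> is_lim v p_infty lv -> lu = 0 /\ lv = 0.
Proof.
  intros Hr0 Ht Hu Hv.
  pose proof (limit_F1_zero u v p q r0 lu lv Hr0 Ht Hu Hv) as E1.
  pose proof (limit_F1_zero v u q p r0 lv lu Hr0
    (fun r Hr => trajectory_swap _ _ _ _ _ (Ht r Hr)) Hv Hu) as E2.
  rewrite F1_react in E1, E2.
  assert (H1 : react lu lv = 0) by lra. assert (H2 : react lv lu = 0) by lra.
  unfold react in H1, H2. pose proof (exp_pos lu). pose proof (exp_pos lv).
  apply Rmult_integral in H1; apply Rmult_integral in H2.
  split; apply exp_inv; rewrite exp_0; lra.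
Qed.

Lemma is_lim_from_thetas (u v : R -> R) (l1 l2 : R) :
  is_lim (fun r => 2 * u r + v r) p_infty l1 -> is_lim (fun r => 2 * v r + u r) p_infty l2 ->
  is_lim u p_infty ((2 * l1 - l2) / 3).
Proof.
  intros H1 H2.
  apply is_lim_ext with (fun r => / 3 * (2 * (2 * u r + v r) - (2 * v r + u r))).
  { intros; field. }
  replace ((2 * l1 - l2) / 3) with (/ 3 * (2 * l1 - l2)) by field.
  apply (is_lim_scal_l _ (/ 3) p_infty (2 * l1 - l2)).
  apply is_lim_minus'; [| exact H2].
  apply (is_lim_scal_l _ 2 p_infty l1 H1).
Qed.

Lemma monotone_topological (u v p q : R -> R) :
  (forall r, 0 < r -> trajectory u v p q r /\ u r <= 0 /\ v r <= 0) ->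
  (forall r, 0 < r -> 0 <= 2 * p r + q r /\ 0 <= 2 * q r + p r) ->
  is_lim u p_infty 0 /\ is_lim v p_infty 0.
Proof.
  intros H Hmono.
  assert (Hth : forall u v p q : R -> R,
    (forall r, 0 < r -> trajectory u v p q r /\ u r <= 0 /\ v r <= 0) ->
    (forall r, 0 < r -> 0 <= 2 * p r + q r) ->
    exists l : R, is_lim (fun r => 2 * u r + v r) p_infty l).
  { clear. intros u v p q H Ha. apply (increasing_limit _ 1 0).
    - intros x y Hxy.
      apply (derive_nonneg_le (fun r => 2 * u r + v r) (fun r => (2 * p r + q r) / r)); [lra | |].
      + intros z Hz. apply trajectory_theta; [lra | apply H; lra].
      + intros z Hz. apply Rdiv_le_0_compat; [apply Ha |]; lra.
    - intros x Hx. destruct (H x ltac:(lra)). lra. }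
  destruct (Hth u v p q H (fun r Hr => proj1 (Hmono r Hr))) as [l1 Hl1].
  destruct (Hth v u q p) as [l2 Hl2].
  { intros r Hr. destruct (H r Hr) as [Ht [Hu Hv]].
    split; [apply trajectory_swap, Ht | split; assumption]. }
  { intros r Hr; apply Hmono, Hr. }
  pose proof (is_lim_from_thetas u v l1 l2 Hl1 Hl2) as Hu.
  pose proof (is_lim_from_thetas v u l2 l1 Hl2 Hl1) as Hv.
  destruct (finite_limit_zero u v p q 1 _ _ Rlt_0_1 ltac:(intros; apply H; lra) Hu Hv) as [E1 E2].
  rewrite E1 in Hu; rewrite E2 in Hv. split; assumption.
Qed.

Lemma descending_theta_decreasing (u v p q : R -> R) (r0 : R) :
  0 < r0 -> (forall r, r0 <= r -> trajectory u v p q r /\ 2 * p r + q r < 0) ->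
  forall x y, r0 <= x < y -> 2 * u y + v y < 2 * u x + v x.
Proof.
  intros Hr0 H x y Hxy.
  apply (derive_neg_lt (fun r => 2 * u r + v r) (fun r => (2 * p r + q r) / r)); [lra | |].
  - intros z Hz. apply trajectory_theta; [lra | apply H; lra].
  - intros z Hz. destruct (H z ltac:(lra)) as [_ Ha].
    assert (0 < - (2 * p z + q z) / z) by (apply Rdiv_lt_0_compat; lra). unfold Rdiv in *; lra.
Qed.

(** If [2 u + v] had a lower bound, so would [2 v + u], because [u, v <= 0]. Both would converge,
    hence [u] and [v] too, with limit 0 by [finite_limit_zero]; but [2 u + v] strictly decreases
    from a nonpositive value. *)
Lemma descending_theta_limit (u v p q : R -> R) (r0 : R) :
  nonpos_trajectory u v p q r0 -> (forall r, r0 <= r -> descending p q r) ->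
  is_lim (fun r => 2 * u r + v r) p_infty m_infty.
Proof.
  intros [Hr0 H] Hd.
  assert (Ht : forall r, r0 <= r -> trajectory u v p q r) by (intros; apply H; assumption).
  pose proof (descending_theta_decreasing u v p q r0 Hr0
    (fun r Hr => conj (Ht r Hr) (proj1 (Hd r Hr)))) as Hdec1.
  pose proof (descending_theta_decreasing v u q p r0 Hr0
    (fun r Hr => conj (trajectory_swap _ _ _ _ _ (Ht r Hr)) (proj2 (Hd r Hr)))) as Hdec2.
  assert (Hle1 : forall x y, r0 <= x <= y -> 2 * u y + v y <= 2 * u x + v x).
  { intros x y [Hx [Hxy | <-]]; [apply Rlt_le, Hdec1; lra | lra]. }
  assert (Hle2 : forall x y, r0 <= x <= y -> 2 * v y + u y <= 2 * v x + u x).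
  { intros x y [Hx [Hxy | <-]]; [apply Rlt_le, Hdec2; lra | lra]. }
  apply (decreasing_unbounded_limit _ r0 Hle1).
  intros K. apply NNPP; intros Hno.
  assert (HK : forall x, r0 <= x -> K <= 2 * u x + v x).
  { intros x Hx. apply Rnot_lt_le; intros Hlt. apply Hno; exists x; split; assumption. }
  destruct (decreasing_limit _ r0 K Hle1 HK) as [l1 [_ [Hl1 Hb1]]].
  destruct (decreasing_limit _ r0 (2 * K) Hle2) as [l2 [_ [Hl2 Hb2]]].
  { intros x Hx. specialize (HK x Hx). destruct (H x Hx) as [_ [Hu Hv]]. lra. }
  pose proof (is_lim_from_thetas u v l1 l2 Hl1 Hl2) as Hu.
  pose proof (is_lim_from_thetas v u l2 l1 Hl2 Hl1) as Hv.
  destruct (finite_limit_zero u v p q r0 _ _ Hr0 Ht Hu Hv) as [E1 E2].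
  specialize (Hb1 (r0 + 1) ltac:(lra)). specialize (Hdec1 r0 (r0 + 1) ltac:(lra)).
  destruct (H r0 (Rle_refl _)) as [_ [Hu0 Hv0]]. lra.
Qed.

(** * Energy and the limits of descending solutions *)

Definition pot (x y : R) : R := exp x * (1 - exp x) + exp y * (1 - exp y) + exp x * exp y.

Definition kin (p q : R -> R) (r : R) : R := (p r * p r + p r * q r + q r * q r) / (3 * (r * r)).

Definition energy (u v p q : R -> R) (r : R) : R := kin p q r + pot (u r) (v r).

Lemma kin_nonneg (p q : R -> R) (r : R) : 0 < r -> 0 <= kin p q r.
Proof. intros Hr. apply Rdiv_le_0_compat; nra. Qed.

Lemma pot_ge (x y : R) : x <= 0 -> exp y * (1 - exp y) <= pot x y.
Proof.
  intros Hx. pose proof (exp_le_1 x Hx). pose proof (exp_pos x). pose proof (exp_pos y).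
  assert (0 <= exp x * (1 - exp x)) by (apply Rmult_le_pos; lra).
  assert (0 <= exp x * exp y) by (apply Rmult_le_pos; lra). unfold pot; lra.
Qed.

Lemma pot_nonneg (x y : R) : x <= 0 -> y <= 0 -> 0 <= pot x y.
Proof.
  intros Hx Hy. apply Rle_trans with (2 := pot_ge x y Hx).
  pose proof (exp_le_1 y Hy). pose proof (exp_pos y). apply Rmult_le_pos; lra.
Qed.

(* With [s = e^x + e^y] the potential is [s - s^2 + 3 e^(x+y)]. *)
Lemma pot_le_quarter (x y : R) : pot x y <= 1 / 4 + 3 * exp (x + y).
Proof.
  unfold pot. rewrite exp_plus.
  pose proof (Rle_0_sqr (exp x + exp y - 1 / 2)). unfold Rsqr in *. lra.
Qed.

(** [react u v] and [react v u] are the partial derivatives of [pot], and the quadratic form in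
    [kin] is adapted to the coupling of the system, so the reaction terms cancel and only the
    friction remains. *)
Lemma energy_derive (u v p q : R -> R) (r : R) :
  0 < r -> trajectory u v p q r ->
  is_derive (energy u v p q) r (- (2 * kin p q r / r)).
Proof.
  intros Hr [Hu [Hv [Hp Hq]]]. unfold energy, kin, pot.
  auto_derive.
  { repeat split; try (eexists; eassumption). nra. }
  replace (Derive (fun x => u x) r) with (p r / r) by (symmetry; apply is_derive_unique, Hu).
  replace (Derive (fun x => v x) r) with (q r / r) by (symmetry; apply is_derive_unique, Hv).
  replace (Derive (fun x => p x) r) with (r * F1 (u r) (v r))
    by (symmetry; apply is_derive_unique, Hp).
  replace (Derive (fun x => q x) r) with (r * F2 (u r) (v r))
    by (symmetry; apply is_derive_unique, Hq).
  rewrite F1_cs_poly, F2_cs_poly. unfold cs_poly. field. lra.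
Qed.

Lemma energy_decreasing (u v p q : R -> R) (a b : R) :
  0 < a -> a <= b -> (forall r, a <= r <= b -> trajectory u v p q r) ->
  energy u v p q b <= energy u v p q a.
Proof.
  intros Ha Hab Ht.
  apply (derive_nonpos_le _ (fun r => - (2 * kin p q r / r))); [exact Hab | |].
  - intros x Hx; apply energy_derive; [lra | apply Ht, Hx].
  - intros x Hx. pose proof (kin_nonneg p q x ltac:(lra)).
    assert (0 <= 2 * kin p q x / x) by (apply Rdiv_le_0_compat; lra). lra.
Qed.

Lemma energy_tail (u v p q : R -> R) (r0 e : R) :
  nonpos_trajectory u v p q r0 -> 0 < e ->
  exists R1, r0 <= R1 /\ forall r s, R1 <= r <= s -> energy u v p q r - energy u v p q s < e.
Proof.
  intros [Hr0 H] He.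
  destruct (decreasing_limit (energy u v p q) r0 0) as [l [_ [Hl Hle]]].
  - intros x y Hxy. apply energy_decreasing; [lra | lra |]. intros; apply H; lra.
  - intros x Hx. destruct (H x Hx) as [_ [Hu Hv]]. unfold energy.
    pose proof (kin_nonneg p q x ltac:(lra)). pose proof (pot_nonneg _ _ Hu Hv). lra.
  - destruct (eventually_le _ _ (l + e) Hl ltac:(lra)) as [r1 Hr1].
    exists (Rmax r0 r1 + 1).
    pose proof (Rmax_l r0 r1); pose proof (Rmax_r r0 r1). split; [lra |].
    intros r s Hrs. specialize (Hr1 r ltac:(lra)). specialize (Hle s ltac:(lra)). lra.
Qed.

(** Keeping [kin >= c] on [[r, k r]] costs the energy [2 c ln k] wherever [r] lies, and at late
    radii less than that is left to lose. *)
Lemma kinetic_window (u v p q : R -> R) (r0 c k : R) :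
  nonpos_trajectory u v p q r0 -> 0 < c -> 1 < k ->
  exists R1, r0 <= R1 /\ forall r, R1 <= r ->
    ~ (forall s, r <= s <= k * r -> c <= kin p q s).
Proof.
  intros H Hc Hk.
  assert (Hlk : 0 < ln k) by (rewrite <- ln_1; apply ln_increasing; lra).
  destruct (energy_tail u v p q r0 (2 * c * ln k) H) as [R1 [HR1 HE]].
  { apply Rmult_lt_0_compat; lra. }
  destruct H as [Hr0 H].
  exists R1; split; [exact HR1 |]. intros r Hr Hkin.
  assert (Hrk : r <= k * r) by nra.
  specialize (HE r (k * r) ltac:(lra)).
  assert (Hcmp : 2 * c * ln (k * r) - 2 * c * ln r
                   <= - energy u v p q (k * r) - - energy u v p q r).
  { apply (derive_le_compare (fun x => 2 * c * ln x) (fun x => - energy u v p q x)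
      (fun x => 2 * c * / x) (fun x => - - (2 * kin p q x / x))); [exact Hrk | | |].
    - intros x Hx. apply (is_derive_scal ln). apply is_derive_Reals, derivable_pt_lim_ln; lra.
    - intros x Hx. apply (is_derive_opp (energy u v p q)), energy_derive; [lra | apply H; lra].
    - intros x Hx. rewrite Ropp_involutive. unfold Rdiv. apply Rmult_le_compat_r.
      + apply Rlt_le, Rinv_0_lt_compat; lra.
      + specialize (Hkin x ltac:(lra)). lra. }
  rewrite ln_mult in Hcmp by lra. lra.
Qed.

Lemma is_lim_m_infty_elim (f : R -> R) (K : R) :
  is_lim f p_infty m_infty -> exists r0, forall r, r0 < r -> f r < K.
Proof. intros H. apply is_lim_spec in H. exact (H K). Qed.

(** Since [u + v] tends to minus infinity, [pot] is at most [1 / 4 + e / 2] at late radii.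
    [kinetic_window] supplies one radius of small kinetic energy, and the monotone energy carries
    the bound to all later ones. *)
Lemma descending_energy (u v p q : R -> R) (r0 e : R) :
  nonpos_trajectory u v p q r0 -> (forall r, r0 <= r -> descending p q r) -> 0 < e ->
  exists R1, r0 <= R1 /\ forall r, R1 <= r -> energy u v p q r < 1 / 4 + e.
Proof.
  intros H Hd He.
  pose proof (descending_theta_limit u v p q r0 H Hd) as H1.
  pose proof (descending_theta_limit v u q p r0 (nonpos_trajectory_swap _ _ _ _ _ H)
    (fun r Hr => descending_swap _ _ _ (Hd r Hr))) as H2.
  (* The two combinations add up to [3 (u + v)], so these thresholds give [u + v < ln (e / 6)], that
     is, [3 e^(u+v) < e / 2]. *)
  destruct (is_lim_m_infty_elim _ (3 * ln (e / 6) / 2) H1) as [r1 Hr1].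
  destruct (is_lim_m_infty_elim _ (3 * ln (e / 6) / 2) H2) as [r2 Hr2].
  destruct (kinetic_window u v p q r0 (e / 2) 2 H) as [R1 [HR1 HK]]; [lra | lra |].
  set (R2 := Rmax R1 (Rmax r1 r2) + 1).
  assert (HR2 : R1 < R2 /\ r1 < R2 /\ r2 < R2)
    by (unfold R2, Rmax; repeat destruct (Rle_dec _ _); lra).
  assert (Hpot : forall r, R2 <= r -> pot (u r) (v r) <= 1 / 4 + e / 2).
  { intros r Hr. apply Rle_trans with (1 := pot_le_quarter _ _).
    specialize (Hr1 r ltac:(lra)). specialize (Hr2 r ltac:(lra)).
    assert (exp (u r + v r) <= e / 6).
    { rewrite <- (exp_ln (e / 6)) by lra. apply exp_incr_le. lra. }
    lra. }
  assert (exists s, R2 <= s /\ energy u v p q s < 1 / 4 + e) as [s [Hs HsE]].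
  { apply NNPP; intros Hno. apply (HK R2 ltac:(lra)). intros s Hs.
    specialize (Hpot s ltac:(lra)).
    assert (1 / 4 + e <= energy u v p q s).
    { apply Rnot_lt_le; intros Hlt; apply Hno; exists s; split; [lra | exact Hlt]. }
    unfold energy in *. lra. }
  exists s; split; [lra |]. intros r Hr.
  apply Rle_lt_trans with (2 := HsE). destruct H as [Hr0 H].
  apply energy_decreasing; [lra | exact Hr |]. intros; apply H; lra.
Qed.

Lemma first_crossing (f df : R -> R) (a b c : R) :
  a <= b -> (forall x, a <= x <= b -> is_derive f x (df x)) -> c < f a -> f b < c ->
  exists x, a <= x <= b /\ f x = c /\ (forall y, a <= y <= x -> c <= f y) /\ df x <= 0.
Proof.
  intros Hab Hd Ha Hb.
  assert (Hc : forall x, a <= x <= b -> continuous f x)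
    by (intros x Hx; apply (is_derive_continuous _ _ _ (Hd x Hx))).
  assert (exists x, a < x <= b /\ f x = c /\ (forall y, a <= y < x -> c < f y)) as [x [Hx [Hfx Hy]]].
  { apply NNPP; intros Hno.
    assert (H : c < f b); [| lra].
    apply (real_induction (fun x => c < f x) a b) with (r := b); [| exact Ha | | lra].
    - intros x Hx Hlt. apply (locally_lt (fun _ => c) f);
        [apply continuous_const | apply Hc, Hx | exact Hlt].
    - intros x Hx Hs.
      assert (Hle : c - f x <= 0).
      { apply (limit_nonpos (fun y => c - f y) a x); [lra | |].
        - apply (continuous_minus (fun _ => c) f); [apply continuous_const | apply Hc; lra].
        - intros s Hs'. specialize (Hs s Hs'). lra. }
      destruct (Req_dec (f x) c) as [He | He]; [| lra].
      elim Hno; exists x; repeat split; try assumption; lra. }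
  exists x; split; [lra |]. split; [exact Hfx |]. split.
  - intros y Hy'. destruct (Req_dec y x) as [-> | Hne]; [lra |]. apply Rlt_le, Hy; lra.
  - apply Rnot_lt_le; intros Hpos.
    destruct (derive_pos_left _ _ _ (Hd x ltac:(lra)) Hpos) as [e He].
    set (s := Rmax a (x - e / 2)).
    assert (Hs : a <= s < x /\ x - s < e).
    { pose proof (cond_pos e). unfold s, Rmax; destruct (Rle_dec _ _); lra. }
    specialize (He s ltac:(lra)).
    specialize (Hy s (proj1 Hs)). lra.
Qed.

(* One-dimensional energy of [u] alone, [x = p / r]: up to the dissipation of the full energy and
   an error of order [e^v], it does not decrease while [u] descends. *)
Lemma u_energy_gain (u v p q : R -> R) (d a b : R) :
  0 < a -> a <= b -> (forall r, a <= r <= b -> trajectory u v p q r) ->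
  (forall r, a <= r <= b -> p r <= 0 /\ exp (v r) <= d) ->
  let e := fun r => p r * p r / (4 * (r * r)) + exp (u r) * (1 - exp (u r)) in
  e a - energy u v p q a - d / 2 * u a <= e b - energy u v p q b - d / 2 * u b.
Proof.
  intros Ha Hab Ht Hpv e.
  set (de := fun r => - (p r * p r / (2 * (r * r * r))) +
    p r / (2 * r) * (exp (v r) * (1 - 2 * exp (v r) - exp (u r)))).
  apply (derive_nonneg_le (fun r => e r - energy u v p q r - d / 2 * u r)
    (fun r => de r - - (2 * kin p q r / r) - d / 2 * (p r / r))); [exact Hab | |].
  - intros r Hr. pose proof (Ht r Hr) as Htr. pose proof Htr as [Hu [Hv [Hp Hq]]].
    apply (is_derive_minus (fun r => e r - energy u v p q r) (fun r => d / 2 * u r));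
      [| apply (is_derive_scal u), Hu].
    apply (is_derive_minus e (energy u v p q)); [| apply energy_derive; [lra | exact Htr]].
    unfold e, de. auto_derive.
    { repeat split; try (eexists; eassumption). nra. }
    replace (Derive (fun x => u x) r) with (p r / r) by (symmetry; apply is_derive_unique, Hu).
    replace (Derive (fun x => p x) r) with (r * F1 (u r) (v r))
      by (symmetry; apply is_derive_unique, Hp).
    rewrite F1_cs_poly. unfold cs_poly. field. lra.
  - intros r Hr. destruct (Hpv r ltac:(lra)) as [Hp Hv].
    unfold de, kin.
    pose proof (exp_pos (u r)) as HU. pose proof (exp_pos (v r)) as HV.
    set (U := exp (u r)) in *. set (V := exp (v r)) in *.
    assert (H1 : V * (1 - 2 * V - U) <= d) by nra.
    replace (- (p r * p r / (2 * (r * r * r))) + p r / (2 * r) * (V * (1 - 2 * V - U)) -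
       - (2 * ((p r * p r + p r * q r + q r * q r) / (3 * (r * r))) / r) - d / 2 * (p r / r))
      with ((p r + 2 * q r) * (p r + 2 * q r) / (6 * (r * r * r)) +
            - p r * (d - V * (1 - 2 * V - U)) / (2 * r)) by (field; lra).
    assert (0 < r * r * r) by (apply Rmult_lt_0_compat; nra).
    apply Rplus_le_le_0_compat; apply Rdiv_le_0_compat; try lra.
    + apply Rle_0_sqr.
    + apply Rmult_le_pos; lra.
Qed.

(** With [U = e^u], [V = e^v], [F1 = - 2 U (1 - 2 U) + V (1 - 2 V - U)]: the first term is at most
    [- 2 c eta] and the second at most [d]. *)
Lemma F1_negative (u v c eta d : R) :
  0 < c -> c <= exp u -> exp u <= 1 / 2 - eta / 2 -> exp v <= d -> d <= c * eta -> 0 < eta ->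
  F1 u v <= - (c * eta).
Proof.
  intros Hc Hu1 Hu2 Hv Hd Heta. rewrite F1_cs_poly. unfold cs_poly.
  pose proof (exp_pos v). set (U := exp u) in *. set (V := exp v) in *.
  assert (c * eta <= U * (1 - 2 * U)) by (apply Rmult_le_compat; lra).
  nra.
Qed.

(** [2 v + u] tends to minus infinity, so [v] must do so along the radii where [u] is bounded
    below. *)
Lemma descending_v_small (u v p q : R -> R) (r0 c d : R) :
  nonpos_trajectory u v p q r0 -> (forall r, r0 <= r -> descending p q r) -> 0 < c -> 0 < d ->
  exists R1, r0 <= R1 /\ forall r, R1 <= r -> c <= exp (u r) -> exp (v r) < d.
Proof.
  intros H Hd Hc Hd0.
  pose proof (descending_theta_limit v u q p r0 (nonpos_trajectory_swap _ _ _ _ _ H)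
    (fun r Hr => descending_swap _ _ _ (Hd r Hr))) as H2.
  destruct (is_lim_m_infty_elim _ (2 * ln d + ln c) H2) as [r2 Hr2].
  exists (Rmax r0 r2 + 1). pose proof (Rmax_l r0 r2); pose proof (Rmax_r r0 r2).
  split; [lra |]. intros r Hr Hcu. specialize (Hr2 r ltac:(lra)).
  apply ln_le in Hcu; [| exact Hc]. rewrite ln_exp in Hcu.
  rewrite <- (exp_ln d) by exact Hd0. apply exp_increasing. lra.
Qed.

(** While [e^u] is between [c1] and [1 / 2 - eta / 2], [e^v] is so small that [F1] is negative:
    [p <= 0] persists and [u] cannot climb back. Staying above [c1] for ever would make [- p] grow
    and [u] unbounded below. *)
Lemma descending_u_falls (u v p q : R -> R) (c1 eta d r1 : R) :
  nonpos_trajectory u v p q r1 -> 0 < c1 -> 0 < eta -> d <= c1 * eta ->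
  (forall r, r1 <= r -> c1 <= exp (u r) -> exp (v r) < d) ->
  c1 < exp (u r1) -> exp (u r1) <= 1 / 2 - eta -> p r1 <= 0 ->
  exists r2, r1 <= r2 /\ exp (u r2) = c1 /\
    forall r, r1 <= r <= r2 -> p r <= 0 /\ exp (v r) <= d.
Proof.
  intros [Hr1 H] Hc1 Heta Hd Hv Hu1 Hu2 Hp1.
  assert (Ht : forall r, r1 <= r -> trajectory u v p q r) by (intros; apply H; assumption).
  assert (Hneg : forall r, r1 <= r -> c1 <= exp (u r) -> exp (u r) < 1 / 2 - eta / 2 ->
    F1 (u r) (v r) <= - (c1 * eta)).
  { intros r Hr HU1 HU2. specialize (Hv r Hr HU1). apply (F1_negative _ _ _ _ d); lra. }
  assert (Hce : 0 < c1 * eta) by (apply Rmult_lt_0_compat; assumption).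
  assert (Hp : forall r, r1 <= r ->
    (forall s, r1 <= s < r -> c1 <= exp (u s) /\ exp (u s) < 1 / 2 - eta / 2) -> p r <= 0).
  { intros r Hr Hs. apply Rle_trans with (2 := Hp1).
    apply (derive_nonpos_le p (fun x => x * F1 (u x) (v x))); [exact Hr | intros; apply Ht; lra |].
    intros x Hx. destruct (Hs x ltac:(lra)). specialize (Hneg x ltac:(lra) ltac:(lra) ltac:(lra)).
    nra. }
  (* The bound with [eta / 2] is strict, hence open for the induction, and it is regained at each
     point because [e^u] has not risen above its initial value, at most [1 / 2 - eta]. *)
  assert (Hzone : forall r, r1 <= r -> (forall s, r1 <= s <= r -> c1 <= exp (u s)) ->
    forall s, r1 <= s <= r -> exp (u s) < 1 / 2 - eta / 2).
  { intros r Hr Hs. apply real_induction; [| lra |].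
    - intros x Hx Hlt. destruct (trajectory_continuous _ _ _ _ x (Ht x ltac:(lra))) as [Cu _].
      apply (locally_lt (fun s => exp (u s)) (fun _ => 1 / 2 - eta / 2));
        [| apply continuous_const | exact Hlt].
      apply continuous_Rexp, Cu.
    - intros x Hx Hs'.
      assert (Hux : u x <= u r1).
      { apply (u_decreasing u v p q); [lra | lra | intros; apply Ht; lra |].
        intros y Hy. apply Hp; [lra |]. intros z Hz; split; [apply Hs | apply Hs']; lra. }
      apply exp_incr_le in Hux. lra. }
  assert (exists b, r1 <= b /\ u b < ln c1) as [b [Hb Hub]].
  { apply NNPP; intros Hno.
    assert (Hge : forall r, r1 <= r -> c1 <= exp (u r)).
    { intros r Hr. rewrite <- (exp_ln c1) by exact Hc1. apply exp_incr_le, Rnot_lt_le.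
      intros Hlt; apply Hno; exists r; split; assumption. }
    destruct (quadratic_growth (fun r => - p r) (fun r => - F1 (u r) (v r)) r1 (c1 * eta) 1)
      as [R1 [HR1 Hp']]; [lra | lra | | |].
    + intros r Hr. replace (r * - F1 (u r) (v r)) with (- (r * F1 (u r) (v r))) by ring.
      apply (is_derive_opp p), Ht; lra.
    + intros r Hr.
      specialize (Hneg r Hr (Hge r Hr) (Hzone r Hr ltac:(intros; apply Hge; lra) r ltac:(lra))). lra.
    + destruct (log_decay_unbounded u p R1 1 (ln c1)) as [r [Hr Hur]]; [lra | lra | | |].
      * intros r Hr. apply Ht; lra.
      * intros r Hr. specialize (Hp' r Hr). lra.
      * apply Hno; exists r; split; [lra | exact Hur]. }
  destruct (first_crossing u (fun r => p r / r) r1 b (ln c1) Hb) as [r2 [Hr2 [Hu [Hbefore _]]]].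
  - intros x Hx. apply Ht; lra.
  - rewrite <- (ln_exp (u r1)). apply ln_increasing; lra.
  - exact Hub.
  - assert (Hge : forall s, r1 <= s <= r2 -> c1 <= exp (u s)).
    { intros s Hs. rewrite <- (exp_ln c1) by exact Hc1. apply exp_incr_le, Hbefore, Hs. }
    exists r2; split; [lra |]. split; [rewrite Hu; apply exp_ln, Hc1 |].
    intros r Hr. split.
    + apply Hp; [lra |]. intros s Hs. split; [apply Hge; lra |].
      apply (Hzone r2); [lra | exact Hge | lra].
    + apply Rlt_le, Hv; [lra | apply Hge; lra].
Qed.

(* Once the flux [2 p + q] dominates the energy, [p] stays negative and [e^v] stays below the
   barrier [1/2], so kinetic energy persists for a time comparable with [r]. *)
Lemma persistent_kinetic_energy (u v p q : R -> R) (r2 c : R) :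
  nonpos_trajectory u v p q r2 -> 0 < c <= 1 / 2 ->
  energy u v p q r2 < 1 / 4 + c / 100 ->
  exp (u r2) < 1 / 2 -> exp (v r2) < 1 / 2 -> 2 * p r2 + q r2 < 0 ->
  (3 * energy u v p q r2 + c / 2) * (r2 * r2) <= (2 * p r2 + q r2) * (2 * p r2 + q r2) ->
  forall r, r2 <= r <= (1 + c / 32) * r2 -> c / 48 <= kin p q r.
Proof.
  intros [Hr2 H] Hc HE HU HV Ha HA.
  assert (Ht : forall r, r2 <= r -> trajectory u v p q r) by (intros; apply H; assumption).
  set (k := 1 + c / 32) in *. set (E2 := energy u v p q r2) in *.
  assert (HE0 : 0 <= E2).
  { destruct (H r2 (Rle_refl _)) as [_ [Hu Hv]].
    pose proof (kin_nonneg p q r2 Hr2). pose proof (pot_nonneg _ _ Hu Hv). unfold E2, energy; lra. }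
  (* While both exponentials are below 1/2, [react u v > 0] pushes [2 p + q] further down. Its
     square keeps dominating, since [s^2] grows at most by the factor [k^2 <= 1 + c / 8], paid for
     by replacing [c / 2] with [c / 4]. *)
  assert (Hflux : forall s, r2 <= s <= k * r2 ->
    (forall x, r2 <= x < s -> exp (u x) < 1 / 2 /\ exp (v x) < 1 / 2) ->
    2 * p s + q s < 0 /\ (3 * E2 + c / 4) * (s * s) <= (2 * p s + q s) * (2 * p s + q s)).
  { intros s Hs Hx.
    assert (Hmono : 2 * p s + q s <= 2 * p r2 + q r2).
    { apply (derive_nonpos_le (fun r => 2 * p r + q r) (fun r => - (3 * r * react (u r) (v r))));
        [lra | intros; apply trajectory_flux, Ht; lra |].
      intros x Hx'. destruct (Hx x ltac:(lra)) as [H1 _]. pose proof (exp_pos (v x)).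
      assert (0 < react (u x) (v x)) by (apply react_pos; lra).
      assert (0 < 3 * x * react (u x) (v x)) by (apply Rmult_lt_0_compat; lra). lra. }
    split; [lra |].
    assert (Hsq : (2 * p r2 + q r2) * (2 * p r2 + q r2) <= (2 * p s + q s) * (2 * p s + q s)) by nra.
    assert (Hss : s * s <= k * k * (r2 * r2)).
    { replace (k * k * (r2 * r2)) with ((k * r2) * (k * r2)) by ring.
      apply Rmult_le_compat; lra. }
    assert (Hkk : (3 * E2 + c / 4) * (k * k) <= 3 * E2 + c / 2).
    { assert (Hk2 : k * k <= 1 + c / 8) by (unfold k; nra).
      apply Rle_trans with ((3 * E2 + c / 4) * (1 + c / 8)); [apply Rmult_le_compat_l; lra |].
      nra. }
    apply Rle_trans with ((3 * E2 + c / 4) * (k * k * (r2 * r2))); [apply Rmult_le_compat_l; lra |].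
    replace ((3 * E2 + c / 4) * (k * k * (r2 * r2))) with ((3 * E2 + c / 4) * (k * k) * (r2 * r2))
      by ring.
    apply Rle_trans with ((3 * E2 + c / 2) * (r2 * r2)); [apply Rmult_le_compat_r; nra |].
    lra. }
  assert (Hkin3 : forall s, r2 <= s ->
    kin p q s * (3 * (s * s)) = p s * p s + p s * q s + q s * q s).
  { intros s Hs. unfold kin. field. lra. }
  assert (HEs : forall s, r2 <= s -> kin p q s + pot (u s) (v s) <= E2).
  { intros s Hs. apply (energy_decreasing u v p q r2 s); [lra | lra |]. intros; apply Ht; lra. }
  (* From [(2 p + q)^2 = (p^2 + p q + q^2) + 3 p (p + q)] and the energy bound, [p (p + q) > 0],
     which is impossible for [p >= 0] when [2 p + q < 0]. From [(2 p + q)^2 <= 4 (p^2 + p q + q^2) =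
     12 s^2 kin] comes the constant [c / 48]. *)
  assert (Hpneg : forall s, r2 <= s <= k * r2 ->
    (forall x, r2 <= x < s -> exp (u x) < 1 / 2 /\ exp (v x) < 1 / 2) ->
    p s < 0 /\ c / 48 <= kin p q s).
  { intros s Hs Hx. destruct (Hflux s Hs Hx) as [Has HAs].
    destruct (H s ltac:(lra)) as [_ [Hu Hv]]. pose proof (pot_nonneg _ _ Hu Hv).
    pose proof (Hkin3 s ltac:(lra)) as Hk3. specialize (HEs s ltac:(lra)).
    assert (Hss : 0 < s * s) by nra.
    assert (HkE : kin p q s * (3 * (s * s)) <= E2 * (3 * (s * s))) by (apply Rmult_le_compat_r; lra).
    split.
    - apply Rnot_le_lt; intros Hps.
      assert (0 < c / 4 * (s * s)) by (apply Rmult_lt_0_compat; lra).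
      assert (Hpp : 0 < p s * (p s + q s)) by nra.
      assert (p s * (p s + q s) <= 0) by nra. lra.
    - assert (0 <= q s * q s) by apply Rle_0_sqr.
      assert (Hq : (3 * E2 + c / 4) * (s * s) <= 4 * (kin p q s * (3 * (s * s)))).
      { rewrite Hk3. nra. }
      assert (0 <= 3 * E2 * (s * s)) by (apply Rmult_le_pos; lra).
      apply Rmult_le_reg_r with (s * s); [exact Hss |]. lra. }
  assert (Hall : forall s, r2 <= s <= k * r2 -> exp (u s) < 1 / 2 /\ exp (v s) < 1 / 2).
  { apply (real_induction (fun s => exp (u s) < 1 / 2 /\ exp (v s) < 1 / 2)); [| split; assumption |].
    - intros x Hx [H1 H2].
      destruct (trajectory_continuous _ _ _ _ x (Ht x ltac:(lra))) as [Cu [Cv _]].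
      apply filter_and.
      + apply (locally_lt (fun s => exp (u s)) (fun _ => 1 / 2));
          [| apply continuous_const | exact H1].
        apply continuous_Rexp, Cu.
      + apply (locally_lt (fun s => exp (v s)) (fun _ => 1 / 2));
          [| apply continuous_const | exact H2].
        apply continuous_Rexp, Cv.
    - intros s Hs Hx. split.
      + assert (Hus : u s <= u r2).
        { apply (u_decreasing u v p q); [lra | lra | intros; apply Ht; lra |].
          intros y Hy. apply Rlt_le, Hpneg; [lra |]. intros z Hz; apply Hx; lra. }
        apply exp_incr_le in Hus. lra.
      + destruct (Hpneg s ltac:(lra) Hx) as [_ Hk].
        destruct (H s ltac:(lra)) as [Hts [Hu Hv]]. specialize (HEs s ltac:(lra)).
        pose proof (pot_ge (u s) (v s) Hu).
        destruct (trajectory_continuous _ _ _ _ s Hts) as [_ [Cv _]].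
        assert (Hle : exp (v s) - 1 / 2 <= 0).
        { apply (limit_nonpos (fun x => exp (v x) - 1 / 2) r2 s); [lra | |].
          - apply (continuous_minus (fun x => exp (v x)) (fun _ => 1 / 2)); [| apply continuous_const].
            apply continuous_Rexp, Cv.
          - intros x Hx'. destruct (Hx x Hx'). lra. }
        (* At [e^v = 1/2] the potential is at least 1/4; together with kinetic energy [c / 48] this
           exceeds the available [1 / 4 + c / 100]. *)
        destruct (Req_dec (exp (v s)) (1 / 2)) as [He | He]; [| lra].
        rewrite He in *. lra. }
  intros r Hr. apply Hpneg; [exact Hr |]. intros x Hx; apply Hall; lra.
Qed.

(** If [p <= 0] at such a late radius, [u] falls to the level [c1]. There the potential is small,
    and by [u_energy_gain] most of the one-dimensional energy of [u] has become kinetic, which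
    [persistent_kinetic_energy] prolongs into a window that [kinetic_window] forbids. *)
Lemma no_late_descent (u v p q : R -> R) (r0 c eta : R) :
  nonpos_trajectory u v p q r0 -> (forall r, r0 <= r -> descending p q r) ->
  0 < c -> 0 < eta ->
  exists R1, r0 <= R1 /\ forall r, R1 <= r ->
    c <= exp (u r) -> exp (u r) <= 1 / 2 - eta -> 0 < p r.
Proof.
  intros H Hdesc Hc Heta.
  destruct (Rle_lt_dec c (1 / 2)) as [Hc2 | Hc2].
  2: { exists r0; split; [lra |]. intros; lra. }
  (* The one-dimensional energy starts at [c / 2] or more, its potential part at the level [c1] is
     at most [c / 4], and dissipation and the [e^v] error each cost at most [e]. So at least
     [c / 2 - 2 e - c1 = 7 c / 32] is kinetic in the end. *)
  set (c1 := c / 4). set (e := c / 64).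
  assert (Hlnc : ln c1 < 0) by (rewrite <- ln_1; apply ln_increasing; unfold c1; lra).
  (* The three bounds on [e^v] serve in turn the sign of [F1], the smallness of [pot] after the
     fall, and the error term in [u_energy_gain]. *)
  set (d := Rmin (c1 * eta) (Rmin (c / 100) (e / (- ln c1)))).
  assert (Hd : 0 < d /\ d <= c1 * eta /\ d <= c / 100 /\ d <= e / (- ln c1)).
  { unfold d. repeat split.
    - repeat apply Rmin_glb_lt; [apply Rmult_lt_0_compat; unfold c1; lra | lra |].
      apply Rdiv_lt_0_compat; unfold e; lra.
    - apply Rmin_l.
    - apply Rle_trans with (1 := Rmin_r _ _), Rmin_l.
    - apply Rle_trans with (1 := Rmin_r _ _), Rmin_r. }
  assert (Hdln : d * - ln c1 <= e).
  { replace e with (e / (- ln c1) * - ln c1) by (field; lra). apply Rmult_le_compat_r; lra. }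
  destruct (descending_v_small u v p q r0 c1 d H Hdesc) as [R1 [HR1 Hv]]; [unfold c1; lra | lra |].
  destruct (energy_tail u v p q r0 e H) as [R2 [HR2 HE]]; [unfold e; lra |].
  destruct (descending_energy u v p q r0 (c / 100) H Hdesc) as [R3 [HR3 HE4]]; [lra |].
  destruct (kinetic_window u v p q r0 (c / 48) (1 + c / 32) H) as [R4 [HR4 HK]]; [lra | lra |].
  set (R5 := Rmax (Rmax R1 R2) (Rmax R3 R4)).
  assert (HR5 : R1 <= R5 /\ R2 <= R5 /\ R3 <= R5 /\ R4 <= R5)
    by (unfold R5, Rmax; repeat destruct (Rle_dec _ _); lra).
  exists R5; split; [lra |]. intros r1 Hr1 HU1 HU2. apply Rnot_le_lt; intros Hp1.
  pose proof (nonpos_trajectory_later u v p q r0 r1 H ltac:(lra)) as H1.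
  destruct (descending_u_falls u v p q c1 eta d r1 H1) as [r2 [Hr2 [Hur2 Hon]]];
    [unfold c1; lra | lra | lra | intros; apply Hv; lra | unfold c1; lra | lra | exact Hp1 |].
  destruct H as [Hr0 H].
  apply (HK r2 ltac:(lra)).
  destruct (Hon r2 ltac:(lra)) as [Hp2 Hv2].
  destruct (Hdesc r2 ltac:(lra)) as [Ha2 Hb2].
  assert (Hln2 : u r2 = ln c1) by (rewrite <- Hur2, ln_exp; reflexivity).
  pose proof (u_energy_gain u v p q d r1 r2 ltac:(lra) Hr2 ltac:(intros; apply H; lra) Hon) as Hgain.
  cbv beta zeta in Hgain. rewrite Hur2, Hln2 in Hgain.
  specialize (HE r1 r2 ltac:(lra)). specialize (HE4 r2 ltac:(lra)).
  destruct (H r1 ltac:(lra)) as [_ [Hu1 _]].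
  assert (Hg1 : c / 2 <= exp (u r1) * (1 - exp (u r1))).
  { apply Rle_trans with (c * (1 / 2)); [lra |]. apply Rmult_le_compat; lra. }
  assert (Hr11 : 0 < r1 * r1) by (apply Rmult_lt_0_compat; lra).
  assert (Hr22 : 0 < r2 * r2) by (apply Rmult_lt_0_compat; lra).
  assert (Hx1 : 0 <= p r1 * p r1 / (4 * (r1 * r1)))
    by (apply Rdiv_le_0_compat; [apply Rle_0_sqr | lra]).
  assert (0 <= d * - u r1) by (apply Rmult_le_pos; lra).
  assert (Hx2 : c / 2 - 2 * e - c1 <= p r2 * p r2 / (4 * (r2 * r2))).
  { pose proof (Rle_0_sqr c1). assert (0 < e) by (unfold e; lra). unfold Rsqr in *. lra. }
  apply (persistent_kinetic_energy u v p q).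
  - apply (nonpos_trajectory_later _ _ _ _ r0); [split; assumption | lra].
  - lra.
  - exact HE4.
  - rewrite Hur2; unfold c1; lra.
  - lra.
  - exact Ha2.
  - assert (HE2 : energy u v p q r2 = kin p q r2 + pot (u r2) (v r2)) by reflexivity.
    assert (Hpot : pot (u r2) (v r2) <= c1 + 2 * d).
    { unfold pot. rewrite Hur2. pose proof (exp_pos (v r2)). unfold c1 in *. nra. }
    assert (Hx3 : (c / 2 - 2 * e - c1) * (4 * (r2 * r2)) <= p r2 * p r2).
    { apply Rmult_le_compat_r with (r := 4 * (r2 * r2)) in Hx2; [| lra].
      replace (p r2 * p r2 / (4 * (r2 * r2)) * (4 * (r2 * r2))) with (p r2 * p r2) in Hx2
        by (field; lra). exact Hx2. }
    assert (Hk3 : kin p q r2 * (3 * (r2 * r2)) = p r2 * p r2 + p r2 * q r2 + q r2 * q r2)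
      by (unfold kin; field; lra).
    (* The last term is nonnegative, since [p <= 0] and [2 q + p < 0] at [r2]; so the lower bound on
       [p^2] bounds the flux from below in absolute value. *)
    assert (HA : (2 * p r2 + q r2) * (2 * p r2 + q r2) =
      kin p q r2 * (3 * (r2 * r2)) + 3 / 2 * (p r2 * p r2) + 3 / 2 * (p r2 * (2 * q r2 + p r2))).
    { rewrite Hk3. field. }
    assert (0 <= p r2 * (2 * q r2 + p r2)) by nra.
    (* The constants just fit: [3 (c / 4 + 2 c / 100) + c / 2 = 1.31 c] against
       [6 * 7 c / 32 = 1.3125 c]. *)
    assert (Hfin : (3 * energy u v p q r2 + c / 2) * (r2 * r2) <=
      (3 * kin p q r2 + 6 * (c / 2 - 2 * e - c1)) * (r2 * r2)).
    { apply Rmult_le_compat_r; [lra |]. unfold c1, e in *. lra. }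
    lra.
Qed.

(** By [no_late_descent] a level below 1/2 that [e^u] exceeds late is never crossed downwards again,
    so [e^u] stays bounded below and [v] tends to minus infinity. Then [F1] alone forces [e^u]
    towards 1/2 from either side. *)
Lemma descending_mixed (u v p q : R -> R) (r0 c : R) :
  nonpos_trajectory u v p q r0 -> (forall r, r0 <= r -> descending p q r) ->
  0 < c -> (forall R1, exists r, R1 <= r /\ c <= exp (u r)) ->
  is_lim u p_infty (ln (1 / 2)) /\ is_lim v p_infty m_infty.
Proof.
  intros H Hdesc Hc Hfreq.
  (* [c' < c] makes the first passage strict, and [c' <= 1/8] puts the level inside the range
     covered by [no_late_descent] with [eta = 1/4]. *)
  set (c' := Rmin c (1 / 4) / 2).
  assert (Hc' : 0 < c' /\ c' < c /\ c' <= 1 / 8) by (unfold c', Rmin; destruct (Rle_dec _ _); lra).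
  assert (Hstay : forall a R1, 0 < a -> r0 <= R1 -> a < exp (u R1) ->
    (forall r, R1 <= r -> exp (u r) = a -> 0 < p r) -> forall r, R1 <= r -> a <= exp (u r)).
  { intros a R1 Ha HR1 HU Hp r Hr. apply Rnot_lt_le; intros Hlt. destruct H as [Hr0 H].
    destruct (first_crossing u (fun r => p r / r) R1 r (ln a) Hr) as [x [Hx [Hux [_ Hdx]]]].
    - intros x Hx. apply H; lra.
    - rewrite <- (ln_exp (u R1)). apply ln_increasing; lra.
    - rewrite <- (ln_exp (u r)). apply ln_increasing; [apply exp_pos | exact Hlt].
    - specialize (Hp x ltac:(lra)). rewrite Hux, exp_ln in Hp by exact Ha. specialize (Hp eq_refl).
      assert (0 < p x / x) by (apply Rdiv_lt_0_compat; lra). lra. }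
  destruct (no_late_descent u v p q r0 c' (1 / 4) H Hdesc) as [R1 [HR1 Hno]]; [lra | lra |].
  destruct (Hfreq R1) as [R2 [HR2 HU2]].
  assert (Hlow : forall r, R2 <= r -> c' <= exp (u r)).
  { apply Hstay; [lra | lra | lra |]. intros r Hr HUr. apply Hno; lra. }
  assert (Hvsmall : forall d, 0 < d -> exists R3, R2 <= R3 /\ forall r, R3 <= r -> exp (v r) < d).
  { intros d Hd. destruct (descending_v_small u v p q r0 c' d H Hdesc) as [R3 [HR3 Hv]]; [lra | lra |].
    exists (Rmax R2 R3). pose proof (Rmax_l R2 R3); pose proof (Rmax_r R2 R3). split; [lra |].
    intros r Hr. apply Hv; [lra | apply Hlow; lra]. }
  destruct H as [Hr0 H].
  assert (Ht : forall r, r0 <= r -> trajectory u v p q r) by (intros; apply H; assumption).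
  assert (Hlower : forall eta, 0 < eta <= 1 / 4 ->
    exists R3, R2 <= R3 /\ forall r, R3 <= r -> 1 / 2 - eta <= exp (u r)).
  { intros eta Heta.
    destruct (no_late_descent u v p q r0 c' eta (conj Hr0 H) Hdesc) as [R3 [HR3 Hno3]]; [lra | lra |].
    destruct (Hvsmall (c' * eta)) as [R4 [HR4 Hv4]]; [apply Rmult_lt_0_compat; lra |].
    set (R5 := Rmax R3 R4).
    assert (HR5 : R3 <= R5 /\ R4 <= R5) by (split; [apply Rmax_l | apply Rmax_r]).
    assert (exists R6, R5 <= R6 /\ 1 / 2 - eta < exp (u R6)) as [R6 [HR6 HU6]].
    (* Remaining below [1 / 2 - eta] would give [F1 <= - c' eta] and finally [p <= -1], while
       [no_late_descent] makes [p] positive there. *)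
    { apply NNPP; intros Hnot.
      assert (Hle : forall r, R5 <= r -> exp (u r) <= 1 / 2 - eta).
      { intros r Hr. apply Rnot_lt_le; intros Hlt; apply Hnot; exists r; split; assumption. }
      destruct (quadratic_growth (fun r => - p r) (fun r => - F1 (u r) (v r)) R5 (c' * eta) 1)
        as [R7 [HR7 Hp]].
      - lra.
      - apply Rmult_lt_0_compat; lra.
      - intros r Hr. replace (r * - F1 (u r) (v r)) with (- (r * F1 (u r) (v r))) by ring.
        apply (is_derive_opp p), Ht; lra.
      - intros r Hr. specialize (Hle r Hr). specialize (Hv4 r ltac:(lra)).
        specialize (Hlow r ltac:(lra)).
        assert (F1 (u r) (v r) <= - (c' * eta)) by (apply (F1_negative _ _ _ _ (c' * eta)); lra).
        lra.
      - specialize (Hp R7 (Rle_refl _)). specialize (Hle R7 HR7). specialize (Hlow R7 ltac:(lra)).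
        specialize (Hno3 R7 ltac:(lra) Hlow Hle). lra. }
    exists R6; split; [lra |].
    apply Hstay; [lra | lra | exact HU6 |]. intros r Hr HUr. apply Hno3; lra. }
  assert (Hupper : forall eta, 0 < eta <= 1 / 4 ->
    exists R3, R2 <= R3 /\ forall r, R3 <= r -> exp (u r) <= 1 / 2 + eta).
  { intros eta Heta.
    destruct (Hvsmall eta) as [R4 [HR4 Hv4]]; [lra |].
    (* With [2 p + q < 0], a flux [p >= 0] would make [q] negative, and [e^v < eta] puts the point
       in the region of [no_escape_strict]. *)
    assert (Hneg : forall r, R4 <= r -> 1 / 2 + eta <= exp (u r) -> p r < 0).
    { intros r Hr HU. apply Rnot_le_lt; intros Hp.
      destruct (Hdesc r ltac:(lra)) as [Ha _]. specialize (Hv4 r Hr).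
      apply (no_escape_strict u v p q r); [| lra | lra | lra].
      apply (nonpos_trajectory_later _ _ _ _ r0); [split; assumption | lra]. }
    assert (exists R6, R4 <= R6 /\ exp (u R6) < 1 / 2 + eta) as [R6 [HR6 HU6]].
    { apply NNPP; intros Hnot.
      assert (Hge : forall r, R4 <= r -> 1 / 2 + eta <= exp (u r)).
      { intros r Hr. apply Rnot_lt_le; intros Hlt; apply Hnot; exists r; split; assumption. }
      destruct (quadratic_growth p (fun r => F1 (u r) (v r)) R4 eta 1) as [R7 [HR7 Hp]].
      - lra.
      - lra.
      - intros r Hr. apply Ht; lra.
      - intros r Hr. specialize (Hge r Hr). specialize (Hv4 r Hr).
        destruct (H r ltac:(lra)) as [_ [Hu _]]. apply exp_le_1 in Hu.
        rewrite F1_cs_poly; unfold cs_poly. pose proof (exp_pos (v r)).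
        set (U := exp (u r)) in *; set (V := exp (v r)) in *.
        assert (2 * eta <= 2 * U * (2 * U - 1)) by nra.
        assert (0 <= V * (1 - U)) by (apply Rmult_le_pos; lra).
        assert (V * V <= eta * (1 / 4)) by (apply Rmult_le_compat; lra).
        lra.
      - specialize (Hp R7 (Rle_refl _)). specialize (Hneg R7 HR7 (Hge R7 HR7)). lra. }
    exists R6; split; [lra |]. intros r Hr. apply Rnot_lt_le; intros Hlt.
    destruct (first_crossing (fun r => - u r) (fun r => - (p r / r)) R6 r (- ln (1 / 2 + eta)) Hr)
      as [x [Hx [Hux [_ Hdx]]]].
    - intros x Hx. apply (is_derive_opp u), Ht; lra.
    - apply Ropp_lt_contravar. rewrite <- (ln_exp (u R6)). apply ln_increasing; [apply exp_pos | lra].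
    - apply Ropp_lt_contravar. rewrite <- (ln_exp (u r)). apply ln_increasing; lra.
    - assert (Hux' : exp (u x) = 1 / 2 + eta).
      { replace (u x) with (ln (1 / 2 + eta)) by lra. apply exp_ln; lra. }
      specialize (Hneg x ltac:(lra) ltac:(lra)).
      assert (0 < - p x / x) by (apply Rdiv_lt_0_compat; lra). unfold Rdiv in *; lra. }
  split.
  - apply is_lim_ext with (fun r => ln (exp (u r))); [intros; apply ln_exp |].
    apply (filterlim_comp _ _ _ (fun r => exp (u r)) ln _ (locally (1 / 2))).
    + change (is_lim (fun r => exp (u r)) p_infty (1 / 2)). apply is_lim_spec; intros eps.
      set (eta := Rmin (eps / 2) (1 / 4)).
      pose proof (cond_pos eps).
      assert (Heta : 0 < eta <= 1 / 4 /\ eta < eps)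
        by (unfold eta, Rmin; destruct (Rle_dec _ _); lra).
      destruct (Hlower eta (proj1 Heta)) as [R3 [_ H3]].
      destruct (Hupper eta (proj1 Heta)) as [R4 [_ H4]].
      exists (Rmax R3 R4). intros r Hr. pose proof (Rmax_l R3 R4); pose proof (Rmax_r R3 R4).
      specialize (H3 r ltac:(lra)). specialize (H4 r ltac:(lra)). apply Rabs_def1; lra.
    + apply (ex_derive_continuous (V := R_NormedModule)). auto_derive. lra.
  - apply is_lim_spec; intros K.
    destruct (Hvsmall (exp K) (exp_pos K)) as [R3 [_ HR3]].
    exists R3; intros r Hr. apply exp_lt_inv, HR3; lra.
Qed.

Lemma descending_limits (u v p q : R -> R) (r0 : R) :
  nonpos_trajectory u v p q r0 -> (forall r, r0 <= r -> descending p q r) ->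
  (is_lim u p_infty m_infty /\ is_lim v p_infty m_infty) \/
  (is_lim u p_infty (ln (1 / 2)) /\ is_lim v p_infty m_infty) \/
  (is_lim u p_infty m_infty /\ is_lim v p_infty (ln (1 / 2))).
Proof.
  intros H Hdesc.
  assert (Hto0 : forall w : R -> R,
    ~ (exists c, 0 < c /\ forall R1, exists r, R1 <= r /\ c <= exp (w r)) ->
    is_lim w p_infty m_infty).
  { intros w Hno. apply is_lim_spec; intros K. apply NNPP; intros Hnot. apply Hno.
    exists (exp K); split; [apply exp_pos |]. intros R1. apply NNPP; intros HR1.
    apply Hnot. exists R1; intros r Hr. apply Rnot_le_lt; intros Hle.
    apply HR1; exists r; split; [lra | apply exp_incr_le, Hle]. }
  destruct (classic (exists c, 0 < c /\ forall R1, exists r, R1 <= r /\ c <= exp (u r)))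
    as [[c [Hc Hfreq]] | Hu].
  { right; left. apply (descending_mixed u v p q r0 c); assumption. }
  destruct (classic (exists c, 0 < c /\ forall R1, exists r, R1 <= r /\ c <= exp (v r)))
    as [[c [Hc Hfreq]] | Hv].
  { right; right. apply and_comm. apply (descending_mixed v u q p r0 c); try assumption.
    - apply nonpos_trajectory_swap, H.
    - intros r Hr; apply descending_swap, Hdesc, Hr. }
  left; split; apply Hto0; assumption.
Qed.

(** * Maximum principle and potential well *)

(* [e^u], continued to [r <= 0] by its limit at the origin. *)
Definition exp_ext (N a : R) (u : R -> R) (r : R) : R :=
  if Rle_dec r 0 then (if Req_EM_T N 0 then exp a else 0) else exp (u r).

Lemma exp_ext_pos (N a : R) (u : R -> R) (r : R) : 0 < r -> exp_ext N a u r = exp (u r).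
Proof. intros Hr. unfold exp_ext. destruct (Rle_dec r 0); [lra | reflexivity]. Qed.

Lemma exp_ext_nonneg (N a : R) (u : R -> R) (r : R) : 0 <= exp_ext N a u r.
Proof.
  unfold exp_ext. destruct (Rle_dec r 0); [destruct (Req_EM_T N 0) |];
    try (apply Rlt_le, exp_pos); lra.
Qed.

Lemma exp_ext_continuous (N a : R) (u : R -> R) (r : R) :
  0 <= N -> behaviour_at_0 N a u -> (forall s, 0 < s -> continuous u s) -> 0 <= r ->
  continuous (exp_ext N a u) r.
Proof.
  intros HN Hb Hc [Hr | <-].
  - apply (continuous_ext_loc _ (fun s => exp (u s))).
    + generalize (open_gt 0 r Hr). apply filter_imp. intros s Hs. symmetry; apply exp_ext_pos, Hs.
    + apply (continuous_comp u exp), continuous_exp. apply Hc, Hr.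
  - apply behaviour_at_0_shift in Hb. apply filterlim_locally; intros eps.
    pose proof (cond_pos eps) as He.
    assert (Hright : exists d, 0 < d /\ forall s, 0 < s < d ->
              Rabs (exp (u s) - exp_ext N a u 0) < eps).
    { unfold exp_ext. destruct (Rle_dec 0 0); [| lra]. destruct (Req_EM_T N 0) as [-> | HN0].
      - assert (Hlim : filterlim (fun s => exp (u s)) (at_right 0) (locally (exp a))).
        { apply (filterlim_comp _ _ _ u exp _ (locally a)); [| apply continuous_exp].
          apply (filterlim_ext (fun r => u r - 2 * 0 * ln r)); [intros; ring | exact Hb]. }
        destruct (proj1 (filterlim_at_right_spec _ _ _) Hlim eps He) as [d [Hd H]].
        exists d; split; [exact Hd |]. intros s Hs; apply H; lra.
      - destruct (proj1 (filterlim_at_right_spec _ _ _) Hb 1 Rlt_0_1) as [d [Hd H]].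
        set (k := (ln eps - a - 1) / (2 * N)).
        exists (Rmin d (exp k)). split; [apply Rmin_glb_lt; [exact Hd | apply exp_pos] |].
        intros s Hs. pose proof (Rmin_l d (exp k)); pose proof (Rmin_r d (exp k)).
        specialize (H s ltac:(lra)). apply Rabs_def2 in H.
        assert (Hls : ln s < k) by (rewrite <- (ln_exp k); apply ln_increasing; lra).
        assert (HNk : 2 * N * k = ln eps - a - 1) by (unfold k; field; lra).
        assert (2 * N * ln s < 2 * N * k) by (apply Rmult_lt_compat_l; lra).
        rewrite Rminus_0_r, Rabs_right by (apply Rle_ge, Rlt_le, exp_pos).
        rewrite <- (exp_ln eps) by exact He. apply exp_increasing. lra. }
    destruct Hright as [d [Hd H]].
    exists (mkposreal d Hd); intros s Hs. change (Rabs (s - 0) < d) in Hs.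
    rewrite Rminus_0_r in Hs. apply Rabs_def2 in Hs.
    change (Rabs (exp_ext N a u s - exp_ext N a u 0) < eps).
    destruct (Rlt_le_dec 0 s) as [Hs0 | Hs0].
    + rewrite exp_ext_pos by exact Hs0. apply H; lra.
    + unfold exp_ext. destruct (Rle_dec s 0); [| lra]. destruct (Rle_dec 0 0); [| lra].
      rewrite Rminus_diag, Rabs_R0. exact He.
Qed.

Lemma entire_trajectory (N1 N2 : R) (alpha : R * R) (u v : R -> R) (r : R) :
  radial_solution_on N1 N2 alpha p_infty u v -> 0 < r ->
  trajectory u v (fun s => s * Derive u s) (fun s => s * Derive v s) r.
Proof. intros Hsol Hr. apply (solution_trajectory _ _ _ _ _ _ r Hsol Hr I). Qed.

Lemma flux_limits (N1 N2 : R) (alpha : R * R) (u v : R -> R) :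
  0 <= N1 -> 0 <= N2 -> radial_solution_on N1 N2 alpha p_infty u v ->
  filterlim (flux_shift N1 u) (at_right 0) (locally 0) /\
  filterlim (flux_shift N2 v) (at_right 0) (locally 0).
Proof.
  intros HN1 HN2 Hsol.
  destruct (solution_bounded_above N1 N2 alpha p_infty u v 1 HN1 HN2 Hsol I) as [M HM].
  destruct (solution_cut_solution _ _ _ _ _ _ 1 M Hsol Rlt_0_1 I) as [_ [_ [_ Hz]]]; [| exact Hz].
  intros r Hr; apply HM; lra.
Qed.

(** The hypothesis on values just to the right of [x] covers an interior maximum and the origin
    alike; at the origin the flux is known only through its limit. *)
Lemma flux_becomes_positive (p g : R -> R) (x d : R) :
  0 <= x -> 0 < d ->
  (forall r, x < r < x + d -> is_derive p r (r * g r) /\ 0 < g r) ->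
  (forall e, 0 < e -> exists c, 0 < c /\ forall r, x < r < x + c -> - e < p r) ->
  forall r, x < r < x + d -> 0 < p r.
Proof.
  intros Hx Hd H Hlim r Hr.
  assert (Hinc : forall s t, x < s < t -> t < x + d -> p s < p t).
  { intros s t Hs Ht. apply (derive_pos_lt p (fun y => y * g y)); [lra | |].
    - intros y Hy; apply H; lra.
    - intros y Hy. destruct (H y ltac:(lra)). apply Rmult_lt_0_compat; lra. }
  assert (Hm : 0 <= p ((x + r) / 2)).
  { apply Rnot_lt_le; intros Hneg.
    destruct (Hlim (- p ((x + r) / 2)) ltac:(lra)) as [c [Hc Hnear]].
    set (s := x + Rmin c ((r - x) / 2) / 2).
    assert (Hs : x < s < x + c /\ s < (x + r) / 2)
      by (unfold s, Rmin; destruct (Rle_dec _ _); lra).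
    specialize (Hnear s (proj1 Hs)). specialize (Hinc s ((x + r) / 2) ltac:(lra) ltac:(lra)). lra. }
  specialize (Hinc ((x + r) / 2) r ltac:(lra) ltac:(lra)). lra.
Qed.

(* At a maximum of [e^u] above [1] with [e^v <= e^u] the right-hand side [F1] is positive. *)
Lemma no_max_above_1 (N1 N2 : R) (alpha : R * R) (u v : R -> R) (x b : R) :
  0 <= N1 -> 0 <= N2 -> radial_solution_on N1 N2 alpha p_infty u v -> 0 <= x < b ->
  let U := exp_ext N1 (fst alpha) u in let V := exp_ext N2 (snd alpha) v in
  1 < U x -> V x <= U x -> (forall r, 0 <= r <= b -> U r <= U x) -> False.
Proof.
  intros HN1 HN2 Hsol Hx U V HU HVU Hmax.
  assert (Ht := fun r Hr => entire_trajectory _ _ _ _ _ r Hsol Hr).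
  pose proof (flux_limits _ _ _ _ _ HN1 HN2 Hsol) as [Hz _].
  set (p := fun s => s * Derive u s) in *. set (q := fun s => s * Derive v s) in *.
  destruct Hsol as [_ [_ [Hb1 Hb2]]].
  assert (CU : continuous U x).
  { apply exp_ext_continuous; [exact HN1 | exact Hb1 | | apply Hx].
    intros s Hs; apply (trajectory_continuous _ _ _ _ _ (Ht s Hs)). }
  assert (CV : continuous V x).
  { apply exp_ext_continuous; [exact HN2 | exact Hb2 | | apply Hx].
    intros s Hs; apply (trajectory_continuous _ _ _ _ _ (Ht s Hs)). }
  (* [cs_poly] is concave in its second argument, so on [[0, U]] it is bounded below by its end
     values [4 U^2 - 2 U] and [U^2 - U], both positive for [U > 1]. *)
  assert (HF : 0 < cs_poly (U x) (V x)).
  { pose proof (exp_ext_nonneg N2 (snd alpha) v x) as HV. fold V in HV. unfold cs_poly. nra. }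
  assert (CF : continuous (fun r => cs_poly (U r) (V r)) x) by (apply continuous_cs_poly; assumption).
  destruct (locally_lt (fun _ => 0) _ x (continuous_const _ _) CF HF) as [d0 Hd0].
  set (d := Rmin d0 (b - x)).
  assert (Hd : 0 < d /\ d <= d0 /\ d <= b - x).
  { pose proof (cond_pos d0). unfold d, Rmin; destruct (Rle_dec _ _); lra. }
  assert (Hp : forall r, x < r < x + d -> 0 < p r).
  { apply (flux_becomes_positive p (fun r => F1 (u r) (v r))); [lra | lra | |].
    - intros r Hr. split; [apply Ht; lra |].
      rewrite F1_cs_poly.
      rewrite <- (exp_ext_pos N1 (fst alpha) u r), <- (exp_ext_pos N2 (snd alpha) v r) by lra.
      apply Hd0. change (Rabs (r - x) < d0). rewrite Rabs_right; lra.
    (* At an interior maximum the comparison with points on the left gives [p >= 0]. At the origin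
       [U > 1] excludes [N1 > 0], where the extended exponential is 0, and for [N1 = 0] the flux
       tends to 0. *)
    - intros e He. destruct (proj1 Hx) as [Hx0 | Hx0].
      + assert (Hpx : 0 <= p x).
        { apply Rnot_lt_le; intros Hneg.
          assert (Hdu : is_derive (fun s => - u s) x (- (p x / x)))
            by apply (is_derive_opp u), Ht, Hx0.
          destruct (derive_pos_left _ _ _ Hdu) as [c Hc].
          { assert (0 < - p x / x) by (apply Rdiv_lt_0_compat; lra). unfold Rdiv in *; lra. }
          set (s := Rmax (x / 2) (x - c / 2)).
          assert (Hs : 0 < s < x /\ x - c < s).
          { pose proof (cond_pos c). unfold s, Rmax; destruct (Rle_dec _ _); lra. }
          specialize (Hc s ltac:(lra)). specialize (Hmax s ltac:(lra)).
          unfold U in Hmax; rewrite !exp_ext_pos in Hmax by lra.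
          assert (exp (u x) < exp (u s)) by (apply exp_increasing; lra). lra. }
        destruct (trajectory_continuous _ _ _ _ _ (Ht x Hx0)) as [_ [_ [Cp _]]].
        destruct (locally_lt (fun _ => - e) p x (continuous_const _ _) Cp ltac:(lra)) as [c Hc].
        exists c; split; [apply cond_pos |]. intros r Hr. apply Hc.
        change (Rabs (r - x) < c). rewrite Rabs_right; lra.
      + assert (HN0 : N1 = 0).
        { apply NNPP; intros HN0. unfold U, exp_ext in HU. rewrite <- Hx0 in HU.
          destruct (Rle_dec 0 0); [| lra]. destruct (Req_EM_T N1 0); [contradiction | lra]. }
        destruct (proj1 (filterlim_at_right_spec _ _ _) Hz e He) as [c [Hc Hnear]].
        exists c; split; [exact Hc |]. intros r Hr. specialize (Hnear r ltac:(lra)).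
        unfold flux_shift in Hnear. rewrite HN0 in Hnear. apply Rabs_def2 in Hnear.
        unfold p; lra. }
  set (m := x + d / 3). set (t := x + d / 2).
  assert (Hinc : forall s r, x < s < r -> r < x + d -> U s < U r).
  { intros s r Hs Hr. unfold U; rewrite !exp_ext_pos by lra. apply exp_increasing.
    apply (derive_pos_lt u (fun y => p y / y)); [lra | intros; apply Ht; lra |].
    intros y Hy. apply Rdiv_lt_0_compat; [apply Hp |]; lra. }
  assert (Hmt : U m < U t) by (apply Hinc; unfold m, t; lra).
  specialize (Hmax t ltac:(unfold t; lra)).
  (* At the origin [U x] is not a value of [e^u], so monotonicity is known only to the right of [x];
     continuity of [U] brings the contradiction to a point [s > x]. *)
  destruct (locally_lt (fun _ => U m) U x (continuous_const _ _) CU ltac:(lra)) as [c Hc].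
  set (s := x + Rmin (c / 2) (d / 6)).
  assert (Hs : x < s < m /\ s < x + c).
  { pose proof (cond_pos c). unfold s, m, Rmin; destruct (Rle_dec _ _); lra. }
  assert (Hsm : U s < U m) by (apply Hinc; unfold m in *; lra).
  assert (U m < U s); [| lra].
  apply Hc. change (Rabs (s - x) < c). rewrite Rabs_right; lra.
Qed.

Lemma radial_solution_swap (N1 N2 : R) (alpha : R * R) (T : Rbar) (u v : R -> R) :
  radial_solution_on N1 N2 alpha T u v ->
  radial_solution_on N2 N1 (snd alpha, fst alpha) T v u.
Proof.
  intros [HT [H [H1 H2]]]. split; [exact HT |]. split; [| split; assumption].
  intros r Hr HrT. destruct (H r Hr HrT) as [Hu Hv].
  rewrite F2_swap in Hv. rewrite <- (F2_swap (v r) (u r)) in Hu. split; assumption.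
Qed.

(** The extended exponentials attain their maxima on [[0, b]], where [b] is so large that both are
    below 1 at [b]. The larger of the two maxima satisfies the hypotheses of [no_max_above_1], up to
    exchanging the components. *)
Lemma non_topological_nonpos (N1 N2 : R) (alpha : R * R) (u v : R -> R) :
  0 <= N1 -> 0 <= N2 -> radial_solution_on N1 N2 alpha p_infty u v ->
  is_lim u p_infty m_infty -> is_lim v p_infty m_infty ->
  forall r, 0 < r -> u r <= 0 /\ v r <= 0.
Proof.
  intros HN1 HN2 Hsol Hu Hv r Hr.
  destruct (is_lim_m_infty_elim u 0 Hu) as [r1 Hr1].
  destruct (is_lim_m_infty_elim v 0 Hv) as [r2 Hr2].
  set (b := Rmax r (Rmax r1 r2) + 1).
  assert (Hb : r < b /\ r1 < b /\ r2 < b) by (unfold b, Rmax; repeat destruct (Rle_dec _ _); lra).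
  set (U := exp_ext N1 (fst alpha) u). set (V := exp_ext N2 (snd alpha) v).
  assert (Ht := fun r Hr => entire_trajectory _ _ _ _ _ r Hsol Hr).
  assert (HUb : U b < 1).
  { unfold U; rewrite exp_ext_pos by lra. rewrite <- exp_0. apply exp_increasing, Hr1; lra. }
  assert (HVb : V b < 1).
  { unfold V; rewrite exp_ext_pos by lra. rewrite <- exp_0. apply exp_increasing, Hr2; lra. }
  destruct (continuity_ab_maj U 0 b ltac:(lra)) as [x [HUx Hx]].
  { intros c Hc. apply continuity_pt_filterlim, exp_ext_continuous; [exact HN1 | apply Hsol | | lra].
    intros s Hs; apply (trajectory_continuous _ _ _ _ _ (Ht s Hs)). }
  destruct (continuity_ab_maj V 0 b ltac:(lra)) as [y [HVy Hy]].
  { intros c Hc. apply continuity_pt_filterlim, exp_ext_continuous; [exact HN2 | apply Hsol | | lra].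
    intros s Hs; apply (trajectory_continuous _ _ _ _ _ (Ht s Hs)). }
  assert (H1 : U x <= 1 /\ V y <= 1).
  { destruct (Rle_lt_dec (V y) (U x)) as [Hle | Hlt].
    - cut (U x <= 1); [lra |]. apply Rnot_lt_le; intros Hgt.
      apply (no_max_above_1 N1 N2 alpha u v x b HN1 HN2 Hsol).
      + split; [lra |]. destruct (Req_dec x b) as [-> | ]; lra.
      + exact Hgt.
      + apply Rle_trans with (2 := Hle). apply HVy, Hx.
      + exact HUx.
    - cut (V y <= 1); [lra |]. apply Rnot_lt_le; intros Hgt.
      apply (no_max_above_1 N2 N1 (snd alpha, fst alpha) v u y b HN2 HN1
        (radial_solution_swap _ _ _ _ _ _ Hsol)).
      + split; [lra |]. destruct (Req_dec y b) as [-> | ]; lra.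
      + exact Hgt.
      + apply Rle_trans with (2 := Rlt_le _ _ Hlt). apply HUx, Hy.
      + exact HVy. }
  assert (Hle : forall z, exp z <= 1 -> z <= 0).
  { intros z Hz. apply Rnot_lt_le; intros Hlt. apply exp_increasing in Hlt. rewrite exp_0 in Hlt; lra. }
  specialize (HUx r ltac:(lra)). specialize (HVy r ltac:(lra)).
  unfold U at 1 in HUx; unfold V at 1 in HVy; rewrite exp_ext_pos in HUx, HVy by exact Hr.
  split; apply Hle; lra.
Qed.

(** The limit is nonnegative for [N1, N2 >= 0], which is the information at the origin that
    [monotone_or_descending] requires. *)
Lemma flux_combination_limit (N1 N2 : R) (u v : R -> R) :
  filterlim (flux_shift N1 u) (at_right 0) (locally 0) ->
  filterlim (flux_shift N2 v) (at_right 0) (locally 0) ->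
  filterlim (fun r => 2 * (r * Derive u r) + r * Derive v r) (at_right 0)
    (locally (4 * N1 + 2 * N2)).
Proof.
  intros Hu Hv. apply filterlim_at_right_spec; intros e He.
  destruct (proj1 (filterlim_at_right_spec _ _ _) Hu (e / 3) ltac:(lra)) as [d1 [Hd1 H1]].
  destruct (proj1 (filterlim_at_right_spec _ _ _) Hv (e / 3) ltac:(lra)) as [d2 [Hd2 H2]].
  exists (Rmin d1 d2); split; [apply Rmin_glb_lt; assumption |].
  intros r Hr. pose proof (Rmin_l d1 d2); pose proof (Rmin_r d1 d2).
  specialize (H1 r ltac:(lra)); specialize (H2 r ltac:(lra)).
  unfold flux_shift in H1, H2. apply Rabs_def2 in H1; apply Rabs_def2 in H2.
  apply Rabs_def1; lra.
Qed.

Lemma nonpos_dichotomy (N1 N2 : R) (alpha : R * R) (u v : R -> R) :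
  0 <= N1 -> 0 <= N2 -> radial_solution_on N1 N2 alpha p_infty u v ->
  (forall r, 0 < r -> u r <= 0 /\ v r <= 0) ->
  let p := fun s => s * Derive u s in let q := fun s => s * Derive v s in
  (is_lim u p_infty 0 /\ is_lim v p_infty 0) \/
  exists r0, nonpos_trajectory u v p q r0 /\ forall r, r0 <= r -> descending p q r.
Proof.
  intros HN1 HN2 Hsol Hneg p q.
  assert (H : forall r, 0 < r -> trajectory u v p q r /\ u r <= 0 /\ v r <= 0).
  { intros r Hr. split; [apply (entire_trajectory _ _ _ _ _ r Hsol Hr) | apply Hneg, Hr]. }
  destruct (flux_limits _ _ _ _ _ HN1 HN2 Hsol) as [Hz Hw].
  pose proof (flux_combination_limit _ _ _ _ Hz Hw) as L1.
  pose proof (flux_combination_limit _ _ _ _ Hw Hz) as L2.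
  destruct (monotone_or_descending u v p q _ _ H L1 ltac:(lra) L2 ltac:(lra))
    as [Hmono | [r0 [Hr0 Hd]]].
  - left. apply (monotone_topological u v p q H Hmono).
  - right. exists r0.
    assert (Hnt : nonpos_trajectory u v p q r0).
    { split; [exact Hr0 |]. intros r Hr; apply H; lra. }
    split; [exact Hnt |]. apply (descending_forever u v p q r0 Hnt Hd).
Qed.

(** A strict condition on [u], [v] and their fluxes at a single radius [r]: energy below the rim of
    the well, position inside it, both fluxes negative. Continuous dependence at that radius then
    suffices for openness. *)
Definition trapped (r x y a b : R) : Prop :=
  (a * a + a * b + b * b) / (3 * (r * r)) + pot x y < 1 / 4 /\
  exp x + exp y < 1 / 2 /\ 2 * a + b < 0 /\ 2 * b + a < 0.

Lemma continuous_pot {T : UniformSpace} (f g : T -> R) (z : T) :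
  continuous f z -> continuous g z -> continuous (fun w => pot (f w) (g w)) z.
Proof.
  intros Hf Hg. apply continuous_Rexp in Hf. apply continuous_Rexp in Hg. unfold pot.
  assert (Hq : forall h : T -> R, continuous h z -> continuous (fun w => h w * (1 - h w)) z).
  { intros h Hh. apply continuous_Rmult; [exact Hh |].
    apply (continuous_Rminus (fun _ => 1)); [apply continuous_const | exact Hh]. }
  apply continuous_Rplus; [| apply continuous_Rmult; assumption].
  apply continuous_Rplus; [apply (Hq _ Hf) | apply (Hq _ Hg)].
Qed.

Lemma continuous_energy {T : UniformSpace} (r : R) (x y a b : T -> R) (z : T) :
  continuous x z -> continuous y z -> continuous a z -> continuous b z ->
  continuous (fun w => (a w * a w + a w * b w + b w * b w) / (3 * (r * r)) + pot (x w) (y w)) z.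
Proof.
  intros Hx Hy Ha Hb. apply continuous_Rplus; [| apply continuous_pot; assumption].
  apply (continuous_Rmult _ (fun _ => / (3 * (r * r)))); [| apply continuous_const].
  apply continuous_Rplus; [| apply continuous_Rmult; assumption].
  apply continuous_Rplus; apply continuous_Rmult; assumption.
Qed.

Lemma trapped_open (r x y a b : R) :
  trapped r x y a b ->
  exists e, 0 < e /\ forall x' y' a' b',
    Rabs (x' - x) < e -> Rabs (y' - y) < e -> Rabs (a' - a) < e -> Rabs (b' - b) < e ->
    trapped r x' y' a' b'.
Proof.
  intros [H1 [H2 [H3 H4]]].
  set (z := ((x, y), (a, b))).
  assert (Cx : continuous (fun w : (R * R) * (R * R) => fst (fst w)) z)
    by (apply (continuous_comp fst fst); apply continuous_fst).
  assert (Cy : continuous (fun w : (R * R) * (R * R) => snd (fst w)) z)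
    by (apply (continuous_comp fst snd); [apply continuous_fst | apply continuous_snd]).
  assert (Ca : continuous (fun w : (R * R) * (R * R) => fst (snd w)) z)
    by (apply (continuous_comp snd fst); [apply continuous_snd | apply continuous_fst]).
  assert (Cb : continuous (fun w : (R * R) * (R * R) => snd (snd w)) z)
    by (apply (continuous_comp snd snd); apply continuous_snd).
  assert (L : locally z (fun w : (R * R) * (R * R) =>
    trapped r (fst (fst w)) (snd (fst w)) (fst (snd w)) (snd (snd w)))).
  { pose proof (continuous_energy r _ _ _ _ _ Cx Cy Ca Cb) as CE.
    pose proof (continuous_Rplus _ _ _ (continuous_Rexp _ _ Cx) (continuous_Rexp _ _ Cy)) as CS.
    pose proof (continuous_Rplus _ _ _ (continuous_Rmult _ _ _ (continuous_const 2 z) Ca) Cb) as C1.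
    pose proof (continuous_Rplus _ _ _ (continuous_Rmult _ _ _ (continuous_const 2 z) Cb) Ca) as C2.
    unfold trapped. repeat apply filter_and.
    - exact (locally_lt _ _ z CE (continuous_const (1 / 4) z) H1).
    - exact (locally_lt _ _ z CS (continuous_const (1 / 2) z) H2).
    - exact (locally_lt _ _ z C1 (continuous_const 0 z) H3).
    - exact (locally_lt _ _ z C2 (continuous_const 0 z) H4). }
  destruct L as [e He]. exists e; split; [apply cond_pos |].
  intros x' y' a' b' Hx Hy Ha Hb.
  apply (He ((x', y'), (a', b'))). split; split; assumption.
Qed.

(** The flux signs come from the dichotomy. [kinetic_window] gives a late radius with [kin < 1/8],
    and exponentials below 1/32 keep [pot] below the other 1/8. *)
Lemma non_topological_trapped (N1 N2 : R) (alpha : R * R) (u v : R -> R) :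
  0 <= N1 -> 0 <= N2 -> radial_solution_on N1 N2 alpha p_infty u v ->
  is_lim u p_infty m_infty -> is_lim v p_infty m_infty ->
  exists r, 0 < r /\ trapped r (u r) (v r) (r * Derive u r) (r * Derive v r).
Proof.
  intros HN1 HN2 Hsol Hu Hv.
  pose proof (non_topological_nonpos _ _ _ _ _ HN1 HN2 Hsol Hu Hv) as Hneg.
  destruct (nonpos_dichotomy _ _ _ _ _ HN1 HN2 Hsol Hneg) as [[H0 _] | [r0 [Hnt Hd]]].
  { apply is_lim_unique in H0. apply is_lim_unique in Hu. rewrite Hu in H0. discriminate. }
  set (p := fun s => s * Derive u s) in *. set (q := fun s => s * Derive v s) in *.
  destruct (is_lim_m_infty_elim u (ln (1 / 32)) Hu) as [r1 Hr1].
  destruct (is_lim_m_infty_elim v (ln (1 / 32)) Hv) as [r2 Hr2].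
  destruct (kinetic_window u v p q r0 (1 / 8) 2 Hnt) as [R1 [HR1 HK]]; [lra | lra |].
  destruct Hnt as [Hr0 Hnt].
  set (R2 := Rmax R1 (Rmax r1 r2) + 1).
  assert (HR2 : R1 < R2 /\ r1 < R2 /\ r2 < R2)
    by (unfold R2, Rmax; repeat destruct (Rle_dec _ _); lra).
  assert (exists r, R2 <= r /\ kin p q r < 1 / 8) as [r [Hr Hkin]].
  { apply NNPP; intros Hno. apply (HK R2 ltac:(lra)). intros s Hs.
    apply Rnot_lt_le; intros Hlt. apply Hno; exists s; split; [lra | exact Hlt]. }
  exists r; split; [lra |].
  assert (HU : exp (u r) < 1 / 32).
  { rewrite <- (exp_ln (1 / 32)) by lra. apply exp_increasing, Hr1; lra. }
  assert (HV : exp (v r) < 1 / 32).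
  { rewrite <- (exp_ln (1 / 32)) by lra. apply exp_increasing, Hr2; lra. }
  split; [| split; [lra | apply (Hd r); lra]].
  change (kin p q r + pot (u r) (v r) < 1 / 4).
  pose proof (exp_pos (u r)); pose proof (exp_pos (v r)). unfold pot. nra.
Qed.

(* On the line [e^u + e^v = 1/2] the potential is at least [1/4], so it bounds a potential well. *)
Lemma trapped_well (u v p q : R -> R) (r0 b : R) :
  0 < r0 -> (forall r, r0 <= r <= b -> trajectory u v p q r) ->
  energy u v p q r0 < 1 / 4 -> exp (u r0) + exp (v r0) < 1 / 2 ->
  forall r, r0 <= r <= b -> exp (u r) + exp (v r) < 1 / 2.
Proof.
  intros Hr0 Ht HE H0. apply real_induction; [| exact H0 |].
  - intros x Hx Hlt. destruct (trajectory_continuous _ _ _ _ x (Ht x Hx)) as [Cu [Cv _]].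
    apply (locally_lt (fun s => exp (u s) + exp (v s)) (fun _ => 1 / 2));
      [| apply continuous_const | exact Hlt].
    apply continuous_Rplus; apply continuous_Rexp; assumption.
  - intros x Hx Hs. destruct (trajectory_continuous _ _ _ _ x (Ht x ltac:(lra))) as [Cu [Cv _]].
    assert (Hle : exp (u x) + exp (v x) - 1 / 2 <= 0).
    { apply (limit_nonpos (fun s => exp (u s) + exp (v s) - 1 / 2) r0 x); [lra | |].
      - apply (continuous_minus (fun s => exp (u s) + exp (v s)) (fun _ => 1 / 2));
          [| apply continuous_const].
        apply continuous_Rplus; apply continuous_Rexp; assumption.
      - intros s Hs'. specialize (Hs s Hs'). lra. }
    destruct (Req_dec (exp (u x) + exp (v x)) (1 / 2)) as [He | He]; [| lra].
    pose proof (energy_decreasing u v p q r0 x Hr0 ltac:(lra) ltac:(intros; apply Ht; lra)) as HEx.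
    unfold energy at 1 in HEx. pose proof (kin_nonneg p q x ltac:(lra)).
    assert (1 / 4 <= pot (u x) (v x)); [| lra].
    unfold pot. pose proof (exp_pos (u x)); pose proof (exp_pos (v x)).
    replace (exp (v x)) with (1 / 2 - exp (u x)) in * by lra. nra.
Qed.

(** The well bounds the solution, which makes it entire and nonpositive from [r0] on, so
    [descending_limits] applies. The gap between the energy and 1/4 keeps [e^u] and [e^v] uniformly
    below 1/2 and rules out the mixed-type limits. *)
Lemma trapped_non_topological (N1 N2 : R) (alpha : R * R) (T : Rbar) (u v : R -> R) (r0 : R) :
  0 <= N1 -> 0 <= N2 -> the_radial_solution N1 N2 alpha T u v -> 0 < r0 -> Rbar_lt r0 T ->
  trapped r0 (u r0) (v r0) (r0 * Derive u r0) (r0 * Derive v r0) ->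
  non_topological T u v.
Proof.
  intros HN1 HN2 Hthe Hr0 Hr0T [H1 [H2 Hd0]]. pose proof (proj1 Hthe) as Hsol.
  set (p := fun s => s * Derive u s). set (q := fun s => s * Derive v s).
  change (energy u v p q r0 < 1 / 4) in H1. change (descending p q r0) in Hd0.
  assert (Hwell : forall r, r0 <= r -> Rbar_lt r T -> exp (u r) + exp (v r) < 1 / 2).
  { intros r Hr HrT. apply (trapped_well u v p q r0 r); [exact Hr0 | | exact H1 | exact H2 | lra].
    intros s Hs. apply (solution_trajectory _ _ _ _ _ _ s Hsol); [lra |].
    apply Rbar_le_lt_trans with (2 := HrT); simpl; lra. }
  assert (Hwell' : forall r, r0 <= r -> Rbar_lt r T -> u r <= 0 /\ v r <= 0).
  { intros r Hr HrT. specialize (Hwell r Hr HrT).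
    pose proof (exp_pos (u r)); pose proof (exp_pos (v r)).
    split; apply Rnot_lt_le; intros Hlt; apply exp_increasing in Hlt; rewrite exp_0 in Hlt; lra. }
  assert (HT : T = p_infty).
  { destruct (solution_bounded_above _ _ _ _ _ _ r0 HN1 HN2 Hsol Hr0T) as [M HM].
    apply (bounded_above_entire N1 N2 alpha T u v (Rmax M 0) Hthe).
    intros r Hr HrT. pose proof (Rmax_l M 0); pose proof (Rmax_r M 0).
    destruct (Rle_lt_dec r r0) as [Hle | Hlt].
    - specialize (HM r ltac:(lra)). lra.
    - specialize (Hwell' r ltac:(lra) HrT). lra. }
  subst T. split; [reflexivity |].
  assert (Ht := fun r Hr => entire_trajectory _ _ _ _ _ r Hsol Hr). fold p q in Ht.
  assert (Hnt : nonpos_trajectory u v p q r0).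
  { split; [exact Hr0 |]. intros r Hr. split; [apply Ht; lra | apply Hwell'; [exact Hr | exact I]]. }
  set (m := 1 / 4 - energy u v p q r0).
  (* For [y = 1/2 - e^u - e^v] the energy gives [y^2 >= m]; since [0 < y < 1/2], also
     [y / 2 >= y^2], hence [y >= 2 m]. *)
  assert (Hgap : forall r, r0 <= r -> exp (u r) + exp (v r) <= 1 / 2 - 2 * m).
  { intros r Hr. specialize (Hwell r Hr I).
    pose proof (energy_decreasing u v p q r0 r Hr0 Hr ltac:(intros; apply Ht; lra)) as HE.
    unfold energy at 1 in HE. pose proof (kin_nonneg p q r ltac:(lra)).
    pose proof (exp_pos (u r)) as HU; pose proof (exp_pos (v r)) as HV.
    assert (Hpot : pot (u r) (v r) <= 1 / 4 - m) by (unfold m; lra).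
    unfold pot in Hpot. set (U := exp (u r)) in *; set (V := exp (v r)) in *.
    assert (0 < U * V) by (apply Rmult_lt_0_compat; assumption).
    assert (m <= (1 / 2 - (U + V)) * (1 / 2 - (U + V))) by lra.
    nra. }
  assert (Hno : forall w : R -> R, (forall r, r0 <= r -> exp (w r) <= 1 / 2 - 2 * m) ->
    ~ is_lim w p_infty (ln (1 / 2))).
  { intros w Hw Hlim. apply is_lim_exp_comp in Hlim. rewrite exp_ln in Hlim by lra.
    pose proof (is_lim_p_infty_le _ _ _ r0 Hlim (fun r Hr => Hw r (Rlt_le _ _ Hr))) as Hle.
    unfold m in Hle. lra. }
  destruct (descending_limits u v p q r0 Hnt (descending_forever u v p q r0 Hnt Hd0))
    as [H | [[Hu _] | [_ Hv]]]; [exact H | exfalso | exfalso].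
  - apply (Hno u); [| exact Hu]. intros r Hr. specialize (Hgap r Hr).
    pose proof (exp_pos (v r)). lra.
  - apply (Hno v); [| exact Hv]. intros r Hr. specialize (Hgap r Hr).
    pose proof (exp_pos (u r)). lra.
Qed.

(** * Openness of [Omega] and solutions on its boundary *)

Lemma Omega_open (N1 N2 : R) : 0 <= N1 -> 0 <= N2 -> open (Omega N1 N2).
Proof.
  intros HN1 HN2 alpha [T [u [v [Hthe [HT [Hu Hv]]]]]].
  unfold entire in HT. subst T. pose proof (proj1 Hthe) as Hsol.
  destruct (non_topological_trapped _ _ _ _ _ HN1 HN2 Hsol Hu Hv) as [r0 [Hr0 Htrap]].
  destruct (trapped_open _ _ _ _ _ Htrap) as [e [He Hopen]].
  destruct (radial_solution_dependence N1 N2 alpha p_infty u v r0 e HN1 HN2 Hsol Hr0 I He)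
    as [d [Hd Hdep]].
  exists (mkposreal d Hd). intros alpha' [Ha1 Ha2].
  destruct (Hdep alpha' Ha1 Ha2) as [t [u' [v' [Ht [Hsol' [K1 [K2 [K3 K4]]]]]]]].
  destruct (the_radial_solution_exists N1 N2 alpha' HN1 HN2) as [T [u1 [v1 Hthe']]].
  destruct (proj2 Hthe' _ _ _ Hsol') as [HtT Heq]. simpl in Heq.
  exists T, u1, v1. split; [exact Hthe' |].
  apply (trapped_non_topological N1 N2 alpha' T u1 v1 r0 HN1 HN2 Hthe' Hr0).
  { apply Rbar_lt_le_trans with (2 := HtT). exact Ht. }
  destruct (Heq r0 Hr0 Ht) as [E1 E2].
  (* Continuous dependence speaks of a solution on [(0, t)], trapping of the maximal one. They agree
     near [r0], so their derivatives there agree as well. *)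
  assert (Hloc : locally r0 (fun s => u' s = u1 s /\ v' s = v1 s)).
  { apply (locally_open_interval _ 0 t); [lra |]. intros s Hs; apply Heq; apply Hs. }
  assert (E3 : Derive u' r0 = Derive u1 r0).
  { apply Derive_ext_loc. revert Hloc; apply filter_imp; tauto. }
  assert (E4 : Derive v' r0 = Derive v1 r0).
  { apply Derive_ext_loc. revert Hloc; apply filter_imp; tauto. }
  rewrite <- E1, <- E2, <- E3, <- E4. apply Hopen; assumption.
Qed.

(** Arbitrarily close to [alpha] there are points of [Omega], whose solutions are nonpositive by the
    maximum principle; continuous dependence at the single radius [r] passes the sign to the
    limit. *)
Lemma boundary_nonpos (N1 N2 : R) (alpha : R * R) (T : Rbar) (u v : R -> R) :
  0 <= N1 -> 0 <= N2 -> boundary (Omega N1 N2) alpha ->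
  radial_solution_on N1 N2 alpha T u v ->
  forall r, 0 < r -> Rbar_lt r T -> u r <= 0 /\ v r <= 0.
Proof.
  intros HN1 HN2 Hbd Hsol r Hr HrT.
  assert (Hclose : forall e, 0 < e -> u r < e /\ v r < e).
  { intros e He.
    destruct (radial_solution_dependence N1 N2 alpha T u v r e HN1 HN2 Hsol Hr HrT He)
      as [d [Hd Hdep]].
    destruct (Hbd (ball alpha (mkposreal d Hd)) (locally_ball alpha _)) as [[alpha' [[Ha1 Ha2] HO]] _].
    destruct (Hdep alpha' Ha1 Ha2) as [t [u' [v' [Ht [Hsol' [K1 [K2 _]]]]]]].
    destruct HO as [T' [u1 [v1 [Hthe [HT' [Hu1 Hv1]]]]]].
    unfold entire in HT'. subst T'.
    destruct (proj2 Hthe _ _ _ Hsol') as [_ Heq]. destruct (Heq r Hr Ht) as [E1 E2].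
    destruct (non_topological_nonpos _ _ _ _ _ HN1 HN2 (proj1 Hthe) Hu1 Hv1 r Hr) as [N1' N2'].
    apply Rabs_def2 in K1; apply Rabs_def2 in K2. lra. }
  split; apply Rnot_lt_le; intros Hlt; destruct (Hclose _ Hlt); lra.
Qed.

Theorem theorem1p8 :
  forall N1 N2 : R, 0 <= N1 -> 0 <= N2 ->
    open (Omega N1 N2) /\
    forall alpha : R * R, boundary (Omega N1 N2) alpha ->
      exists (T : Rbar) (u v : R -> R),
        the_radial_solution N1 N2 alpha T u v /\
        (topological T u v \/ mixed_type T u v).
Proof.
  intros N1 N2 HN1 HN2. split; [apply Omega_open; assumption |].
  intros alpha Hbd.
  destruct (the_radial_solution_exists N1 N2 alpha HN1 HN2) as [T [u [v Hthe]]].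
  exists T, u, v. split; [exact Hthe |].
  pose proof (boundary_nonpos N1 N2 alpha T u v HN1 HN2 Hbd (proj1 Hthe)) as Hneg.
  assert (HT : T = p_infty) by apply (bounded_above_entire N1 N2 alpha T u v 0 Hthe Hneg).
  subst T.
  assert (Hneg' : forall r, 0 < r -> u r <= 0 /\ v r <= 0)
    by (intros r Hr; apply Hneg; [exact Hr | exact I]).
  destruct (nonpos_dichotomy _ _ _ _ _ HN1 HN2 (proj1 Hthe) Hneg') as [Htop | [r0 [Hnt Hd]]].
  { left. split; [reflexivity | exact Htop]. }
  destruct (descending_limits _ _ _ _ _ Hnt Hd) as [Hnon | Hmix].
  - exfalso.
    assert (HO : Omega N1 N2 alpha).
    { exists p_infty, u, v. split; [exact Hthe | split; [reflexivity | exact Hnon]]. }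
    destruct (Hbd _ (Omega_open N1 N2 HN1 HN2 alpha HO)) as [_ [y [Hy Hny]]].
    exact (Hny Hy).
  - right. split; [reflexivity | exact Hmix].
Qed.
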